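(* Let $\Omega\subset\mathbb C^2$ be a $\mathbb C$-convex domain containing no affine complex lines, let $p\in\partial\Omega$, let $X$ be a unit vector in the direction of $T^{\mathbb C}_p\partial\Omega$, and let $S\subset T^{\mathbb C}_p\partial\Omega\cap\partial\Omega$ be a line segment containing $p$ such that $\partial\Omega$ is $\mathcal C^1$-smooth at the points of $S$ and $T^{\mathbb R}_p\partial\Omega=T^{\mathbb R}_s\partial\Omega$ for each $s\in S$. Suppose that there are $\delta>0$ and a function $H:[0,\delta]\to\mathbb R$ such that $\delta_\Omega(s_r;X)\ge H(r)$ for all $s\in S$ and $r\in(0,\delta)$, and $$\int_0^\delta\frac{H(r)}{r}\,dr=\infty .$$ Then $\Omega$ fails the visibility property. Explicitly, there exists $\lambda>1$ such that for any $s\in S$, $\Omega$ has $(\lambda,0)$-geodesics $\gamma_j:[0,1]\to\Omega$ $(j\in\mathbb N)$ with $\max_{t\in[0,1]}\delta_\Omega(\gamma_j(t))\to0$, $\gamma_j(0)\to p$ and $\gamma_j(1)\to s$ as $j\to\infty$.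
   Context: A domain $\Omega\subset\mathbb C^n$ is $\mathbb C$-convex if its intersection with any affine complex line is connected and simply connected. $\Delta$ is the unit disc, $k_\Omega$ is the Kobayashi pseudodistance and $\kappa_\Omega(z;v)=\inf\{1/r: r>0,\ \exists \varphi\in\mathcal O(r\Delta,\Omega),\ \varphi(0)=z,\ \varphi'(0)=v\}$ is the Kobayashi-Royden pseudometric. $\delta_\Omega(z)$ is the Euclidean distance from $z$ to $\partial\Omega$, and $\delta_\Omega(z;v):=\sup\{r>0: z+\alpha v\in\Omega \text{ for all }\alpha\in r\Delta\}$. $T^{\mathbb R}_p\partial\Omega$ is the affine real tangent space to $\partial\Omega$ at $p$, and $T^{\mathbb C}_p\partial\Omega=p+(F^{\mathbb R}_p\partial\Omega\cap iF^{\mathbb R}_p\partial\Omega)$ is the affine complex tangent space, where $F^{\mathbb R}_p\partial\Omega$ is the linear real tangent space. For $s\in S$, $s_r:=s+r\eta_s$, where $\eta_s$ is the inner unit normal to $\partial\Omega$ at $s$. Line segments are nondegenerate. For an absolutely continuous curve $\gamma:I\to\Omega$, $l^\kappa_\Omega(\gamma)=\int_I\kappa_\Omega(\gamma(t);\gamma'(t))\,dt$. For $\lambda\ge1,\epsilon\ge0$, an absolutely continuous $\gamma:[0,1]\to\Omega$ is a $(\lambda,\epsilon)$-geodesic if $l^\kappa_\Omega(\gamma|_{[t_1,t_2]})\le\lambda k_\Omega(\gamma(t_1),\gamma(t_2))+\epsilon$ for all $t_1\le t_2$ in $[0,1]$. For $\Omega$ hyperbolic (i.e. $k_\Omega$ is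 a distance) and distinct $p,q\in\partial\Omega$, $\{p,q\}$ is a $(\lambda,\epsilon)$-visible pair if there are neighbourhoods $U_p,U_q$ of $p,q$ and $K\subset\subset\Omega$ such that every $(\lambda,\epsilon)$-geodesic joining a point of $\Omega\cap U_p$ to a point of $\Omega\cap U_q$ meets $K$. $\Omega$ satisfies the visibility property if every pair of distinct boundary points is a $(\lambda,\epsilon)$-visible pair for all $\lambda\ge1$, $\epsilon\ge0$. *)

(* Defs.v *)
(* C^n is 'rV[R[i]]_n, over an arbitrary R : realType. *)
From HB Require Import structures.
From mathcomp Require Import all_boot all_order all_algebra.
From mathcomp Require Import all_classical all_reals all_analysis.
From mathcomp Require Import complex.
Import Order.TTheory GRing.Theory Num.Theory numFieldNormedType.Exports.

Set Implicit Arguments.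
Unset Strict Implicit.
Unset Printing Implicit Defensive.

Local Open Scope classical_set_scope.
Local Open Scope ring_scope.
Local Open Scope complex_scope.

(* The usual topology of the complex plane (modulus norm).  The topology it
   induces on 'rV[R[i]]_n is the product one, i.e. the Euclidean topology of
   C^n; over the field R[i], [derivable f z 1] for f : R[i] -> R[i] is complex
   differentiability at z. *)
HB.instance Definition _ (R : rcfType) := NormedModule.copy R[i] R[i]^o.

(* Re <z, w>, and the associated Euclidean norm (the library norm of row
   vectors is the sup norm, which is not the one needed here). *)
Definition rdot (R : realType) (n : nat) (z w : 'rV[R[i]]_n) : R :=
  \sum_(i < n) (complex.Re (z 0 i) * complex.Re (w 0 i)
                + complex.Im (z 0 i) * complex.Im (w 0 i)).

Definition enorm (R : realType) (n : nat) (z : 'rV[R[i]]_n) : R :=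
  Num.sqrt (rdot z z).

Definition boundary (T : topologicalType) (A : set T) : set T :=
  closure A `\` interior A.

Definition domain (R : realType) (n : nat) (Omega : set 'rV[R[i]]_n) : Prop :=
  [/\ open Omega, connected Omega & Omega !=set0].

(* Every loop in A is homotopic to a constant loop, in A and relative to its
   base point.  Connectedness is required separately in [C_convex]. *)
Definition null_homotopic_loops (R : realType) (n : nat)
    (A : set 'rV[R[i]]_n) : Prop :=
  forall g : R -> 'rV[R[i]]_n,
    {within `[0, 1], continuous g} ->
    (forall t, `[0, 1]%classic t -> A (g t)) ->
    g 0 = g 1 ->
    exists h : R * R -> 'rV[R[i]]_n,
      [/\ {within `[0, 1] `*` `[0, 1], continuous h},
          forall u t, `[0, 1]%classic u -> `[0, 1]%classic t -> A (h (u, t)),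
          forall t, `[0, 1]%classic t -> h (0, t) = g t,
          forall t, `[0, 1]%classic t -> h (1, t) = g 0 &
          forall u, `[0, 1]%classic u -> h (u, 0) = g 0 /\ h (u, 1) = g 0].

Definition complex_line (R : realType) (n : nat) (a v : 'rV[R[i]]_n) :
    set 'rV[R[i]]_n :=
  [set a + c *: v | c in [set: R[i]]].

(* As usual, the empty intersection is allowed. *)
Definition C_convex (R : realType) (n : nat) (Omega : set 'rV[R[i]]_n) : Prop :=
  forall a v : 'rV[R[i]]_n, v != 0 ->
    connected (Omega `&` complex_line a v) /\
    null_homotopic_loops (Omega `&` complex_line a v).

Definition contains_no_complex_line (R : realType) (n : nat)
    (Omega : set 'rV[R[i]]_n) : Prop :=
  forall a v : 'rV[R[i]]_n, v != 0 -> ~ (complex_line a v `<=` Omega).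

(* phi is a holomorphic map from the disc r Delta to Omega; holomorphy in the
   target C^n is componentwise, and values off the disc are irrelevant. *)
Definition holo_disc (R : realType) (n : nat) (r : R)
    (Omega : set 'rV[R[i]]_n) (phi : R[i] -> 'rV[R[i]]_n) : Prop :=
  forall z : R[i], `|z| < r%:C ->
    Omega (phi z) /\ forall i : 'I_n, derivable (fun x => phi x 0 i) z 1.

Definition kobayashi_royden (R : realType) (n : nat)
    (Omega : set 'rV[R[i]]_n) (z v : 'rV[R[i]]_n) : \bar R :=
  ereal_inf [set (r^-1)%:E | r in [set r : R | 0 < r /\
    exists phi : R[i] -> 'rV[R[i]]_n,
      [/\ holo_disc r Omega phi, phi 0 = z &
          forall i : 'I_n, derive1 (fun x => phi x 0 i) 0 = v 0 i]]].

(* artanh of the pseudo-hyperbolic distance.  With this normalisation the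
   infinitesimal metric is |dz| / (1 - |z|^2), in agreement with
   kobayashi_royden, which gives |v| at the centre of the unit disc. *)
Definition poincare_dist (R : realType) (a b : R[i]) : R :=
  let m := ComplexField.Normc.normc ((a - b) / (1 - b^* * a)) in
  ln ((1 + m) / (1 - m)) / 2.

(* Kobayashi's original definition, by chains of analytic discs. *)
Definition kobayashi (R : realType) (n : nat)
    (Omega : set 'rV[R[i]]_n) (z w : 'rV[R[i]]_n) : \bar R :=
  ereal_inf [set L%:E | L in [set L : R |
    exists (m : nat) (x : nat -> 'rV[R[i]]_n)
           (phi : nat -> R[i] -> 'rV[R[i]]_n) (a b : nat -> R[i]),
      [/\ x 0%N = z, x m.+1 = w,
          forall j, (j <= m)%N ->
            [/\ holo_disc 1 Omega (phi j), `|a j| < 1, `|b j| < 1,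
                phi j (a j) = x j & phi j (b j) = x j.+1] &
          L = \sum_(j < m.+1) poincare_dist (a j) (b j)]]].

(* The boundary is nonempty wherever this is used. *)
Definition bdist (R : realType) (n : nat)
    (Omega : set 'rV[R[i]]_n) (z : 'rV[R[i]]_n) : R :=
  inf [set enorm (z - w) | w in boundary Omega].

(* Extended-real valued; for z outside Omega the set is empty and the value
   is -oo, so that a lower bound by a real number entails that z is in
   Omega. *)
Definition dir_bdist (R : realType) (n : nat)
    (Omega : set 'rV[R[i]]_n) (z v : 'rV[R[i]]_n) : \bar R :=
  ereal_sup [set r%:E | r in [set r : R | 0 < r /\
    forall c : R[i], `|c| < r%:C -> Omega (z + c *: v)]].

(* Derivative of a real function on C^n in the real direction v. *)
Definition rderive (R : realType) (n : nat)
    (rho : 'rV[R[i]]_n -> R) (v z : 'rV[R[i]]_n) : R :=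
  derive1 (fun t : R => rho (z + t%:C *: v)) 0.

(* C^1 in the real sense: all real directional derivatives exist and are
   continuous on the open set U. *)
Definition C1_on (R : realType) (n : nat)
    (U : set 'rV[R[i]]_n) (rho : 'rV[R[i]]_n -> R) : Prop :=
  forall (v z : 'rV[R[i]]_n), U z ->
    derivable (fun t : R => rho (z + t%:C *: v)) 0 1 /\
    {for z, continuous (rderive rho v)}.

Definition defining_function (R : realType) (n : nat)
    (Omega : set 'rV[R[i]]_n) (p : 'rV[R[i]]_n) (rho : 'rV[R[i]]_n -> R) :
    Prop :=
  exists U : set 'rV[R[i]]_n,
    [/\ open U, U p, C1_on U rho,
        forall z, U z -> exists v, rderive rho v z != 0 &
        forall z, U z -> (Omega z <-> rho z < 0) /\
                         (boundary Omega z <-> rho z = 0)].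

Definition C1_smooth_boundary_at (R : realType) (n : nat)
    (Omega : set 'rV[R[i]]_n) (p : 'rV[R[i]]_n) : Prop :=
  exists rho, defining_function Omega p rho.

(* F^R_p : kernel at p of the differential of a defining function; it does not
   depend on the choice of that function. *)
Definition real_tangent_dir (R : realType) (n : nat)
    (Omega : set 'rV[R[i]]_n) (p : 'rV[R[i]]_n) : set 'rV[R[i]]_n :=
  [set v | exists2 rho, defining_function Omega p rho & rderive rho v p = 0].

Definition complex_tangent_dir (R : realType) (n : nat)
    (Omega : set 'rV[R[i]]_n) (p : 'rV[R[i]]_n) : set 'rV[R[i]]_n :=
  real_tangent_dir Omega p `&`
  [set 'i *: v | v in real_tangent_dir Omega p].

Definition real_tangent_space (R : realType) (n : nat)
    (Omega : set 'rV[R[i]]_n) (p : 'rV[R[i]]_n) : set 'rV[R[i]]_n :=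
  [set p + v | v in real_tangent_dir Omega p].

Definition complex_tangent_space (R : realType) (n : nat)
    (Omega : set 'rV[R[i]]_n) (p : 'rV[R[i]]_n) : set 'rV[R[i]]_n :=
  [set p + v | v in complex_tangent_dir Omega p].

Definition is_inner_unit_normal (R : realType) (n : nat)
    (Omega : set 'rV[R[i]]_n) (s eta : 'rV[R[i]]_n) : Prop :=
  [/\ enorm eta = 1,
      forall v, real_tangent_dir Omega s v -> rdot v eta = 0 &
      \forall r \near (0 : R)^'+, Omega (s + r%:C *: eta)].

(* eta_s: unique where the boundary is C^1, and 0 by default if none exists. *)
Definition inner_unit_normal (R : realType) (n : nat)
    (Omega : set 'rV[R[i]]_n) (s : 'rV[R[i]]_n) : 'rV[R[i]]_n :=
  xget 0 [set eta | is_inner_unit_normal Omega s eta].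

(* s_r *)
Definition inner_shift (R : realType) (n : nat)
    (Omega : set 'rV[R[i]]_n) (s : 'rV[R[i]]_n) (r : R) : 'rV[R[i]]_n :=
  s + r%:C *: inner_unit_normal Omega s.

Definition line_segment (R : realType) (n : nat)
    (S : set 'rV[R[i]]_n) : Prop :=
  exists a b : 'rV[R[i]]_n, a != b /\
    S = [set a + t%:C *: (b - a) | t in `[(0 : R), 1]%classic].

(* Curves are total functions on R used on [0, 1] only. *)
Definition abs_continuous (R : realType) (n : nat)
    (g : R -> 'rV[R[i]]_n) : Prop :=
  forall e : R, 0 < e -> exists2 d : R, 0 < d &
    forall (N : nat) (a b : 'I_N -> R),
      (forall k, [/\ 0 <= a k, a k <= b k & b k <= 1]) ->
      (forall k l, k != l -> b k <= a l \/ b l <= a k) ->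
      \sum_(k < N) (b k - a k) < d ->
      \sum_(k < N) enorm (g (b k) - g (a k)) < e.

(* Componentwise; it exists almost everywhere for an absolutely continuous
   curve, and the remaining points do not matter for the integral below. *)
Definition velocity (R : realType) (n : nat)
    (g : R -> 'rV[R[i]]_n) (t : R) : 'rV[R[i]]_n :=
  \row_(i < n) (derive1 (fun u => complex.Re (g u 0 i)) t
                +i* derive1 (fun u => complex.Im (g u 0 i)) t).

Definition kobayashi_length (R : realType) (n : nat)
    (Omega : set 'rV[R[i]]_n) (g : R -> 'rV[R[i]]_n) (t1 t2 : R) : \bar R :=
  (\int[@lebesgue_measure R]_(t in `[t1, t2])
     kobayashi_royden Omega (g t) (velocity g t))%E.

Definition geodesic (R : realType) (n : nat) (Omega : set 'rV[R[i]]_n)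
    (lambda epsilon : R) (g : R -> 'rV[R[i]]_n) : Prop :=
  [/\ abs_continuous g,
      forall t, `[0, 1]%classic t -> Omega (g t) &
      forall t1 t2, 0 <= t1 -> t1 <= t2 -> t2 <= 1 ->
        (kobayashi_length Omega g t1 t2 <=
         lambda%:E * kobayashi Omega (g t1) (g t2) + epsilon%:E)%E].

Definition visible_pair (R : realType) (n : nat) (Omega : set 'rV[R[i]]_n)
    (lambda epsilon : R) (p q : 'rV[R[i]]_n) : Prop :=
  exists Up Uq K : set 'rV[R[i]]_n,
    [/\ nbhs p Up, nbhs q Uq, compact (closure K), closure K `<=` Omega &
        forall g, geodesic Omega lambda epsilon g ->
          (Omega `&` Up) (g 0) -> (Omega `&` Uq) (g 1) ->
          exists2 t, `[0, 1]%classic t & K (g t)].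

Definition visibility_property (R : realType) (n : nat)
    (Omega : set 'rV[R[i]]_n) : Prop :=
  forall p q, boundary Omega p -> boundary Omega q -> p != q ->
  forall lambda epsilon : R, 1 <= lambda -> 0 <= epsilon ->
    visible_pair Omega lambda epsilon p q.

(* Main.v *)
(* Let eta be the inner normal, x and w the complex coordinates along X and eta.

   Lower bound. The domain misses the complex tangent line w = 0. On every complex
   line through p, C-convexity makes w a function with two square roots, and
   continuity in the line selects a global branch of sqrt w; it is positive on small
   positive w. Hence sqrt w omits an interval [-a, 0], and sqrt (sqrt w / (sqrt w + a))
   maps the domain holomorphically to the right half-plane. By the Schwarz-Pick lemma
   k is at least |ln w1 - ln w2| / 16 for small positive w1, w2.

   Upper bound. If a C-convex set contains the discs of radii h and k around a point
   in two coordinate directions, it contains the diamond |x| / h + |w| / k < 1: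
   otherwise turn a complex line about a missing point, with slope of modulus k / h.
   Its section of the domain is simply connected, so the square roots of two points
   of the section are joined up to a sign that stays constant, whereas the points can
   be made to turn so that this sign flips. A curve descending like w = exp (- t)
   and moving along S with velocity at most a multiple of H (w) has therefore bounded
   speed. As the integral of H (r) / r diverges, such a curve can cross S at an
   arbitrarily small height, and by the lower bound it is a geodesic up to a fixed
   factor. *)
Require Import Defs.
From mathcomp Require Import all_boot all_order all_algebra.
From mathcomp Require Import all_classical all_reals all_analysis.
From mathcomp Require Import measurable_realfun.
From mathcomp Require Import complex.
From mathcomp Require Import ring lra.
Import Order.TTheory GRing.Theory Num.Theory numFieldNormedType.Exports.
Local Open Scope classical_set_scope.
Local Open Scope ring_scope.
Set Implicit Arguments.
Unset Strict Implicit.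
Unset Printing Implicit Defensive.
Local Open Scope complex_scope.
Import ComplexField.Normc.

(** Simple connectedness is available only as contraction of loops, so all the topology is carried
    by a sign: in a connected open set that omits 0 and in which loops contract, a root of one point
    is joined to exactly one of the two roots of another point. This sign is locally constant in
    every parameter, and it serves twice: its constancy along a turning line gives the diamond, and
    fixing it near the boundary point on every line gives the branch.

    [H] need not be continuous, monotone or positive. It is replaced by the maximum of [H r] and
    [r], the second radius being provided by the C^1 boundary, and on each block of heights of ratio
    7/8 by its value at one height where it is at least half of its supremum. The ratio is so close
    to 1 that the diamond at that single height serves the curve during the whole block. The
    finiteness of the supremum is where the absence of complex lines enters.

    The time of the curve counts blocks, so that both its length and the lower bound for the
    distance are proportional to the elapsed time; their quotient does not depend on the number of
    blocks. *)

Section ComplexPlane.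
Context {R : realType}.
Implicit Types (z w : R[i]) (r e : R).
Local Notation C := R[i].

(** * The complex plane with its real-valued modulus *)

Lemma norm_normc z : `|z| = (normc z)%:C.
Proof. by []. Qed.

Lemma normc_ge0 z : 0 <= normc z.
Proof. by case: z => a b; exact: sqrtr_ge0. Qed.

Lemma normc_eq0 z : (normc z == 0) = (z == 0).
Proof. by apply/eqP/eqP=> [/eq0_normc|->]//; rewrite normc0. Qed.

Lemma normc_gt0 z : (0 < normc z) = (z != 0).
Proof. by rewrite lt_def normc_eq0 normc_ge0 andbT. Qed.

Lemma normcR r : normc r%:C = `|r|.
Proof. by rewrite /normc/= expr0n addr0 sqrtr_sqr. Qed.

Lemma normcB z w : normc (z - w) = normc (w - z).
Proof. by rewrite -normcN opprB. Qed.

Lemma normcX z n : normc (z ^+ n) = normc z ^+ n.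
Proof.
by elim: n => [|n IH]; rewrite ?expr0 ?normc1// !exprS normcM IH.
Qed.

Lemma normc_sqr z : normc z ^+ 2 = complex.Re z ^+ 2 + complex.Im z ^+ 2.
Proof. by case: z => a b /=; rewrite sqr_sqrtr// addr_ge0// sqr_ge0. Qed.

Lemma normc_Re z : `|complex.Re z| <= normc z.
Proof. by have := normc_ge_Re z; rewrite norm_normc lecR. Qed.

Lemma normc_Im z : `|complex.Im z| <= normc z.
Proof.
rewrite -(@ler_pXn2r _ 2) ?nnegrE ?normc_ge0// normc_sqr real_normK ?num_real//.
by rewrite lerDr sqr_ge0.
Qed.

Lemma normc_conj z : normc z^* = normc z.
Proof. by case: z => a b /=; rewrite sqrrN. Qed.

Lemma normc_triB z w : normc z <= normc w + normc (z - w).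
Proof. by rewrite -{1}[z](subrKC w) le_normcD. Qed.

Lemma near_normc z (A : set C) :
  nbhs z A <-> exists2 e : R, 0 < e & forall w, normc (w - z) < e -> A w.
Proof.
split.
  move=> /nbhs_ballP [e /= e0 eA]; exists (complex.Re e).
    by move: e0; rewrite ltcE/= => /andP[].
  move=> w we; apply: eA; rewrite -ball_normE/= distrC norm_normc.
  move: e0 we; case: e => e1 e2; rewrite !ltcE/= => /andP[/eqP -> _] ->.
  by rewrite eqxx.
move=> [e e0 eA]; apply/nbhs_ballP; exists e%:C => /=; first by rewrite ltcR.
by move=> w; rewrite -ball_normE/= distrC norm_normc ltcR; exact: eA.
Qed.

Lemma cvgc_normc {T : Type} {F : set_system T} {FF : Filter F} (f : T -> C) z :
  f @ F --> z <-> (forall e : R, 0 < e -> \forall x \near F, normc (f x - z) < e).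
Proof.
split.
  move=> + e e0 => /(_ [set w | normc (w - z) < e]); apply.
  by apply/near_normc; exists e.
move=> H A /near_normc[e e0 eA]; near=> x; apply: eA.
by near: x; exact: H.
Unshelve. all: end_near. Qed.

End ComplexPlane.

(** * Limits of complex functions and the principal square root *)

Section ComplexLimits.
Context {R : realType}.
Implicit Types (z w : R[i]) (r e : R).
Local Notation C := R[i].

Lemma cvgc_Re {T : Type} {F : set_system T} {FF : Filter F} (f : T -> C) z :
  f @ F --> z -> complex.Re (f x) @[x --> F] --> complex.Re z.
Proof.
move=> /cvgc_normc fz; apply/cvgrPdist_lt => e e0.
near=> x; rewrite distrC -raddfB; apply: le_lt_trans (normc_Re _) _.
by near: x; exact: fz.
Unshelve. all: end_near. Qed.

Lemma cvgc_Im {T : Type} {F : set_system T} {FF : Filter F} (f : T -> C) z :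
  f @ F --> z -> complex.Im (f x) @[x --> F] --> complex.Im z.
Proof.
move=> /cvgc_normc fz; apply/cvgrPdist_lt => e e0.
near=> x; rewrite distrC -raddfB; apply: le_lt_trans (normc_Im _) _.
by near: x; exact: fz.
Unshelve. all: end_near. Qed.

Lemma le_normcB z w : `|normc z - normc w| <= normc (z - w).
Proof.
have := normc_triB z w; have := normc_triB w z; rewrite (normcB w z).
by move=> h1 h2; rewrite ler_norml; lra.
Qed.

Lemma cvgc_norm {T : Type} {F : set_system T} {FF : Filter F} (f : T -> C) z :
  f @ F --> z -> normc (f x) @[x --> F] --> normc z.
Proof.
move=> /cvgc_normc fz; apply/cvgrPdist_lt => e e0.
near=> x; rewrite distrC; apply: le_lt_trans (le_normcB _ _) _.
by near: x; exact: fz.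
Unshelve. all: end_near. Qed.

Lemma cvgRc {T : Type} {F : set_system T} {FF : Filter F} (f : T -> R) r :
  f @ F --> r -> (f x)%:C @[x --> F] --> r%:C.
Proof.
move=> /cvgrPdist_lt fr; apply/cvgc_normc => e e0.
near=> x; rewrite -[_ - _](rmorphB (real_complex R)) normcR distrC.
by near: x; exact: fr.
Unshelve. all: end_near. Qed.

Lemma cvgc_i {T : Type} {F : set_system T} {FF : Filter F} (f g : T -> R) a b :
  f @ F --> a -> g @ F --> b -> (f x +i* g x) @[x --> F] --> a +i* b.
Proof.
move=> fa gb.
have -> : a +i* b = a%:C + b%:C * 'i by simpc.
rewrite (_ : (fun x => _) = (fun x => (f x)%:C + (g x)%:C * 'i)); last first.
  by apply/funext => x; simpc.
by apply: cvgD; [exact: cvgRc|apply: cvgM; [exact: cvgRc|exact: cvg_cst]].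
Qed.

Lemma cvgcM {T : Type} {F : set_system T} {FF : Filter F} (f g : T -> C) z w :
  f @ F --> z -> g @ F --> w -> (f x * g x) @[x --> F] --> z * w.
Proof. exact: cvgM. Qed.

Lemma csqr_cvg {T : Type} {F : set_system T} {FF : Filter F} (f : T -> C) z :
  f @ F --> z -> (f x ^+ 2) @[x --> F] --> z ^+ 2.
Proof. by move=> fz; apply: cvgM; exact: fz. Qed.

(** The plane without the closed negative real half-line, as an open condition; up to the factor 2
    its right side is the radicand in [psqrt]. *)
Definition slit z : Prop := 0 < normc z + complex.Re z.

(* The principal square root, off the closed negative half-line. *)
Definition psqrt z : C :=
  (Num.sqrt (2 * (normc z + complex.Re z)))^-1%:C * (z + (normc z)%:C).

(** The vector z + |z| bisects the angle between z and the positive axis, and its square is 2 (|z| +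
    Re z) z. *)
Lemma psqrt_sqr z : slit z -> psqrt z ^+ 2 = z.
Proof.
rewrite /slit => zs; rewrite /psqrt exprMn.
rewrite -(rmorphXn (real_complex R)) exprVn sqr_sqrtr; last by lra.
have -> : (z + (normc z)%:C) ^+ 2 = (2 * (normc z + complex.Re z))%:C * z.
  have := normc_sqr z; move: (normc z) => n.
  by case: z {zs} => a b /= nE; rewrite expr2; simpc; congr (_ +i* _); lra.
rewrite mulrA -rmorphM mulVf ?mul1r//; lra.
Qed.

Lemma psqrt_Re_gt0 z : slit z -> 0 < complex.Re (psqrt z).
Proof.
rewrite /slit => zs; rewrite /psqrt; case: z zs => a b zs.
move: zs; set n := normc _ => /= zs.
have s0 : 0 < (Num.sqrt (2 * (n + a)))^-1 by rewrite invr_gt0 sqrtr_gt0; lra.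
by rewrite mul0r subr0 mulr_gt0//; lra.
Qed.

Lemma Re_gt0_slit z : 0 < complex.Re z -> slit z.
Proof. by move=> z0; rewrite /slit ltr_wpDl// normc_ge0. Qed.

Lemma near1_Re_gt0 z : normc (z - 1) < 1 -> 0 < complex.Re z.
Proof.
move=> z1; have := le_lt_trans (normc_Re _) z1.
by rewrite raddfB/= ltr_norml; lra.
Qed.

Lemma Re_inv_gt0 z : 0 < complex.Re z^-1 -> 0 < complex.Re z.
Proof.
case: z => a b; rewrite /GRing.inv/= => h.
have : 0 <= a ^+ 2 + b ^+ 2 by rewrite addr_ge0 ?sqr_ge0.
rewrite le_eqVlt => /orP[/eqP E|n0]; first by move: h; rewrite -E invr0 mulr0 ltxx.
by move: h; rewrite pmulr_lgt0// invr_gt0.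
Qed.

Lemma psqrt_sqr_id z : 0 < complex.Re z -> psqrt (z ^+ 2) = z.
Proof.
move=> z0.
have zs : slit (z ^+ 2).
  rewrite /slit normcX normc_sqr; case: z z0 => a b /= a0.
  have a2 : 0 < a ^+ 2 by rewrite exprn_gt0.
  by rewrite -!expr2; lra.
have /eqP := psqrt_sqr zs; rewrite eqf_sqr => /orP[/eqP//|/eqP E].
by exfalso; have := psqrt_Re_gt0 zs; rewrite E raddfN/=; lra.
Qed.

Lemma psqrt1 : psqrt 1 = 1 :> C.
Proof. by rewrite -[in LHS](expr1n C 2) psqrt_sqr_id//= ltr01. Qed.

Lemma psqrt_cvg {T : Type} {F : set_system T} {FF : Filter F} (f : T -> C) z :
  slit z -> f @ F --> z -> psqrt (f x) @[x --> F] --> psqrt z.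
Proof.
rewrite /slit => zs fz; apply: cvgM.
  apply: cvgRc; apply: cvgV; first by rewrite gt_eqF// sqrtr_gt0; lra.
  apply: (@cvg_comp _ _ _ _ Num.sqrt _ (nbhs (2 * (normc z + complex.Re z))));
    last exact: sqrt_continuous.
  apply: cvgM; first exact: cvg_cst.
  by apply: cvgD; [exact: cvgc_norm|exact: cvgc_Re].
by apply: cvgD; [exact: fz|apply: cvgRc; apply: cvgc_norm; exact: fz].
Qed.

Lemma csqrt_eq z w : z ^+ 2 = w ^+ 2 -> z = w \/ z = - w.
Proof. by move/eqP; rewrite eqf_sqr => /orP[/eqP|/eqP]; [left|right]. Qed.

Lemma csqrt_exists z : exists w, w ^+ 2 = z.
Proof. by exists (sqrtc z); exact: sqr_sqrtc. Qed.

End ComplexLimits.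

(** [P] cuts out of [A] a relatively open and relatively closed subset. Every sign below is
    propagated along intervals, segments and complex lines in this form. *)
Lemma connected_ind (T : topologicalType) (A : set T) (P : T -> Prop) :
  connected A ->
  (forall x, A x -> \forall y \near x, A y -> (P x <-> P y)) ->
  forall x y, A x -> A y -> P x -> P y.
Proof.
move=> cA loc x y Ax Ay Px.
suff E : A `&` P = A by move: Ay; rewrite -E => -[].
apply: cA; first by exists x.
- exists [set y | A y -> P y]^°; first exact: open_interior.
  apply/seteqP; split=> [z [Az Pz]|z [Az /interior_subset h]]; last by split => //; exact: h.
  split=> //; rewrite /interior/=; have := loc _ Az.
  by apply: filterS => w + Aw => /(_ Aw)[+ _]; exact.
- exists (~` [set y | A y -> ~ P y]^°).
    by rewrite closedC; exact: open_interior.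
  apply/seteqP; split=> [z [Az Pz]|z [Az Pz]].
    by split => // /interior_subset/(_ Az).
  split => //; apply: contrapT => nPz; apply: Pz; rewrite /interior/=.
  have := loc _ Az; apply: filterS => w + Aw Pw => /(_ Aw)[_ h]; exact/nPz/h.
Qed.

Lemma continuousc (T U V : topologicalType) (f : T -> U) (g : U -> V) :
  continuous f -> continuous g -> continuous (fun x => g (f x)).
Proof. by move=> fc gc x; exact: (continuous_comp (fc x) (gc _)). Qed.

(** * Paths and the sign of a square root along them *)

Section Joined.
Context {R : realType}.
Local Notation C := R[i].
Implicit Types (E D : set C) (x y z : C).

(** Continuity is asked on all of [R], so that no subspace topology intervenes; only the values on
    [0, 1] have to lie in [E]. *)
Definition joined E x y : Prop := exists g : R -> C,
  [/\ continuous g, g 0 = x, g 1 = y & forall t, 0 <= t <= 1 -> E (g t)].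

Lemma joined_refl E x : E x -> joined E x x.
Proof.
move=> Ex; exists (fun=> x); split; [exact: cst_continuous|by []|by []|].
by move=> t _.
Qed.

Lemma joined_sym E x y : joined E x y -> joined E y x.
Proof.
move=> [g [gc g0 g1 gE]]; exists (fun t => g (1 - t)); split.
- apply: (@continuousc _ _ _ (fun t : R => 1 - t) g) => // t.
  by apply: cvgB; [exact: cvg_cst|exact: cvg_id].
- by rewrite subr0.
- by rewrite subrr.
- by move=> t t01; apply: gE; lra.
Qed.

(** The two paths are added rather than glued: at each time one of the two clamped summands equals
    [y], so continuity needs no case distinction. *)
Lemma joined_trans E x y z : joined E x y -> joined E y z -> joined E x z.
Proof.
move=> [g [gc g0 g1 gE]] [k [kc k0 k1 kE]].
exists (fun t => g (Num.min 1 (2 * t)) + k (Num.max 0 (2 * t - 1)) - y); split.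
- have c2 : continuous (fun t : R => 2 * t) by apply: mulrl_continuous.
  have cg : continuous (fun t : R => g (Num.min 1 (2 * t))).
    apply: (@continuousc _ _ _ (fun t : R => Num.min 1 (2 * t)) g); last exact: gc.
    by move=> t; apply: continuous_min; [exact: cst_continuous|exact: c2].
  have ck : continuous (fun t : R => k (Num.max 0 (2 * t - 1))).
    apply: (@continuousc _ _ _ (fun t : R => Num.max 0 (2 * t - 1)) k); last exact: kc.
    move=> t; apply: (@continuous_max _ _ (fun=> 0) (fun t : R => 2 * t - 1)).
      exact: cst_continuous.
    by apply: cvgB; [exact: c2|exact: cvg_cst].
  by move=> t; apply: cvgB; [apply: cvgD; [exact: cg|exact: ck]|exact: cvg_cst].
- rewrite mulr0 (min_idPr _) ?ler01// sub0r (max_idPl _) ?lerN10//.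
  by rewrite g0 k0 addrK.
- rewrite mulr1 (min_idPl _); last lra.
  have -> : Num.max 0 (2 - 1) = 1 :> R by rewrite max_r; lra.
  by rewrite g1 k1 addrC addKr.
- move=> t t01; have [t2|t2] := leP (2 * t) 1.
    by rewrite (max_idPl _); [rewrite k0 addrK; apply: gE; lra|lra].
  rewrite (max_idPr _); last lra.
  by rewrite g1 addrC addKr; apply: kE; lra.
Qed.

Lemma joined_ball E x y e : (forall w, normc (w - x) < e -> E w) ->
  normc (y - x) < e -> joined E x y.
Proof.
move=> xE yx; exists (fun t => x + t%:C * (y - x)); split.
- move=> t; apply: cvgD; first exact: cvg_cst.
  by apply: cvgM; [apply: cvgRc; exact: cvg_id|exact: cvg_cst].
- by rewrite mul0r addr0.
- by rewrite mul1r addrC subrK.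
- move=> t t01; apply: xE; rewrite addrAC subrr add0r normcM normcR.
  apply: le_lt_trans yx; rewrite ger0_norm; last lra.
  by rewrite ler_piMl ?normc_ge0//; lra.
Qed.

(** The same path works for all nearby parameters, by compactness of [0, 1]. *)
Lemma joined_near (T : topologicalType) (m0 : T) (E : T -> set C) x y :
  (forall z, E m0 z -> \forall m \near m0 & w \near z, E m w) ->
  joined (E m0) x y -> \forall m \near m0, joined (E m) x y.
Proof.
move=> Eo [g [gc g0 g1 gE]].
have := @segment_compact R 0 1; rewrite compact_near_coveringP.
move=> /(_ T (nbhs m0) (fun m t => E m (g t)) _).
have H : (forall t : R, `[0, 1]%classic t ->
   \forall t' \near t & m \near m0, E m (g t')).
  move=> t /=; rewrite in_itv/= => /gE/Eo [[A B]/= [mA zB] AB].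
  exists (g @^-1` B, A) => /=; first by split => //; exact: gc.
  by move=> [t' m]/= [Bt Am]; exact: (AB (m, g t')).
by move=> /(_ H); apply: filterS => m mE; exists g; split.
Qed.

Lemma continuous_within_comp {S T U : topologicalType} (A : set T) (f : T -> U) (k : S -> T) :
  {within A, continuous f} -> continuous k -> (forall x : S, A (k x)) ->
  continuous (f \o k).
Proof.
move=> fA kc kA x.
move/subspace_continuousP: fA => /(_ _ (kA x)) fA.
apply: (cvg_trans _ fA) => B hB.
have hB' : nbhs (k x) [set y | A y -> B (f y)] := hB.
have := kc x _ hB'.
by rewrite /nbhs/=; apply: filterS => y; apply; exact: kA.
Qed.

(* A form of "every loop is null-homotopic"; the base point need not stay fixed. *)
Definition loops_contract D : Prop := forall g : R -> C, continuous g ->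
  (forall t, 0 <= t <= 1 -> D (g t)) -> g 0 = g 1 ->
  exists h : R * R -> C,
    [/\ continuous h, forall q, D (h q),
        forall t, 0 <= t <= 1 -> h (0, t) = g t,
        forall t, h (1, t) = h (1, 0) & forall u, h (u, 0) = h (u, 1)].

(** When [D] omits 0, this is its double cover by square roots. *)
Definition squares D : set C := [set s | D (s ^+ 2)].

(** The square of a path from s to -s is a loop in [D]. Contracting it provides a closed continuous
    root of this loop, which agrees with the path up to a constant sign; but the path changes sign
    between its endpoints and the closed root does not. *)
Lemma no_flip D s : ~ D 0 -> loops_contract D -> ~ joined (squares D) s (- s).
Proof.
move=> D0 Dl [c [cc c0 c1 cE]].
have c2 : continuous (fun t => c t ^+ 2).
  by move=> t; apply: cvgM; exact: cc.
have [] := Dl _ c2 cE _; first by rewrite c0 c1 sqrrN.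
move=> h [hc hD h0 h1 hend].
have hn0 q : h q != 0 by apply/eqP => E; apply: D0; rewrite -E.
have hcr u : continuous (fun t => h (u, t)).
  move=> t; apply: (continuous_comp (f := fun t => (u, t))); last exact: hc.
  exact: (@cvg_pair _ _ _ _ (nbhs u) (nbhs t) _ _ _ (fun=> u) id (cvg_cst _) cvg_id).
pose P u := exists so : R -> C,
  [/\ continuous so, forall t, 0 <= t <= 1 -> so t ^+ 2 = h (u, t) & so 0 = so 1].
(* A root of one loop times [psqrt] of the ratio is a root of the neighbouring loop; it closes up
   because both loops do. *)
have step u v : (forall t, 0 <= t <= 1 -> 0 < complex.Re (h (v, t) / h (u, t))) -> P u -> P v.
  move=> uv [so [oc o2 o01]].
  (* The ratio is controlled on [0, 1] only, whereas the root has to be continuous on the whole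
     line; the time is therefore clamped. *)
  pose cl (t : R) := Num.max 0 (Num.min 1 t).
  have clc : continuous cl.
    move=> t; apply: continuous_max; first exact: cst_continuous.
    by apply: continuous_min; [exact: cst_continuous|exact: cvg_id].
  have cl01 t : 0 <= cl t <= 1.
    by rewrite /cl le_max lexx/= ge_max ler01 ge_min lexx.
  have clE t : 0 <= t <= 1 -> cl t = t.
    by move=> /andP[t0 t1]; rewrite /cl (min_idPr t1) (max_idPr t0).
  exists (fun t => so t * psqrt (h (v, cl t) / h (u, cl t))); split.
  - move=> t; apply: cvgM; first exact: oc.
    apply: psqrt_cvg; first by apply: Re_gt0_slit; exact: uv.
    apply: cvgM; first exact: (continuous_comp (clc t) (hcr v _)).
    apply: cvgV => //; exact: (continuous_comp (clc t) (hcr u _)).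
  - move=> t t01; rewrite exprMn psqrt_sqr; last by apply: Re_gt0_slit; exact: uv.
    by rewrite o2// clE// mulrC divfK.
  - by rewrite o01 !clE ?lexx ?ler01// -!hend.
have loc u : \forall v \near u, P u <-> P v.
  have near1 : \forall v \near u, forall t, 0 <= t <= 1 ->
      0 < complex.Re (h (v, t) / h (u, t)).
    have := @segment_compact R 0 1; rewrite compact_near_coveringP.
    move=> /(_ R (nbhs u) (fun v t => 0 < complex.Re (h (v, t) / h (u, t))) _).
    have H : (forall t : R, `[0, 1]%classic t -> \forall t' \near t & v \near u,
        0 < complex.Re (h (v, t') / h (u, t'))).
      move=> t _.
      have H1 : (h (q.2, q.1) / h (u, q.1)) @[q --> (nbhs t, nbhs u)] --> h (u, t) / h (u, t).
        apply: cvgM.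
          apply: (@cvg_comp _ _ _ (fun q : R * R => (q.2, q.1)) h _ (nbhs (u, t))); last exact: hc.
          exact: (@cvg_pair _ _ _ _ (nbhs u) (nbhs t) _ _ _ (fun q => q.2)
            (fun q => q.1) cvg_snd cvg_fst).
        apply: cvgV => //.
        apply: (@cvg_comp _ _ _ (fun q : R * R => q.1) (fun t => h (u, t)) _ (nbhs t)); first exact: cvg_fst.
        exact: hcr.
      move/cvgc_normc: H1 => /(_ 1 ltr01); rewrite divff//=.
      by apply: filterS => q; exact: near1_Re_gt0.
    move=> /(_ H); apply: filterS => v vE t t01; apply: vE.
    by rewrite /= in_itv.
  apply: filterS near1 => v uv; split; apply: step => // t /uv.
  by rewrite -invf_div => /Re_inv_gt0.
(* The loop at u = 1 is constant and has a constant root; connectedness of [0, 1] carries the closed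
   root back to u = 0. *)
have P1 : P 1.
  have [so oE] := csqrt_exists (h (1, 0)).
  exists (fun=> so); split; [exact: cst_continuous| |by []].
  by move=> t _; rewrite oE h1.
have [so [oc o2 o01]] : P 0.
  apply: (@connected_ind R `[0, 1]%classic P _ _ 1 0) => //.
  - exact: segment_connected.
  - by move=> u _; have := loc u; apply: filterS.
  - by rewrite /= in_itv/= ler01 lexx.
  - by rewrite /= in_itv/= ler01 lexx.
have on0 t : 0 <= t <= 1 -> so t != 0.
  by move=> t01; rewrite -sqrf_eq0 o2.
have cn0 t : 0 <= t <= 1 -> c t != 0.
  by move=> t01; rewrite -sqrf_eq0 -h0.
pose Q (t : R) := c t = so t.
have Qd t : 0 <= t <= 1 -> c t = so t \/ c t = - so t.
  by move=> t01; apply: csqrt_eq; rewrite o2// h0.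
have Qloc (t : R) : `[0, 1]%classic t -> \forall t' \near t, `[0, 1]%classic t' -> (Q t <-> Q t').
  rewrite /= in_itv/= => t01.
  have rc : (c x / so x) @[x --> t] --> c t / so t.
    by apply: cvgM; [exact: cc|apply: cvgV; [exact: on0|exact: oc]].
  move/cvgc_Re/cvgrPdist_lt: rc => /(_ 1 ltr01).
  apply: filterS => t'; rewrite in_itv/= => + t'01; rewrite /Q.
  have := on0 _ t01; have := on0 _ t'01.
  case: (Qd _ t01) => ->; case: (Qd _ t'01) => -> n1 n2;
    rewrite ?mulNr ?divff//= => H1.
  - by exfalso; move: H1; rewrite ltr_norml; lra.
  - by exfalso; move: H1; rewrite ltr_norml; lra.
  - have N k : k != 0 -> - k <> k :> C.
      move=> k0 /eqP; rewrite eq_sym -addr_eq0 -mulr2n mulrn_eq0/=.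
      by rewrite (negbTE k0).
    by split => /N.
have i0 : `[0 : R, 1]%classic 0 by rewrite /= in_itv/= lexx ler01.
have i1 : `[0 : R, 1]%classic 1 by rewrite /= in_itv/= lexx ler01.
have Q01 : Q 0 <-> Q 1.
  split; apply: (connected_ind _ Qloc) => //; exact: segment_connected.
have s0 : s != 0 by rewrite -c0; apply: cn0; rewrite lexx ler01.
have N : - s <> s.
  move=> /eqP; rewrite eq_sym -addr_eq0 -mulr2n mulrn_eq0/=.
  by rewrite (negbTE s0).
case: (Qd 0) => [|E|E]; first by rewrite lexx ler01.
  by have /Q01 := E; rewrite /Q -o01 -E c0 c1.
have nQ0 : ~ Q 0 by rewrite /Q => Q0; apply: N; rewrite -c0 {1}E opprK -Q0.
case: (Qd 1) => [|E1|E1]; first by rewrite lexx ler01.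
  by apply: nQ0; apply/Q01.
by apply: N; rewrite -c1 E1 -o01 -E c0.
Qed.

Lemma joinedN D x y : joined (squares D) x y -> joined (squares D) (- x) (- y).
Proof.
move=> [g [gc g0 g1 gD]]; exists (fun t => - g t); split.
- by move=> t; apply: cvgN; exact: gc.
- by rewrite g0.
- by rewrite g1.
- by move=> t t01; rewrite /squares/= sqrrN; exact: gD.
Qed.

(** Near [t0] the roots are s * psqrt (t / t0), which depend continuously on t and equal s at
    [t0]. *)
Lemma joined_root_near D (s t0 : C) : open D -> D t0 -> s ^+ 2 = t0 -> s != 0 ->
  \forall t \near t0, exists2 s', s' ^+ 2 = t & joined (squares D) s s'.
Proof.
move=> Do Ds st s0.
have t00 : t0 != 0 by rewrite -st expf_neq0.
have [e e0 eD] : exists2 e, 0 < e & forall w, normc (w - s) < e -> squares D w.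
  apply/(near_normc s (squares D)); rewrite -st in Ds.
  by apply: (csqr_cvg (@cvg_id _ (nbhs s))); exact: open_nbhs_nbhs.
have q1 : (t / t0) @[t --> t0] --> (1 : C).
  rewrite -[X in _ --> X](@divff _ t0)//.
  exact: (cvgM (@cvg_id _ (nbhs t0)) (cvg_cst _)).
have slit1 : slit (1 : C) by apply: Re_gt0_slit; rewrite /= ltr01.
have n0 : 0 < normc s by rewrite normc_gt0.
have q2 : (fun t : C => psqrt (t / t0)) @ nbhs t0 --> psqrt (1 : C).
  exact: psqrt_cvg.
move/cvgc_normc : q2 => /(_ (e / normc s)); rewrite divr_gt0// psqrt1.
move=> /(_ isT) q2.
near=> t.
have ts : slit (t / t0).
  apply/Re_gt0_slit/near1_Re_gt0; near: t.
  by move/cvgc_normc : q1; apply.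
exists (s * psqrt (t / t0)).
  by rewrite exprMn psqrt_sqr// st mulrC divfK.
apply: (joined_ball eD); rewrite -{2}[s]mulr1 -mulrBr normcM.
by rewrite mulrC -ltr_pdivlMr//; near: t; exact: q2.
Unshelve. all: end_near. Qed.

(** Having a root joined to [s1] is a locally constant property of the point; where the root reached
    is the opposite of the one continued locally, the local path is negated. *)
Lemma exists_root D t1 t2 s1 : open D -> connected D -> ~ D 0 ->
  D t1 -> s1 ^+ 2 = t1 -> D t2 ->
  exists2 s2, s2 ^+ 2 = t2 & joined (squares D) s1 s2.
Proof.
move=> Do Dc D0 Dt1 s1E Dt2.
pose P t := exists2 s, s ^+ 2 = t & joined (squares D) s1 s.
have P1 : P t1.
  by exists s1 => //; apply: joined_refl; rewrite /squares/= s1E.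
suff : P t2 by [].
apply: (connected_ind Dc _ Dt1 Dt2 P1) => t Dt.
have [s sE] := csqrt_exists t.
have s0 : s != 0.
  by apply/eqP => s0; apply: D0; move: Dt; rewrite -sE s0 expr0n.
have := joined_root_near Do Dt sE s0.
apply: filterS => t' [s' s'E ss'] Dt'; split.
- move=> [s2 s2E j2]; have : s2 ^+ 2 = s ^+ 2 by rewrite s2E sE.
  move=> /csqrt_eq[E|E].
    by exists s' => //; apply: joined_trans j2 _; rewrite E.
  exists (- s'); first by rewrite sqrrN.
  by apply: joined_trans j2 _; rewrite E; exact: joinedN.
- move=> [s2 s2E j2]; have : s2 ^+ 2 = s' ^+ 2 by rewrite s2E s'E.
  move=> /csqrt_eq[E|E].
    by exists s => //; apply: joined_trans j2 _; rewrite E; exact: joined_sym.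
  exists (- s); first by rewrite sqrrN.
  by apply: joined_trans j2 _; rewrite E; apply/joinedN/joined_sym.
Qed.

Lemma squares_near (T : topologicalType) (D : T -> set C) m z :
  (forall m t, D m t -> \forall m' \near m & t' \near t, D m' t') ->
  squares (D m) z -> \forall m' \near m & z' \near z, squares (D m') z'.
Proof.
move=> Do /Do[[A B]/= [mA zB] AB].
exists (A, (fun z : C => z ^+ 2) @^-1` B) => /=; last first.
  by move=> [m' z']/= [Am' Bz']; exact: (AB (m', z' ^+ 2)).
by split => //; exact: (csqr_cvg (@cvg_id _ (nbhs z))).
Qed.

(* The sign by which the square roots [al t] and [be t] of two points of D_t are
   joined does not depend on t, whereas the hypotheses at 0 and 1 flip it. *)
Lemma no_monodromy (D : R -> set C) (al be : R -> C) :
  (forall t z, D t z -> \forall t' \near t & z' \near z, D t' z') ->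
  (forall t, open (D t)) -> (forall t, connected (D t)) ->
  (forall t, loops_contract (D t)) -> (forall t, ~ D t 0) ->
  continuous al -> continuous be ->
  (forall t, D t (al t ^+ 2)) -> (forall t, D t (be t ^+ 2)) ->
  D 0 = D 1 -> be 1 = be 0 -> al 1 = - al 0 -> False.
Proof.
move=> Dn Do Dc Dl D0 alc bec Dal Dbe D01 be01 al01.
pose E t := squares (D t).
have al0 t : al t != 0.
  by apply/eqP => E0; apply: (D0 t); have := Dal t; rewrite E0 expr0n.
have be0 t : be t != 0.
  by apply/eqP => E0; apply: (D0 t); have := Dbe t; rewrite E0 expr0n.
have dich t : joined (E t) (be t) (al t) \/ joined (E t) (be t) (- al t).
  have [s2 s2E j] := exists_root (Do t) (Dc t) (D0 t) (Dbe t) (erefl _) (Dal t).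
  by case: (csqrt_eq s2E) => <-; [left|right].
have excl t s : joined (E t) (be t) s -> joined (E t) (be t) (- s) -> False.
  move=> j1 j2; apply: (no_flip (D0 t) (Dl t) (s := s)).
  by apply: joined_trans j2; exact: joined_sym.
(* For nearby times the old path is kept, and two short segments link its ends to the moved
   roots. *)
have stab t (al' : R -> C) : continuous al' -> squares (D t) (al' t) ->
    joined (E t) (be t) (al' t) -> \forall t' \near t, joined (E t') (be t') (al' t').
  move=> alc' Dal' j.
  have loc (f : R -> C) : continuous f -> squares (D t) (f t) ->
      \forall t' \near t, joined (E t') (f t) (f t').
    move=> fc Df.
    have [[A B]/= [tA fB] AB] := squares_near Dn Df.
    have [e e0 eB] : exists2 e, 0 < e & forall w, normc (w - f t) < e -> B w.
      by apply/near_normc.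
    near=> t'; apply: (@joined_ball _ _ _ e).
      move=> w wB; apply: (AB (t', w)); split => /=; last exact: eB.
      by near: t'.
    near: t'; have /cvgc_normc := fc t; by apply.
  near=> t'.
  apply: (@joined_trans _ _ (be t)); first by apply: joined_sym; near: t'; exact: loc.
  apply: (@joined_trans _ _ (al' t)); last by near: t'; exact: loc.
  near: t'; apply: joined_near j => z; exact: squares_near.
have loc t : \forall t' \near t, joined (E t) (be t) (al t) <-> joined (E t') (be t') (al t').
  case: (dich t) => j.
    have := stab _ _ alc (Dal t) j; apply: filterS => t' j'; split => //.
  have Nalc : continuous (fun t => - al t) by move=> x; apply: cvgN; exact: alc.
  have DN : squares (D t) (- al t) by rewrite /squares/= sqrrN.
  have := stab _ _ Nalc DN j; apply: filterS => t' j'; split => h.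
    by have := excl _ _ h j.
  by have := excl _ _ h j'.
have i0 : `[0 : R, 1]%classic 0 by rewrite /= in_itv/= lexx ler01.
have i1 : `[0 : R, 1]%classic 1 by rewrite /= in_itv/= lexx ler01.
pose P t := joined (E t) (be t) (al t).
have PP : P 0 <-> P 1.
  by split; apply: (connected_ind (@segment_connected R 0 1) (P := P)) => //
    x _; have := loc x; apply: filterS.
have E1 : E 1 = E 0 by rewrite /E D01.
case: (dich 0) => [j|j].
  by have /PP := j; rewrite /P E1 be01 al01 => /(excl 0 _ j).
case: (dich 1); last first.
  rewrite E1 be01 al01 opprK => j'; exact: (excl _ _ j' j).
move=> /PP j'; exact: (excl _ _ j' j).
Unshelve. all: end_near. Qed.

End Joined.

(** * Real and complex derivatives through estimates of the remainder *)

Section Calculus.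

Lemma is_derive_eps (K : numFieldType) (f : K -> K) (x d : K) :
  is_derive x 1 f d -> forall e, 0 < e ->
  \forall h \near 0, `|f (x + h) - f x - h * d| <= e * `|h|.
Proof.
move=> fd e e0; have fx : derivable f x 1 by [].
have /eqaddoP := (derivable_nbhsP f x 1).1 fx.
move=> /(_ e e0); apply: filterS => h hE.
have {hE} : `|f (h *: 1 + x) - (f x + h *: 'D_1 f x)| <= e * `|h| := hE.
by rewrite derive_val -[h *: 1]/(h * 1) -[h *: d]/(h * d) mulr1 [h + x]addrC opprD addrA.
Qed.

Lemma eps_is_derive (K : numFieldType) (f : K -> K) (x d : K) :
  (forall e, 0 < e -> \forall h \near 0, `|f (x + h) - f x - h * d| <= e * `|h|) ->
  is_derive x 1 f d.
Proof.
move=> H.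
have fd : (h^-1 *: ((f \o shift x) (h *: 1) - f x)) @[h --> 0^'] --> d.
  apply/cvgrPdist_le => e e0; rewrite /dnbhs near_withinE.
  have := H _ e0; apply: filterS => h he h0.
  rewrite /GRing.scale/= mulr1 [h + x]addrC -[d](mulKf h0) -mulrBr normrM normfV.
  by rewrite mulrC ler_pdivrMr ?normr_gt0// distrC.
have dv : derivable f x 1 by apply/cvg_ex; exists d.
by apply: DeriveDef => //; apply: cvg_lim.
Qed.

End Calculus.

Section ComplexDerivative.
Context {R : realType}.
Local Notation C := R[i].
Implicit Types (f g : C -> C) (z w d : C).

(* Caratheodory's form of complex differentiability. *)
Definition cderiv f z d : Prop := exists2 k : C -> C,
  k @ nbhs z --> d & forall w, f w - f z = k w * (w - z).

Lemma cderiv_eps f z d : (forall e : R, 0 < e -> exists2 r : R, 0 < r &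
    forall w, normc (w - z) < r -> normc (f w - f z - d * (w - z)) <= e * normc (w - z)) ->
  cderiv f z d.
Proof.
move=> H; exists (fun w => if w == z then d else (f w - f z) / (w - z)).
  apply/cvgc_normc => e e0.
  have [r r0 rE] := H (e / 2) ltac:(lra).
  apply/near_normc; exists r => // w wz; case: eqP => [_|/eqP wz0].
    by rewrite subrr normc0.
  have wz1 : w - z != 0 by rewrite subr_eq0.
  have n0 : 0 < normc (w - z) by rewrite normc_gt0.
  rewrite -[d](mulfK wz1) -mulrBl normcM normcV -ltr_pdivlMr ?invr_gt0// invrK.
  by apply: le_lt_trans (rE _ wz) _; rewrite ltr_pM2r//; lra.
move=> w; case: eqP => [->|/eqP wz0]; first by rewrite !subrr mulr0.
by rewrite divfK// subr_eq0.
Qed.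

Lemma eps_cderiv f z d : cderiv f z d -> forall e : R, 0 < e -> exists2 r : R, 0 < r &
    forall w, normc (w - z) < r -> normc (f w - f z - d * (w - z)) <= e * normc (w - z).
Proof.
move=> [k /cvgc_normc kd kE] e e0.
have /near_normc[r r0 rE] := kd _ e0; exists r => // w wz.
by rewrite kE -mulrBl normcM ler_wpM2r ?normc_ge0//; apply/ltW/rE.
Qed.

Lemma cderiv_is_derive f z d : cderiv f z d -> is_derive (z : C) 1 f d.
Proof.
move=> H; apply: eps_is_derive => e.
case: e => e e'; rewrite ltcE/= => /andP[/eqP -> e0].
have [r r0 rE] := eps_cderiv H e0.
apply/near_normc; exists r => // h; rewrite subr0 => hr.
rewrite !norm_normc [_ +i* 0]complexr0 -rmorphM lecR.
have := rE (z + h); rewrite addrAC subrr add0r [d * h]mulrC; exact.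
Qed.

Lemma is_derive_cderiv f z d : is_derive (z : C) 1 f d -> cderiv f z d.
Proof.
move=> H; apply: cderiv_eps => e e0.
have := is_derive_eps H (e := e%:C); rewrite ltcR => /(_ e0).
move=> /near_normc[r r0 rE]; exists r => // w wr.
have := rE (w - z); rewrite subr0 => /(_ wr).
by rewrite !norm_normc -rmorphM lecR [z + _]addrC subrK [_ * d]mulrC.
Qed.

Lemma derivable_cderiv f z : derivable f (z : C) 1 -> exists d, cderiv f z d.
Proof.
by move=> fz; exists ('D_1 f z); apply: is_derive_cderiv; apply: DeriveDef.
Qed.

Lemma cderiv_cst c z : cderiv (fun=> c) z 0.
Proof. by exists (fun=> 0); [exact: cvg_cst|move=> w; rewrite subrr mul0r]. Qed.

Lemma cderiv_id z : cderiv id z 1.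
Proof. by exists (fun=> 1); [exact: cvg_cst|move=> w; rewrite mul1r]. Qed.

Lemma cderiv_cvg f z d : cderiv f z d -> f @ nbhs z --> f z.
Proof.
move=> [k kd kE].
have -> : f = fun w => k w * (w - z) + f z.
  by apply/funext => w; rewrite -kE subrK.
rewrite /= subrr mulr0 add0r -[X in _ --> X]add0r -[X in _ --> X + _](mulr0 d).
apply: cvgD; last exact: cvg_cst.
apply: (cvgcM kd); apply/cvgc_normc => e e0; apply/near_normc; exists e => // w.
by rewrite subr0.
Qed.

Lemma cderivD f g z d e : cderiv f z d -> cderiv g z e ->
  cderiv (fun w => f w + g w) z (d + e).
Proof.
move=> [k kd kE] [l le lE]; exists (fun w => k w + l w).
  by apply: cvgD; [exact: kd|exact: le].
by move=> w; rewrite mulrDl -kE -lE; ring.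
Qed.

Lemma cderivM f g z d e : cderiv f z d -> cderiv g z e ->
  cderiv (fun w => f w * g w) z (d * g z + f z * e).
Proof.
move=> fd ge; have fc := cderiv_cvg fd; have gc := cderiv_cvg ge.
move: fd ge => [k kd kE] [l le lE].
exists (fun w => k w * g z + f w * l w).
  apply: cvgD; apply: cvgcM; [exact: kd|exact: cvg_cst|exact: fc|exact: le].
move=> w; rewrite mulrDl mulrAC -kE -[f w * l w * _]mulrA -lE; ring.
Qed.

Lemma cderivV f z d : f z != 0 -> cderiv f z d ->
  cderiv (fun w => (f w)^-1) z (- d / f z ^+ 2).
Proof.
move=> fz0 fd; have fc := cderiv_cvg fd; move: fd => [k kd kE].
have near0 : \forall w \near z, f w != 0.
  move/cvgc_normc: fc => /(_ (normc (f z))); rewrite normc_gt0 => /(_ fz0).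
  apply: filterS => w; apply: contraTneq => ->; rewrite sub0r normcN ltxx//.
(* Where [f w] vanishes, its inverse has the default value 0 and the slope is taken as a plain
   difference quotient; near [z] this does not happen. *)
pose l w := if f w == 0 then ((f w)^-1 - (f z)^-1) / (w - z) else - k w / (f w * f z).
have lim1 : (fun w => - k w / (f w * f z)) @ nbhs z --> - d / f z ^+ 2.
  apply: (cvgcM (cvgN kd)); rewrite expr2.
  apply: cvgV; first by rewrite mulf_neq0.
  exact: (cvgcM fc (cvg_cst _)).
exists l.
  apply: cvg_trans lim1; apply: near_eq_cvg; apply: filterS near0 => w fw0.
  by rewrite /l (negbTE fw0).
move=> w; rewrite /l; case: eqP => [fw0|/eqP fw0].
  case: (eqVneq w z) => [E|wz]; first by rewrite E !subrr !mul0r.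
  by rewrite divfK// subr_eq0.
have -> : - k w / (f w * f z) * (w - z) = - (k w * (w - z)) / (f w * f z) by ring.
by rewrite -kE; field; rewrite fw0 fz0.
Qed.

Lemma cderiv_comp f g z d e : cderiv g z d -> cderiv f (g z) e ->
  cderiv (fun w => f (g w)) z (e * d).
Proof.
move=> gd; have gc := cderiv_cvg gd; move: gd => [k kd kE] [l le lE].
exists (fun w => l (g w) * k w).
  apply: cvgcM; last exact: kd.
  exact: (cvg_comp _ _ gc le).
by move=> w; rewrite lE kE mulrA.
Qed.

Lemma cderiv_near f g z d : (\forall w \near z, f w = g w) -> cderiv f z d -> cderiv g z d.
Proof.
move=> fg /eps_cderiv H; apply: cderiv_eps => e e0.
have fgz : f z = g z by exact: (nbhs_singleton fg).
have [r r0 rE] := H _ e0; have /near_normc[s s0 sE] := fg.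
exists (Num.min r s); first by rewrite lt_min r0.
by move=> w; rewrite lt_min => /andP[wr ws]; rewrite -sE// -fgz; exact: rE.
Qed.

(** Divide g w - g z = (f w - f z) (f w + f z) by the last factor, which tends to 2 f z. Continuity
    of the root is thus enough for its holomorphy. *)
Lemma cderiv_sqrt f g z d : f z != 0 -> f @ nbhs z --> f z ->
  (\forall w \near z, f w ^+ 2 = g w) -> cderiv g z d ->
  cderiv f z (d / (2 * f z)).
Proof.
move=> fz0 fc fg [k kd kE]; apply: cderiv_eps => e e0.
have fgz : f z ^+ 2 = g z by exact: (nbhs_singleton fg).
have ld : (k w / (f w + f z)) @[w --> z] --> d / (2 * f z).
  rewrite mulr_natl mulr2n; apply: (cvgcM kd).
  apply: cvgV; first by rewrite -mulr2n mulrn_eq0.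
  exact: (cvgD fc (cvg_cst _)).
move/cvgc_normc: ld => /(_ _ e0) ld.
have near0 : \forall w \near z, f w + f z != 0.
  move/cvgc_normc: fc => /(_ (normc (f z))); rewrite normc_gt0 => /(_ fz0).
  apply: filterS => w; apply: contraTneq => /eqP; rewrite addr_eq0 => /eqP ->.
  rewrite -opprD normcN -mulr2n normcMn mulr2n -leNgt lerDl normc_ge0//.
have /near_normc[r r0 rE] : \forall w \near z, [/\ f w + f z != 0,
    normc (k w / (f w + f z) - d / (2 * f z)) < e & f w ^+ 2 = g w].
  near=> w; split; near: w => //.
exists r => // w /rE[h1 h2 h3].
have -> : f w - f z = k w / (f w + f z) * (w - z).
  by rewrite mulrAC -kE -h3 -fgz subr_sqr mulfK.
by rewrite -mulrBl normcM ler_wpM2r ?normc_ge0// ltW.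
Unshelve. all: end_near. Qed.

End ComplexDerivative.

(** * Integrals of continuous functions over intervals *)

Section Integrals.
Context {R : realType}.
Implicit Types (f g : R -> R) (a b m : R).

Definition ival f a b : R := \int[@lebesgue_measure R]_(x in `[a, b]) f x.

Definition cont_on f a b : Prop := {in `[a, b], continuous f}.

Lemma cont_on_integrable f a b : cont_on f a b ->
  (@lebesgue_measure R).-integrable `[a, b] (EFin \o f).
Proof.
move=> fc; apply: continuous_compact_integrable; first exact: segment_compact.
exact: continuous_subspace_itv.
Qed.

Lemma ival_split f a m b : a <= m -> m <= b -> cont_on f a b ->
  ival f a b = ival f a m + ival f m b.
Proof.
move=> am mb fc; have := cont_on_integrable fc => fi.
have := Rintegral_itvB fi (x := m); rewrite !bnd_simp => /(_ am mb).
rewrite /ival => E; apply/eqP; rewrite -subr_eq addrC; apply/eqP.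
rewrite -(@Rintegral_itv_obnd_cbnd _ m); last first.
  apply: integrableS fi => // x; rewrite /= !in_itv/= => /andP[h1 h2].
  by rewrite h2 andbT (le_trans am (ltW h1)).
by rewrite -E; ring.
Qed.

Lemma ivalD f g a b : cont_on f a b -> cont_on g a b ->
  ival (fun x => f x + g x) a b = ival f a b + ival g a b.
Proof. by move=> fc gc; apply: RintegralD => //; exact: cont_on_integrable. Qed.

Lemma cont_on_cst r a b : cont_on (fun=> r) a b.
Proof. by move=> x _; exact: cvg_cst. Qed.

Lemma ival_cst r a b : a <= b -> ival (fun=> r) a b = r * (b - a).
Proof.
move=> ab; rewrite /ival Rintegral_cst//= lebesgue_measure_itv/= lte_fin.
case: ltP => ab' //=; have -> : a = b by apply/eqP; rewrite eq_le ab.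
by rewrite subrr mulr0.
Qed.

Lemma le_ival f g a b : cont_on f a b -> cont_on g a b ->
  (forall x, a <= x <= b -> f x <= g x) -> ival f a b <= ival g a b.
Proof.
by move=> fc gc fg; apply: le_Rintegral => //; exact: cont_on_integrable.
Qed.

Lemma ival_near_cst f r M a b : a <= b -> cont_on f a b ->
  (forall x, a <= x <= b -> `|f x - r| <= M) -> `|ival f a b - r * (b - a)| <= M * (b - a).
Proof.
move=> ab fc fM.
have h1 : ival f a b <= ival (fun=> r + M) a b.
  apply: le_ival => // [|x /fM]; first exact: cont_on_cst.
  by rewrite ler_norml; lra.
have h2 : ival (fun=> r - M) a b <= ival f a b.
  apply: le_ival => // [|x /fM]; first exact: cont_on_cst.
  by rewrite ler_norml; lra.
move: h1 h2; rewrite !ival_cst// mulrDl mulrBl => h1 h2.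
by rewrite ler_norml; lra.
Qed.

Lemma eq_ival f g a b : (forall x, a <= x <= b -> f x = g x) -> ival f a b = ival g a b.
Proof.
move=> fg; apply: eq_Rintegral => x; rewrite inE/= in_itv/=; exact: fg.
Qed.

End Integrals.

(** * Goursat's theorem for rectangles in a left half-plane *)

Section Goursat.
Context {R : realType}.
Local Notation C := R[i].
Variables (G : C -> C) (H : R).
Hypothesis dG : forall z : C, complex.Re z < H -> exists d, cderiv G z d.

Let U (x y : R) : R := complex.Re (G (x +i* y)).
Let V (x y : R) : R := complex.Im (G (x +i* y)).

(* The real part of the integral of G along the boundary of the rectangle
   [a, a + h] x [c, c + k]. *)
Definition rect_ival (a c h k : R) : R :=
  ival (fun x => U x c - U x (c + k)) a (a + h) -
  ival (fun y => V (a + h) y - V a y) c (c + k).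

Lemma normc_le_ReIm (x y : R) : normc (x +i* y) <= `|x| + `|y|.
Proof.
have -> : x +i* y = x%:C + y%:C * 'i by simpc.
by rewrite (le_trans (le_normcD _ _))// normcM !normcR /= expr0n expr1n add0r sqrtr1 mulr1.
Qed.

Lemma GcvgH (y x : R) : x < H -> (G (t +i* y)) @[t --> x] --> G (x +i* y).
Proof.
move=> xH; have [d /cderiv_cvg Gc] := dG (z := x +i* y) xH.
apply: (@cvg_comp _ _ _ (fun t : R => t +i* y) G _ _ _ _ Gc).
by apply: cvgc_i; [exact: cvg_id|exact: cvg_cst].
Qed.

Lemma GcvgV (x y : R) : x < H -> (G (x +i* t)) @[t --> y] --> G (x +i* y).
Proof.
move=> xH; have [d /cderiv_cvg Gc] := dG (z := x +i* y) xH.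
apply: (@cvg_comp _ _ _ (fun t : R => x +i* t) G _ _ _ _ Gc).
by apply: cvgc_i; [exact: cvg_cst|exact: cvg_id].
Qed.

Lemma Ucont y a b : b < H -> cont_on (fun x => U x y) a b.
Proof.
move=> bH x; rewrite in_itv/= => /andP[_ xb].
by apply: cvgc_Re; apply: GcvgH; exact: le_lt_trans xb bH.
Qed.

Lemma Vcont x c d : x < H -> cont_on (fun y => V x y) c d.
Proof. by move=> xH y _; apply: cvgc_Im; exact: GcvgV. Qed.

Lemma Udcont y y' a b : b < H -> cont_on (fun x => U x y - U x y') a b.
Proof.
move=> bH x xab.
have h1 : cont_on (fun x => U x y) a b by exact: Ucont.
have h2 : cont_on (fun x => U x y') a b by exact: Ucont.
exact: (cvgB (h1 x xab) (h2 x xab)).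
Qed.

Lemma Vdcont x x' c d : x < H -> x' < H -> cont_on (fun y => V x y - V x' y) c d.
Proof.
by move=> xH xH' y yab; exact: (cvgB (Vcont xH yab) (Vcont xH' yab)).
Qed.

Lemma rect_split_h a c h1 h2 k : 0 <= h1 -> 0 <= h2 -> 0 <= k -> a + (h1 + h2) < H ->
  rect_ival a c (h1 + h2) k = rect_ival a c h1 k + rect_ival (a + h1) c h2 k.
Proof.
move=> h10 h20 k0 aH; rewrite /rect_ival.
rewrite (@ival_split _ _ a (a + h1)); [|lra|lra|exact: Udcont].
have -> : ival (fun y => V (a + (h1 + h2)) y - V a y) c (c + k) =
   ival (fun y => V (a + h1) y - V a y) c (c + k) +
   ival (fun y => V (a + h1 + h2) y - V (a + h1) y) c (c + k).
  rewrite -ivalD; [|by apply: Vdcont; lra|by apply: Vdcont; lra].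
  by apply: eq_ival => y _; rewrite addrA; ring.
rewrite !addrA; ring.
Qed.

Lemma rect_split_v a c h k1 k2 : 0 <= h -> 0 <= k1 -> 0 <= k2 -> a + h < H ->
  rect_ival a c h (k1 + k2) = rect_ival a c h k1 + rect_ival a (c + k1) h k2.
Proof.
move=> h0 k10 k20 aH; rewrite /rect_ival.
rewrite (@ival_split _ _ c (c + k1)); [|lra|lra|by apply: Vdcont; lra].
have -> : ival (fun x => U x c - U x (c + (k1 + k2))) a (a + h) =
   ival (fun x => U x c - U x (c + k1)) a (a + h) +
   ival (fun x => U x (c + k1) - U x (c + k1 + k2)) a (a + h).
  rewrite -ivalD; [|exact: Udcont|exact: Udcont].
  by apply: eq_ival => y _; rewrite addrA; ring.
rewrite !addrA; ring.
Qed.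

Lemma rect_quarter a c h k (M : R) : 0 <= h -> 0 <= k -> a + h < H ->
  M <= `|rect_ival a c h k| -> exists a' c' : R,
    [/\ a <= a' <= a + h / 2, c <= c' <= c + k / 2 &
        M / 4 <= `|rect_ival a' c' (h / 2) (k / 2)|].
Proof.
move=> h0 k0 aH.
have -> : rect_ival a c h k =
  rect_ival a c (h / 2) (k / 2) + rect_ival a (c + k / 2) (h / 2) (k / 2) +
  (rect_ival (a + h / 2) c (h / 2) (k / 2) +
   rect_ival (a + h / 2) (c + k / 2) (h / 2) (k / 2)).
  rewrite -rect_split_v; [|lra|lra|lra|lra]; rewrite -rect_split_v; [|lra|lra|lra|lra].
  have E x : x / 2 + x / 2 = x :> R by lra.
  rewrite E -rect_split_h; [|lra|lra|lra|lra]; by rewrite E.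
set r1 := rect_ival _ _ _ _; set r2 := rect_ival _ _ _ _.
set r3 := rect_ival _ _ _ _; set r4 := rect_ival _ _ _ _.
move=> MS.
have [h1|h1] := leP (M / 4) `|r1|; first by exists a, c; split; lra.
have [h2|h2] := leP (M / 4) `|r2|; first by exists a, (c + k / 2); split; lra.
have [h3|h3] := leP (M / 4) `|r3|; first by exists (a + h / 2), c; split; lra.
have [h4|h4] := leP (M / 4) `|r4|; first by exists (a + h / 2), (c + k / 2); split; lra.
have := ler_normD (r1 + r2) (r3 + r4); have := ler_normD r1 r2; have := ler_normD r3 r4.
lra.
Qed.

(** For the affine approximation at [z], the difference of [U] between the horizontal sides is Im d
    * k and that of [V] between the vertical sides is Im d * h; both integrals become Im d * h * k
    and cancel. Only the remainder is left, on sides of total length h + k. *)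
Lemma rect_small (z d : C) (e a c h k : R) : 0 <= h -> 0 <= k -> a + h < H -> 0 <= e ->
  a <= complex.Re z <= a + h -> c <= complex.Im z <= c + k ->
  (forall w : C, normc (w - z) <= h + k ->
     normc (G w - G z - d * (w - z)) <= e * normc (w - z)) ->
  `|rect_ival a c h k| <= 2 * e * (h + k) ^+ 2.
Proof.
move=> h0 k0 aH e0 /andP[z1 z2] /andP[z3 z4] Gz.
have near x y : a <= x <= a + h -> c <= y <= c + k ->
    normc (G (x +i* y) - G z - d * ((x +i* y) - z)) <= e * (h + k).
  move=> /andP[x1 x2] /andP[y1 y2].
  have xz : normc ((x +i* y) - z) <= h + k.
    case: z z1 z2 z3 z4 {Gz} => p q /= *; rewrite (le_trans (normc_le_ReIm _ _))//.
    by apply: lerD; rewrite ler_norml; lra.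
  by rewrite (le_trans (Gz _ xz))// ler_wpM2l.
have E1 x : a <= x <= a + h -> `|(U x c - U x (c + k)) - complex.Im d * k| <= 2 * (e * (h + k)).
  move=> xa.
  have := near x c xa; rewrite lexx lerDl k0 => /(_ isT) n1.
  have := near x (c + k) xa; rewrite lexx lerDl k0 => /(_ isT) n2.
  have := le_trans (normc_Re _) n1; have := le_trans (normc_Re _) n2.
  rewrite /U; case: (G (x +i* c)) => u1 v1; case: (G (x +i* _)) => u2 v2.
  case: (G z) => u3 v3; case: d {Gz near n1 n2} => d1 d2; case: z {z1 z2 z3 z4} => p q /=.
  rewrite !ler_norml; lra.
have E2 y : c <= y <= c + k -> `|(V (a + h) y - V a y) - complex.Im d * h| <= 2 * (e * (h + k)).
  move=> ya.
  have := near a y; rewrite lexx lerDl h0 => /(_ isT ya) n1.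
  have := near (a + h) y; rewrite lexx lerDl h0 => /(_ isT ya) n2.
  have := le_trans (normc_Im _) n1; have := le_trans (normc_Im _) n2.
  rewrite /V; case: (G (a +i* y)) => u1 v1; case: (G (_ +i* y)) => u2 v2.
  case: (G z) => u3 v3; case: d {Gz near n1 n2 E1} => d1 d2; case: z {z1 z2 z3 z4} => p q /=.
  rewrite !ler_norml; lra.
have ah : a <= a + h by lra.
have ck : c <= c + k by lra.
have := ival_near_cst ah (@Udcont c (c + k) a _ aH) E1.
have aH' : a < H by lra.
have := ival_near_cst ck (Vdcont (c := c) (d := c + k) aH aH') E2.
have -> : c + k - c = k by ring.
have -> : a + h - a = h by ring.
rewrite /rect_ival !ler_norml; set I1 := ival _ _ _; set I2 := ival _ _ _.
have -> : complex.Im d * k * h = complex.Im d * h * k by ring.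
by move: (complex.Im d * h * k) => m; rewrite expr2; lra.
Qed.

(** By bisection, an integral of modulus M > 0 leaves one of modulus at least M / 4^n on quarters
    shrinking to a point, against the quadratic bound of [rect_small]. Half-planes suffice as
    domains since [cexp] wraps them onto punctured discs. *)
Theorem goursat a c h k : 0 <= h -> 0 <= k -> a + h < H -> rect_ival a c h k = 0.
Proof.
move=> h0 k0 aH; apply/eqP; rewrite -normr_eq0; apply/negPn/negP => n0.
have {n0} : 0 < `|rect_ival a c h k| by rewrite lt_def n0 normr_ge0.
pose M : R := `|rect_ival a c h k|; rewrite -/M => M0.
pose P (n : nat) (p : R * R) := [/\ a <= p.1, p.1 + h / 2 ^+ n <= a + h &
  M / 4 ^+ n <= `|rect_ival p.1 p.2 (h / 2 ^+ n) (k / 2 ^+ n)|].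
pose Q (n : nat) (p q : R * R) := p.1 <= q.1 <= p.1 + h / 2 ^+ n.+1 /\
  p.2 <= q.2 <= p.2 + k / 2 ^+ n.+1.
have half (x : R) n : x / 2 ^+ n / 2 = x / 2 ^+ n.+1.
  by rewrite exprSr invfM mulrA.
have half' (x : R) n : x / 2 ^+ n.+1 + x / 2 ^+ n.+1 = x / 2 ^+ n.
  by rewrite -half; lra.
have pos (x : R) n : 0 <= x -> 0 <= x / 2 ^+ n.
  by move=> x0; rewrite divr_ge0// exprn_ge0.
have step n p : P n p -> exists q, P n.+1 q /\ Q n p q.
  move=> [p1 p2 p3].
  have pH : p.1 + h / 2 ^+ n < H by exact: le_lt_trans p2 aH.
  have [a' [c' [a1 c1 r]]] := rect_quarter (pos _ n h0) (pos _ n k0) pH p3.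
  move: a1 c1 r; rewrite !half => a1 c1 r; have E := half' h n.
  exists (a', c'); split=> //; split => /=; [lra|lra|].
  by rewrite exprSr invfM mulrA.
have [f [f0 fP]] : exists f : nat -> R * R, f 0%N = (a, c) /\
    forall n, P n (f n) /\ Q n (f n) (f n.+1).
  (* Each subdivision needs the invariant of the rectangle before it, so the iteration runs on
     rectangles packed with a proof of [P]. *)
  pose S := {np : nat * (R * R) | P np.1 np.2}.
  have P0 : P 0%N (a, c) by split; rewrite /= ?expr0 ?divr1.
  pose nxt (s : S) : S := let: exist np Pnp := s in
    exist (fun np => P np.1 np.2) (np.1.+1, projT1 (cid (step _ _ Pnp)))
      (projT2 (cid (step _ _ Pnp))).1.
  pose s0 : S := exist (fun np => P np.1 np.2) (0%N, (a, c)) P0.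
  pose sq n := iter n nxt s0.
  have sq1 n : (sval (sq n)).1 = n.
    elim: n => [//|n IH]; rewrite /sq iterS -/(sq n).
    by case: (sq n) IH => np Pnp /= ->.
  exists (fun n => (sval (sq n)).2); split => // n; split.
    by have := svalP (sq n); rewrite sq1.
  have := sq1 n; rewrite /sq iterS -/(sq n).
  case: (sq n) => np Pnp /= <-.
  by case: (projT2 (cid (step _ _ Pnp))).
(* Nested intervals: the supremum of the left endpoints lies in all of them. This is applied to each
   coordinate. *)
have mono (x : nat -> R) (L : R) : 0 <= L ->
    (forall n, x n <= x n.+1 <= x n + L / 2 ^+ n.+1) ->
    exists A, forall n, x n <= A <= x n + L / 2 ^+ n.
  move=> L0 xn.
  have incr n m : x n <= x (n + m)%N.
    elim: m => [|m IH]; first by rewrite addn0.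
    by rewrite addnS (le_trans IH)//; have /andP[] := xn (n + m)%N.
  have decr n m : x (n + m)%N + L / 2 ^+ (n + m) <= x n + L / 2 ^+ n.
    elim: m => [|m IH]; first by rewrite addn0.
    rewrite addnS (le_trans _ IH)//; have := half' L (n + m)%N.
    by have := xn (n + m)%N; lra.
  have bnd n m : x m <= x n + L / 2 ^+ n.
    case: (leqP n m) => [/subnKC <-|/ltnW/subnKC E].
      by apply: le_trans (decr n (m - n)%N); rewrite lerDl pos.
    by rewrite -E; apply: le_trans (incr m (n - m)%N) _; rewrite lerDl pos.
  exists (sup (range x)) => n.
  have ne : range x !=set0 by exists (x 0%N); exists 0%N.
  apply/andP; split.
    apply: ub_le_sup; last by exists n.
    by exists (x 0%N + L / 2 ^+ 0) => _ [m _ <-]; exact: bnd.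
  by apply: ge_sup => // _ [m _ <-]; exact: bnd.
have [A A1] : exists A, forall n, (f n).1 <= A <= (f n).1 + h / 2 ^+ n.
  by apply: mono => // n; have [_ []] := fP n.
have [B B1] : exists B, forall n, (f n).2 <= B <= (f n).2 + k / 2 ^+ n.
  by apply: mono => // n; have [_ []] := fP n.
have AH : A < H.
  apply: le_lt_trans aH; have := A1 0%N; rewrite f0/= expr0 divr1; lra.
have [d Gd] := dG (z := A +i* B) AH.
(* This makes 2 e (h + k)^2 smaller than M; the summand 4 keeps the denominator positive for
   degenerate rectangles. *)
pose e := M / (4 * (h + k) ^+ 2 + 4).
have den0 : 0 < 4 * (h + k) ^+ 2 + 4.
  by have := sqr_ge0 (h + k); lra.
have e0 : 0 < e by rewrite divr_gt0.
have [r r0 rE] := eps_cderiv Gd e0.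
have [n nr] : exists n, (h + k) / 2 ^+ n < r.
  have [n nE] : exists n : nat, (h + k) / r < n%:R.
    by exists (Num.truncn ((h + k) / r)).+1; rewrite truncnS_gt.
  exists n; rewrite ltr_pdivrMr ?exprn_gt0// mulrC -ltr_pdivrMr//.
  apply: lt_le_trans nE _; rewrite -natrX ler_nat ltnW// ltn_expl//.
have [[p1 p2 p3] _] := fP n.
have := rect_small (z := A +i* B) (d := d) (e := e) (pos _ n h0) (pos _ n k0)
  (le_lt_trans p2 aH) (ltW e0) (A1 n) (B1 n).
have E4 : (2 : R) ^+ n * 2 ^+ n = 4 ^+ n.
  by rewrite -exprMn; congr (_ ^+ _); lra.
have n4 : 0 < (4 : R) ^+ n by rewrite exprn_gt0.
move=> /(_ _)/wrap[|].
  move=> w wz; apply: rE; apply: le_lt_trans wz _.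
  by rewrite -mulrDl.
move=> small; have := le_trans p3 small; rewrite -mulrDl expr_div_n (expr2 (2 ^+ n)) E4.
rewrite mulrA ler_pM2r ?invr_gt0// /e.
have -> : 2 * (M / (4 * (h + k) ^+ 2 + 4)) * (h + k) ^+ 2 =
   M * ((2 * (h + k) ^+ 2) / (4 * (h + k) ^+ 2 + 4)) by ring.
rewrite -{1}[M]mulr1 ler_pM2l// ler_pdivlMr// mul1r.
by have := sqr_ge0 (h + k); lra.
Qed.

End Goursat.

(** * The exponential, mean values over circles and the Schwarz lemma at the centre *)

Section MeanValue.
Context {R : realType}.
Local Notation C := R[i].

Definition cexp (z : C) : C :=
  (expR (complex.Re z) * cos (complex.Im z)) +i* (expR (complex.Re z) * sin (complex.Im z)).

Lemma cexpD z w : cexp (z + w) = cexp z * cexp w.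
Proof.
case: z w => a b [c d]; rewrite /cexp/= expRD cosD sinD; simpc.
by congr (_ +i* _); ring.
Qed.

Lemma cexp_near0 (e : R) : 0 < e -> exists2 r : R, 0 < r &
  forall h : C, normc h < r -> normc (cexp h - 1 - h) <= e * normc h.
Proof.
(* Six errors of size e1 |h| add up: three in the real part, two in the imaginary part, and one from
   the product term, where |h| < e1 / 2. *)
move=> e0; pose e1 := Num.min 1 (e / 6).
have e10 : 0 < e1 by rewrite lt_min ltr01/=; lra.
have [e11 e1e] : e1 <= 1 /\ e1 <= e / 6 by rewrite !ge_min !lexx orbT.
have near0 (f : R -> R) (d : R) : is_derive (0 : R) 1 f d -> exists2 r : R, 0 < r &
    forall x, `|x| < r -> `|f x - f 0 - d * x| <= e1 * `|x|.
  move=> fd; have [r /= r0 rE] := is_derive_eps fd e10.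
  by exists r => // x xr; have := rE x; rewrite /= sub0r normrN add0r mulrC; apply.
have [r1 r10 expE] := near0 _ _ (is_derive_expR (0 : R)).
have [r2 r20 cosE] := near0 _ _ (is_derive_cos (0 : R)).
have [r3 r30 sinE] := near0 _ _ (is_derive_sin (0 : R)).
exists (Num.min (Num.min r1 (e1 / 2)) (Num.min r2 r3)).
  by rewrite !lt_min r10 r20 r30/=; lra.
move=> h; rewrite !lt_min => /andP[/andP[h1 hh] /andP[h2 h3]].
have := normc_Re h; have := normc_Im h; move: (normc h) (normc_ge0 h) hh h1 h2 h3 => n n0 hh h1 h2 h3.
case: h => x y; rewrite -[complex.Re (x +i* y)]/x -[complex.Im (x +i* y)]/y => yn xn.
have := expE _ (le_lt_trans xn h1); have := cosE _ (le_lt_trans yn h2).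
have := sinE _ (le_lt_trans yn h3).
rewrite expR0 cos0 sin0 !subr0 oppr0 mul0r subr0 !mul1r.
set X := expR x; set c := cos y; set s := sin y => sE cE xE.
have e1n : e1 * n <= n by rewrite ler_piMl.
have e1x : e1 * `|x| <= e1 * n by rewrite ler_pM2l.
have e1y : e1 * `|y| <= e1 * n by rewrite ler_pM2l.
have X2 : `|X| <= 2.
  rewrite -[X](subrK (1 + x)) (le_trans (ler_normD _ _))//.
  have := ler_normD 1 x; rewrite normr1; move: xE; rewrite opprD addrA => xE; lra.
rewrite /cexp -[complex.Re (x +i* y)]/x -[complex.Im (x +i* y)]/y -/X -/c -/s.
have -> : ((X * c) +i* (X * s) - 1 - x +i* y : C) =
   ((X - 1 - x) + X * (c - 1)) +i* (X * (s - y) + (X - 1) * y).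
  by simpc; congr (_ +i* _); ring.
apply: le_trans (normc_le_ReIm _ _) _.
have n1 : `|X - 1 - x + X * (c - 1)| <= 3 * (e1 * n).
  apply: le_trans (ler_normD _ _) _; rewrite normrM.
  have : `|X| * `|c - 1| <= 2 * (e1 * n).
    by apply: ler_pM => //; exact: le_trans cE e1y.
  by have := le_trans xE e1x; lra.
have n2 : `|X * (s - y) + (X - 1) * y| <= 2 * (e1 * n) + 2 * n * n.
  apply: le_trans (ler_normD _ _) _; rewrite !normrM; apply: lerD.
    by apply: ler_pM => //; exact: le_trans sE e1y.
  apply: ler_pM => //; rewrite -[X - 1](subrK x) (le_trans (ler_normD _ _))//.
  by have := le_trans xE e1x; lra.
have := lerD n1 n2.
have : n * n <= n * (e1 / 2).
  by apply: ler_wpM2l => //; lra.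
have : e1 * n <= e / 6 * n by apply: ler_wpM2r.
lra.
Qed.

Lemma normc_cexp z : normc (cexp z) = expR (complex.Re z).
Proof.
rewrite /cexp /=; case: z => x y; rewrite -[complex.Re (x +i* y)]/x -[complex.Im (x +i* y)]/y.
by rewrite !exprMn -mulrDr cos2Dsin2 mulr1 sqrtr_sqr ger0_norm// expR_ge0.
Qed.

Lemma cderiv_cexp z : cderiv cexp z (cexp z).
Proof.
apply: cderiv_eps => e e0.
have E0 : 0 < normc (cexp z) by rewrite normc_cexp expR_gt0.
have [r r0 rE] := cexp_near0 (divr_gt0 e0 E0).
exists r => // w wz.
have -> : cexp w - cexp z - cexp z * (w - z) = cexp z * (cexp (w - z) - 1 - (w - z)).
  by rewrite !mulrBr -cexpD mulr1 [z + _]addrC subrK; ring.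
rewrite normcM mulrC -ler_pdivlMr// mulrAC; exact: rE.
Qed.

Section Disc.
Variable q : C -> C.
Hypothesis dq : forall z, z != 0 -> normc z < 1 -> exists d, cderiv q z d.

(** [rect_ival] sees the imaginary part on the vertical sides, which [cexp] wraps onto circles;
    hence Im q is averaged, and [schwarz_center] has to rotate its function accordingly. *)
Lemma circle_ival (r s : R) : 0 < r -> r <= s -> s < 1 ->
  ival (fun y => complex.Im (q (cexp (ln r +i* y)))) 0 (pi *+ 2) =
  ival (fun y => complex.Im (q (cexp (ln s +i* y)))) 0 (pi *+ 2).
Proof.
move=> r0 rs s1; have s0 : 0 < s by exact: lt_le_trans rs.
have dG z : complex.Re z < 0 -> exists d, cderiv (fun w => q (cexp w)) z d.
  move=> z0; have [d dE] : exists d, cderiv q (cexp z) d.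
    apply: dq; first by rewrite -normc_gt0 normc_cexp expR_gt0.
    by rewrite normc_cexp -expR0 ltr_expR.
  by exists (d * cexp z); apply: cderiv_comp dE; exact: cderiv_cexp.
have per x : cexp (x +i* 0) = cexp (x +i* (pi *+ 2)).
  by rewrite /cexp -[complex.Im (x +i* 0)]/(0 : R) -[complex.Im (x +i* _)]/(pi *+ 2) sin2pi cos2pi sin0 cos0.
have lnrs : ln r <= ln s by rewrite ler_ln.
have pi0 : 0 <= (pi *+ 2 : R) by rewrite mulrn_wge0// pi_ge0.
move: (pi *+ 2 : R) pi0 per => T pi0 per.
have lr : 0 <= ln s - ln r by rewrite subr_ge0.
have ls0 : ln r + (ln s - ln r) < 0 by rewrite addrC subrK ln_lt0// s0.
have := goursat dG 0 lr pi0 ls0; rewrite /rect_ival add0r.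
rewrite (@eq_ival _ _ (fun=> 0)); last by move=> x _; rewrite per subrr.
rewrite ival_cst; last by rewrite lerDl.
rewrite mul0r sub0r [_ + (_ - _)]addrC subrK => E0.
have E := eq_trans (esym (opprK _)) (eq_trans (congr1 -%R E0) (oppr0 _)).
have c1 (u : R) : 0 < u -> u < 1 ->
    cont_on (fun y => complex.Im (q (cexp (ln u +i* y)))) 0 T.
  by move=> u0 u1; apply: (Vcont dG); rewrite ln_lt0// u0.
have c2 := c1 _ s0 s1; have c3 := c1 _ r0 (le_lt_trans rs s1).
have -> : ival (fun y => complex.Im (q (cexp (ln s +i* y)))) 0 T =
    ival (fun y => complex.Im (q (cexp (ln r +i* y)))) 0 T +
    ival (fun y => complex.Im (q (cexp (ln s +i* y))) -
                   complex.Im (q (cexp (ln r +i* y)))) 0 T.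
  rewrite -ivalD//; first by apply: eq_ival => y _; ring.
  by move=> y yi; exact: (cvgB (c2 _ yi) (c3 _ yi)).
by rewrite E addr0.
Qed.

(* Mean value property over circles, by Goursat's theorem for q o cexp on the
   rectangles [ln r, ln s] x [0, 2 pi], the horizontal sides cancelling out. *)
Lemma max_modulus0 (M s : R) : q @ nbhs 0 --> q 0 -> 0 < s -> s < 1 ->
  (forall z, normc z = s -> normc (q z) <= M) -> complex.Im (q 0) <= M.
Proof.
move=> qc s0 s1 qM; apply/ler_addgt0Pr => e e0.
move/cvgc_Im/cvgrPdist_lt : qc => /(_ _ e0) /near_normc[d d0 dE].
pose r := Num.min (d / 2) s.
have r0 : 0 < r by rewrite lt_min s0 andbT; lra.
have rs : r <= s by rewrite ge_min lexx orbT.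
have rd : r < d by rewrite gt_min; apply/orP; left; lra.
have pi0 : 0 < (pi *+ 2 : R) by rewrite mulrn_wgt0// pi_gt0.
have := circle_ival r0 rs s1; move: (pi *+ 2 : R) pi0 => T pi0.
have ncexp (u y : R) : 0 < u -> normc (cexp (ln u +i* y)) = u.
  by move=> u0; rewrite normc_cexp /= lnK.
have c1 (u : R) : 0 < u -> u < 1 ->
    cont_on (fun y => complex.Im (q (cexp (ln u +i* y)))) 0 T.
  move=> u0 u1 y _; apply: cvgc_Im.
  have [d1 /cderiv_cvg dE1] : exists d, cderiv q (cexp (ln u +i* y)) d.
    by apply: dq; rewrite -?normc_gt0 ncexp.
  apply: (@cvg_comp _ _ _ (fun t : R => cexp (ln u +i* t)) q _ _ _ _ dE1).
  apply: (@cvg_comp _ _ _ (fun t : R => ln u +i* t) cexp _ _ _ _ (cderiv_cvg (cderiv_cexp _))).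
  by apply: cvgc_i; [exact: cvg_cst|exact: cvg_id].
have h1 : (complex.Im (q 0) - e) * T <=
    ival (fun y => complex.Im (q (cexp (ln r +i* y)))) 0 T.
  rewrite -{1}[T]subr0 -ival_cst; last exact: ltW.
  apply: le_ival; [exact: cont_on_cst|by apply: c1 => //; exact: le_lt_trans s1|].
  move=> y _; have := dE (cexp (ln r +i* y)); rewrite subr0 ncexp// => /(_ rd).
  by rewrite ltr_norml; lra.
have h2 : ival (fun y => complex.Im (q (cexp (ln s +i* y)))) 0 T <= M * T.
  rewrite -{2}[T]subr0 -ival_cst; last exact: ltW.
  apply: le_ival; [exact: c1|exact: cont_on_cst|].
  move=> y _; apply: le_trans (qM (cexp (ln s +i* y)) _); last by rewrite ncexp.
  by apply: le_trans (normc_Im _); rewrite ler_norm.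
move=> E; move: h1; rewrite E => /le_trans/(_ h2).
by rewrite (ler_pM2r pi0) lerBlDr.
Qed.

End Disc.

(** The Cayley transform (F - F 0) / (F + conj (F 0)) maps the disc into itself and vanishes at 0.
    Its quotient by z is bounded by 1 / s on the circle of radius s, hence at the centre, where it
    equals d / (2 Re (F 0)); then s tends to 1. *)
Lemma schwarz_center (F : C -> C) (d : C) :
  (forall z, normc z < 1 -> exists d, cderiv F z d) ->
  (forall z, normc z < 1 -> 0 < complex.Re (F z)) ->
  cderiv F 0 d -> normc d <= 2 * complex.Re (F 0).
Proof.
move=> dF F0 Fd.
have n01 : normc (0 : C) < 1 by rewrite normc0 ltr01.
have F00 := F0 _ n01.
pose c := F 0; pose den z := F z + c^*.
have den0 z : normc z < 1 -> den z != 0.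
  move=> /F0 Fz; apply/eqP => /(congr1 (@complex.Re R)).
  by rewrite /den raddfD/=; move: F00; rewrite /c; case: (F 0) => u v /= *; lra.
have [k kd kE] := Fd.
have n2 : (2 * complex.Re c)%:C = den 0.
  rewrite /den /c; case: (F 0) => u v; apply/eqP; rewrite eq_complex /=.
  by apply/andP; split; apply/eqP; ring.
have dend z : normc z < 1 -> exists d, cderiv (fun w => (den w)^-1) z d.
  move=> z1; have [d1 dE1] := dF _ z1; exists (- (d1 + 0) / den z ^+ 2).
  by apply: cderivV; [exact: den0|apply: cderivD => //; exact: cderiv_cst].
(* The rotation makes the value at the centre a nonnegative multiple of i, so that [max_modulus0],
   which bounds an imaginary part, bounds its modulus. *)
have [u u1 uE] : exists2 u : C, normc u = 1 & u * (d / den 0) = (normc (d / den 0))%:C * 'i.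
  case: (eqVneq (d / den 0) 0) => [->|v0].
    by exists 1; rewrite ?normc1// normc0 mulr0 mul0r.
  move: (d / den 0) v0 => v v0.
  exists ((normc v)%:C * 'i / v).
    rewrite !normcM normcV normcR ger0_norm ?normc_ge0//.
    rewrite {2}/normc /= expr0n expr1n add0r sqrtr1 mulr1 divff//.
    by rewrite gt_eqF// normc_gt0.
  by rewrite divfK.
pose q z := u * (k z * (den z)^-1).
have den00 := den0 _ n01.
have dq z : z != 0 -> normc z < 1 -> exists d, cderiv q z d.
  move=> z0 z1; have [d1 dE1] := dF _ z1; have [d2 dE2] := dend _ z1.
  have [d3 dE3] : exists d3, cderiv (fun w => (F w + - F 0) * w^-1) z d3.
    exists ((d1 + 0) * z^-1 + (F z + - F 0) * (- 1 / z ^+ 2)); apply: cderivM.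
      by apply: cderivD => //; exact: cderiv_cst.
    by apply: cderivV => //; exact: cderiv_id.
  have kd3 : cderiv k z d3.
    apply: cderiv_near dE3; apply/near_normc; exists (normc z).
      by rewrite normc_gt0.
    move=> w wz; have w0 : w != 0.
      by apply: contraTneq wz => ->; rewrite sub0r normcN ltxx.
    by have := kE w; rewrite subr0 => ->; rewrite mulfK.
  exists (0 * (k z * (den z)^-1) + u * (d3 * (den z)^-1 + k z * d2)).
  by apply: cderivM; [exact: cderiv_cst|exact: cderivM].
(* k is d at 0 only up to its (irrelevant) value at the centre *)
pose q1 z := if z == 0 then u * (d / den 0) else q z.
have dq1 z : z != 0 -> normc z < 1 -> exists d, cderiv q1 z d.
  move=> z0 z1; have [d1 dE1] := dq _ z0 z1; exists d1.
  apply: cderiv_near dE1; apply/near_normc; exists (normc z).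
    by rewrite normc_gt0.
  move=> w wz; rewrite /q1; case: eqP => // w0.
  by move: wz; rewrite w0 sub0r normcN ltxx.
have q1c : q1 @ nbhs 0 --> q1 0.
  rewrite {2}/q1 eqxx.
  have qc : q @ nbhs 0 --> u * (d / den 0).
    apply: (cvgcM (cvg_cst u)); apply: (cvgcM kd).
    by have [d2 /cderiv_cvg] := dend _ n01.
  move/cvgc_normc: qc => qc; apply/cvgc_normc => e e0.
  have := qc _ e0; apply: filterS => w; rewrite /q1; case: eqP => // _ _.
  by rewrite subrr normc0.
suff H s : 0 < s -> s < 1 -> normc (d / den 0) * s <= 1.
  have : normc (d / den 0) <= 1.
    have n0 : 0 <= normc (d / den 0) by exact: normc_ge0.
    rewrite leNgt; apply/negP => n1.
    (* If the modulus at the centre is n > 1, this radius lies in (0, 1) and gives n s = (n + 1) / 2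
       > 1. *)
    pose s := (1 + (normc (d / den 0))^-1) / 2.
    have i1 : (normc (d / den 0))^-1 < 1 by rewrite invf_lt1//; lra.
    have i0 : 0 < (normc (d / den 0))^-1 by rewrite invr_gt0; lra.
    have := H s; rewrite /s => /(_ ltac:(lra) ltac:(lra)).
    have := mulfV (lt0r_neq0 (lt_trans ltr01 n1)).
    by move: i1 i0; move: (_^-1) => v; move: n1; move: (normc _) => n; nra.
  rewrite normcM normcV -n2 normcR ger0_norm; last by rewrite /c; lra.
  by rewrite ler_pdivrMr ?mul1r// /c; lra.
move=> s0 s1; rewrite -ler_pdivlMr// mul1r.
have := @max_modulus0 q1 dq1 s^-1 s q1c s0 s1 _.
rewrite {2}/q1 eqxx uE.
have -> : complex.Im ((normc (d / den 0))%:C * 'i) = normc (d / den 0) :> R by simpc.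
apply=> z zs; have z0 : z != 0 by rewrite -normc_gt0 zs.
rewrite /q1 (negbTE z0) /q normcM u1 mul1r normcM normcV.
have -> : normc (k z) = normc (F z - F 0) / s.
  by rewrite kE subr0 normcM zs mulfK// gt_eqF.
have zn1 : normc z < 1 by rewrite zs.
have dz : 0 < normc (den z) by rewrite normc_gt0 den0.
rewrite mulrAC -[leRHS]mul1r ler_wpM2r ?invr_ge0 ?(ltW s0)// ler_pdivrMr// mul1r.
(* As both real parts are positive, F z is nearer to F 0 than to the mirror image of F 0 in the
   imaginary axis. *)
rewrite -(@ler_pXn2r _ 2) ?nnegrE ?normc_ge0// !normc_sqr /den /c.
move: (F0 _ zn1) F00; case: (F z) => a b; case: (F 0) => a' b' /= h1 h2.
have : 0 < a * a' by rewrite mulr_gt0.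
rewrite !expr2; nra.
Qed.

End MeanValue.

(** * The Schwarz-Pick inequality for maps of the disc to the right half-plane *)

Section SchwarzPick.
Context {R : realType}.
Local Notation C := R[i].
Implicit Types (F g : C -> C) (a b z w : C).

Definition mob b z : C := (z + b) / (1 + b^* * z).

Lemma mob_den b z : normc b < 1 -> normc z < 1 -> 1 + b^* * z != 0.
Proof.
move=> b1 z1; apply/eqP => /eqP; rewrite addr_eq0 => /eqP/(congr1 (@normc R)).
rewrite normc1 normcN normcM normc_conj => E.
have : normc b * normc z < 1 by rewrite mulr_ilt1// normc_ge0.
by rewrite -E ltxx.
Qed.

(** From the identity |1 + conj b z|^2 - |z + b|^2 = (1 - |b|^2) (1 - |z|^2). *)
Lemma mob_lt1 b z : normc b < 1 -> normc z < 1 -> normc (mob b z) < 1.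
Proof.
move=> b1 z1; have d0 := mob_den b1 z1.
rewrite /mob normcM normcV ltr_pdivrMr ?normc_gt0// mul1r.
rewrite -(@ltr_pXn2r _ 2) ?nnegrE ?normc_ge0// !normc_sqr.
have : 0 < (1 - normc b ^+ 2) * (1 - normc z ^+ 2).
  by rewrite mulr_gt0// subr_gt0 expr_lt1// normc_ge0.
rewrite !normc_sqr; case: b {b1 d0} => p q; case: z {z1} => x y /=.
rewrite -subr_gt0 => H; rewrite -subr_gt0; apply: lt_le_trans H _.
rewrite subr0 le_eqVlt; apply/orP; left; apply/eqP; ring.
Qed.

Lemma cderiv_mob b z : normc b < 1 -> normc z < 1 -> exists d, cderiv (mob b) z d.
Proof.
move=> b1 z1; eexists; apply: cderivM.
  by apply: cderivD; [exact: cderiv_id|exact: cderiv_cst].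
apply: cderivV; first exact: mob_den.
apply: cderivD; first exact: cderiv_cst.
by apply: cderivM; [exact: cderiv_cst|exact: cderiv_id].
Qed.

Lemma cderiv_mob0 b : cderiv (mob b) 0 (1 - (normc b ^+ 2)%:C).
Proof.
have E : 1 + b^* * 0 = 1 :> C by rewrite mulr0 addr0.
have := @cderivM R (fun z => z + b) (fun z => (1 + b^* * z)^-1) 0 _ _
  (cderivD (cderiv_id 0) (cderiv_cst b 0))
  (@cderivV R (fun z => 1 + b^* * z) 0 _ _ (cderivD (cderiv_cst 1 0)
    (cderivM (cderiv_cst b^* 0) (cderiv_id 0)))).
rewrite /= E => /(_ (oner_neq0 _)); congr cderiv.
rewrite invr1 expr1n divr1 !addr0 !mulr1 mul0r !add0r mulrN.
by congr (_ - _); rewrite normc_sqr; case: b {E} => p q; simpc; congr (_ +i* _); ring.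
Qed.

Section HalfPlane.
Variable F : C -> C.
Hypothesis dF : forall z, normc z < 1 -> exists d, cderiv F z d.
Hypothesis F0 : forall z, normc z < 1 -> 0 < complex.Re (F z).

(** Precompose with [mob z], which sends 0 to z with derivative 1 - |z|^2 there. *)
Lemma schwarz_deriv z d : normc z < 1 -> cderiv F z d ->
  normc d * (1 - normc z ^+ 2) <= 2 * complex.Re (F z).
Proof.
move=> z1 Fd.
have m0 : mob z 0 = z by rewrite /mob add0r mulr0 addr0 divr1.
have dG w : normc w < 1 -> exists d, cderiv (fun w => F (mob z w)) w d.
  move=> w1; have [d1 h1] := cderiv_mob z1 w1; have [d2 h2] := dF (mob_lt1 z1 w1).
  by exists (d2 * d1); exact: cderiv_comp.
have G0 w : normc w < 1 -> 0 < complex.Re (F (mob z w)).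
  by move=> w1; apply/F0/mob_lt1.
have Fd0 : cderiv F (mob z 0) d by rewrite m0.
have := schwarz_center dG G0 (cderiv_comp (cderiv_mob0 z) Fd0).
rewrite m0; rewrite normcM -(rmorphB (real_complex R) 1) normcR ger0_norm//.
by rewrite subr_ge0 expr_le1 ?normc_ge0 ?ltW.
Qed.

Lemma is_derive_Re (t : R) d : cderiv F t%:C d ->
  is_derive t 1 (fun s : R => complex.Re (F s%:C)) (complex.Re d).
Proof.
move=> Fd; apply: eps_is_derive => e e0.
have [r r0 rE] := eps_cderiv Fd e0.
apply/nbhs_ballP; exists r => //= h; rewrite /ball/= sub0r normrN => hr.
have := rE (t + h)%:C; rewrite rmorphD addrAC subrr add0r normcR => /(_ hr) H.
apply: le_trans H; apply: le_trans (normc_Re _); rewrite !raddfB/=.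
by case: d {Fd rE} => p q; simpc; rewrite mulrC.
Qed.

(** Along the radius the derivative of ln (Re F) is bounded by 2 / (1 - s^2), which is the
    derivative of ln ((1 + s) / (1 - s)). Both signs are integrated by means of the mean value
    theorem. *)
Lemma schwarz_pick_radial (t : R) : 0 <= t -> t < 1 ->
  `|ln (complex.Re (F t%:C)) - ln (complex.Re (F 0))| <= ln ((1 + t) / (1 - t)).
Proof.
rewrite le_eqVlt => /orP[/eqP <-|t0 t1].
  by move=> _; rewrite subrr normr0 addr0 subr0 divr1 ln1.
pose v (s : R) := ln (complex.Re (F s%:C)).
pose L (s : R) := ln (1 + s) - ln (1 - s).
have n1 (s : R) : 0 <= s -> s <= t -> normc s%:C < 1.
  by move=> s0 st; rewrite normcR ger0_norm//; exact: le_lt_trans st t1.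
have dL (s : R) : 0 <= s -> s <= t -> is_derive s 1 L (2 / (1 - s ^+ 2)).
  move=> s0 st.
  have h1 : is_derive s 1 (fun s : R => ln (1 + s)) (1 + s)^-1.
    rewrite -[X in is_derive _ _ _ X]mulr1.
    apply: (@is_derive1_comp _ (@ln R) (fun s => 1 + s)).
      by apply: is_derive1_ln; lra.
    by rewrite -[X in is_derive _ _ _ X](add0r 1); apply: is_deriveD.
  have h2 : is_derive s 1 (fun s : R => ln (1 - s)) ((1 - s)^-1 * -1).
    apply: (@is_derive1_comp _ (@ln R) (fun s => 1 - s)).
      by apply: is_derive1_ln; lra.
    by rewrite -[X in is_derive _ _ _ X](add0r (- 1)); apply: is_deriveB.
  have -> : 2 / (1 - s ^+ 2) = (1 + s)^-1 - (1 - s)^-1 * -1.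
    by field; apply/andP; split; [|apply/andP; split]; apply: lt0r_neq0; nra.
  exact: is_deriveB.
have dv (s : R) : 0 <= s -> s <= t -> exists2 d, is_derive s 1 v d & `|d| <= 2 / (1 - s ^+ 2).
  move=> s0 st; have s1 := n1 _ s0 st; have [d Fd] := dF s1; have Fs := F0 s1.
  exists ((complex.Re (F s%:C))^-1 * complex.Re d).
    apply: (@is_derive1_comp _ (@ln R) (fun s : R => complex.Re (F s%:C))).
      exact: is_derive1_ln.
    exact: is_derive_Re.
  have := schwarz_deriv s1 Fd; rewrite normcR real_normK ?num_real// => H.
  have s2 : 0 < 1 - s ^+ 2 by rewrite subr_gt0 expr_lt1 => //; lra.
  rewrite normrM normfV (ger0_norm (ltW Fs)) ler_pdivlMr// -mulrA.
  rewrite ler_pdivrMl// [leRHS]mulrC; apply: le_trans H.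
  by rewrite ler_wpM2r ?normc_Re// ltW.
have L0 : L 0 = 0 by rewrite /L addr0 subr0 subrr.
have Lt : L t = ln ((1 + t) / (1 - t)) by rewrite /L ln_div// posrE; lra.
have mono (f : R -> R) (df : R -> R) : (forall s, 0 <= s -> s <= t -> is_derive s 1 f (df s)) ->
    (forall s, 0 <= s -> s <= t -> df s <= 0) -> f t <= f 0.
  move=> fd fn.
  have [c] : exists2 c, c \in `]0, t[%R & f t - f 0 = df c * (t - 0).
    apply: MVT => //.
      by move=> x; rewrite in_itv/= => /andP[x0 xt]; apply: fd; exact: ltW.
    apply: continuous_subspace_itv => x; rewrite in_itv/= => /andP[x0 xt].
    apply: differentiable_continuous; apply/derivable1_diffP.
    by have := fd _ x0 xt; case.
  rewrite in_itv/= subr0 => /andP[c0 ct] E.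
  have dc := fn c (ltW c0) (ltW ct).
  by rewrite -subr_le0 E mulr_le0_ge0//; exact: ltW.
have [w wE wL] : exists2 w : R -> R, forall s, 0 <= s -> s <= t -> is_derive s 1 v (w s) &
    forall s, 0 <= s -> s <= t -> `|w s| <= 2 / (1 - s ^+ 2).
  have H (s : R) : exists d : R, 0 <= s -> s <= t ->
      is_derive (s : R) (1 : R) v d /\ `|d| <= 2 / (1 - s ^+ 2).
    case: (pselect (0 <= s /\ s <= t)) => [[s0 st]|n].
      by have [d h1 h2] := dv _ s0 st; exists d.
    by exists 0 => s0 st; exfalso; apply: n.
  have [w wP] := choice H.
  by exists w => s s0 st; have [] := wP _ s0 st.
have v0E : ln (complex.Re (F 0)) = v 0 by [].
rewrite -Lt v0E -/(v t) ler_norml; apply/andP; split.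
  have := mono (fun s => - v s - L s) (fun s => - w s - 2 / (1 - s ^+ 2)) _ _.
  rewrite L0 subr0; have -> : - v t - L t <= - v 0 = (- L t <= v t - v 0) by rewrite lerBlDr [RHS]lerNl opprB lerBlDr addrC -subr_ge0 -[RHS]subr_ge0; congr (0 <= _); ring.
  apply=> s s0 st.
    by apply: is_deriveB; [apply: is_deriveN; exact: wE|exact: dL].
  by have := wL _ s0 st; rewrite ler_norml; lra.
have := mono (fun s => v s - L s) (fun s => w s - 2 / (1 - s ^+ 2)) _ _.
rewrite L0 subr0 [v t - v 0 <= _]lerBlDr [v t - L t <= _]lerBlDr addrC; apply=> s s0 st.
  by apply: is_deriveB; [exact: wE|exact: dL].
by have := wL _ s0 st; rewrite ler_norml; lra.
Qed.

End HalfPlane.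

(** A Moebius map and a rotation carry 0 to b and a point of the positive radius to a; the factor 2
    undoes the division by 2 in [poincare_dist]. *)
Lemma schwarz_pick F a b : (forall z, normc z < 1 -> exists d, cderiv F z d) ->
  (forall z, normc z < 1 -> 0 < complex.Re (F z)) ->
  normc a < 1 -> normc b < 1 ->
  `|ln (complex.Re (F a)) - ln (complex.Re (F b))| <= 2 * poincare_dist a b.
Proof.
move=> dF F0 a1 b1; rewrite /poincare_dist.
set z := (a - b) / (1 - b^* * a).
have zE : z = mob (- b) a by rewrite /mob rmorphN mulNr.
have nb1 : normc (- b) < 1 by rewrite normcN.
have z1 : normc z < 1 by rewrite zE mob_lt1.
have [u u1 uz] : exists2 u : C, normc u = 1 & u * (normc z)%:C = z.
  case: (eqVneq z 0) => [->|z0].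
    by exists 1; rewrite ?normc1// normc0 mulr0.
  have n0 : normc z != 0 by rewrite normc_eq0.
  have nc0 : (normc z)%:C != 0 by rewrite fmorph_eq0.
  exists (z / (normc z)%:C); last by rewrite divfK.
  by rewrite normcM normcV normcR ger0_norm ?normc_ge0// divff.
have nu w : normc w < 1 -> normc (u * w) < 1 by rewrite normcM u1 mul1r.
have dG w : normc w < 1 -> exists d, cderiv (fun w => F (mob b (u * w))) w d.
  move=> w1; have [d1 h1] := cderiv_mob b1 (nu _ w1).
  have [d2 h2] := dF (mob b (u * w)) (mob_lt1 b1 (nu _ w1)).
  have h3 := cderivM (cderiv_cst u w) (cderiv_id w).
  by eexists; apply: (cderiv_comp (g := fun w => mob b (u * w)) _ h2);
    apply: cderiv_comp h3 h1.
have G0 w : normc w < 1 -> 0 < complex.Re (F (mob b (u * w))).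
  by move=> w1; apply/F0/mob_lt1 => //; exact: nu.
have := schwarz_pick_radial dG G0 (normc_ge0 _) z1.
rewrite uz mulr0 (_ : mob b 0 = b); last by rewrite /mob add0r mulr0 addr0 divr1.
rewrite (_ : mob b z = a); first by move=> H; apply: le_trans H _; lra.
have d1 : 1 - b^* * a != 0.
  by have := mob_den nb1 a1; rewrite rmorphN mulNr.
have d2 : 1 - b^* * b != 0.
  by have := mob_den nb1 b1; rewrite rmorphN mulNr.
rewrite /mob /z; field; rewrite d1/=.
have -> : 1 - b^* * a + b^* * (a - b) = 1 - b^* * b by ring.
exact: d2.
Qed.

End SchwarzPick.

(** * Lower bounds for the Kobayashi distance from maps to the half-plane *)

Section KobayashiLowerBound.
Context {R : realType}.
Local Notation C := R[i].

(** The increments of ln (Re Phi) telescope along a chain of discs. [Phi] is asked to be holomorphic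
    along analytic discs only, so that no notion of holomorphic function of several variables is
    involved. *)
Lemma kobayashi_ge n (Omega : set 'rV[C]_n) (Phi : 'rV[C]_n -> C) (z w : 'rV[C]_n) :
  (forall phi, holo_disc 1 Omega phi -> forall x : C, normc x < 1 ->
     0 < complex.Re (Phi (phi x)) /\ exists d, cderiv (fun x => Phi (phi x)) x d) ->
  ((`|ln (complex.Re (Phi z)) - ln (complex.Re (Phi w))| / 2)%:E <= kobayashi Omega z w)%E.
Proof.
move=> H; apply: le_ereal_inf_tmp => _ [L [m [x [phi [a [b [x0 xm step ->]]]]]] <-].
rewrite lee_fin ler_pdivrMr// mulrC mulr_sumr -x0 -xm.
pose l j := ln (complex.Re (Phi (x j))).
have tele k : (k <= m.+1)%N ->
    `|l 0%N - l k| <= \sum_(j < k) 2 * poincare_dist (a j) (b j).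
  elim: k => [|k IH] km; first by rewrite big_ord0 subrr normr0.
  rewrite big_ord_recr/=.
  have -> : l 0%N - l k.+1 = (l 0%N - l k) + (l k - l k.+1) by ring.
  apply: le_trans (ler_normD _ _) _; apply: lerD; first exact: IH (ltnW km).
  have [hd a1 b1 aE bE] := step _ km.
  move: a1 b1; rewrite !norm_normc -(rmorph1 (real_complex R)) !ltcR => a1 b1.
  rewrite /l -aE -bE; apply: (@schwarz_pick R (fun y => Phi (phi k y))) => //.
    by move=> y y1; have [_] := H _ hd y y1.
  by move=> y y1; have [] := H _ hd y y1.
exact: tele.
Qed.

End KobayashiLowerBound.

(** * Pencils of complex lines: the diamond, and the branch of the square root *)

Section Pencils.
Context {R : realType}.
Local Notation C := R[i].

(** For t in [0, 1] this is half a turn from 1 to -1. Its square makes a full turn, which brings a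
    line back to itself and a square root to its opposite. *)
Definition zeta (t : R) : C := cos (pi * t) +i* sin (pi * t).

Lemma normc_zeta t : normc (zeta t) = 1.
Proof. by rewrite /zeta /= cos2Dsin2 sqrtr1. Qed.

Lemma zeta_neq0 t : zeta t != 0.
Proof. by rewrite -normc_gt0 normc_zeta ltr01. Qed.

Lemma continuous_zeta : continuous zeta.
Proof.
have c1 : continuous (fun t : R => pi * t) by exact: mulrl_continuous.
move=> t; apply: cvgc_i.
  by apply: (continuousc c1); exact: continuous_cos.
by apply: (continuousc c1); exact: continuous_sin.
Qed.

Lemma zeta0 : zeta 0 = 1.
Proof. by rewrite /zeta mulr0 cos0 sin0. Qed.

Lemma zeta1 : zeta 1 = - 1.
Proof. by rewrite /zeta mulr1 cospi sinpi; simpc. Qed.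

(* Om x w stands for "the point with coordinates (x, w) lies in the domain". *)
Variable Om : C -> C -> Prop.
Hypothesis OmO : forall x w, Om x w -> exists2 e : R, 0 < e &
  forall x' w', normc (x' - x) < e -> normc (w' - w) < e -> Om x' w'.
Hypothesis OmL : forall x w u v, (u != 0) || (v != 0) ->
  connected [set t | Om (x + t * u) (w + t * v)] /\
  loops_contract [set t | Om (x + t * u) (w + t * v)].

Lemma Om_near {T : Type} {F : set_system T} {FF : Filter F} (X W : T -> C) x w :
  X @ F --> x -> W @ F --> w -> Om x w -> \forall t \near F, Om (X t) (W t).
Proof.
move=> /cvgc_normc Xx /cvgc_normc Ww /OmO[e e0 eE]; near=> t.
by apply: eE; near: t; [exact: Xx|exact: Ww].
Unshelve. all: end_near. Qed.

Lemma open_line x w u v : open [set t | Om (x + t * u) (w + t * v)].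
Proof.
rewrite openE => t /= Ot; rewrite /interior/=.
apply: (@Om_near _ (nbhs t) _ (fun t => x + t * u) (fun t => w + t * v) _ _ _ _ Ot).
  exact: (cvgD (cvg_cst _) (cvgcM (@cvg_id _ (nbhs t)) (cvg_cst _))).
exact: (cvgD (cvg_cst _) (cvgcM (@cvg_id _ (nbhs t)) (cvg_cst _))).
Qed.

(* If (x, w) is not in the domain, the lines of slope ka * zeta ^ 2 through it
   cannot carry two points of the domain that turn at different speeds. *)
Lemma pencil x w (ka : R) (A B : C) : ~ Om x w -> 0 < ka -> A != 0 -> B != 0 ->
  (forall z : C, normc z = 1 ->
     Om (x + A) (w + ka%:C * z ^+ 2 * A) /\ Om (x + B / z ^+ 2) (w + ka%:C * B)) ->
  False.
Proof.
move=> nO ka0 A0 B0 H.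
pose D (t : R) := [set z | Om (x + z * 1) (w + z * (ka%:C * zeta t ^+ 2))].
have [al alE] := csqrt_exists B; have [be beE] := csqrt_exists A.
(* The parameter on the line is the displacement in x: the point A stays fixed, while B / zeta^2
   turns once and its root al / zeta changes sign. *)
apply: (@no_monodromy R D (fun t => al / zeta t) (fun=> be)).
- move=> t z Dtz.
  have FF : Filter (filter_prod (nbhs t) (nbhs z)) by exact: filter_prod_filter.
  have f1 : (fun q : R * C => q.1) @ filter_prod (nbhs t) (nbhs z) --> t by exact: cvg_fst.
  have f2 : (fun q : R * C => q.2) @ filter_prod (nbhs t) (nbhs z) --> z by exact: cvg_snd.
  apply: (@Om_near _ (filter_prod (nbhs t) (nbhs z)) _ (fun q => x + q.2 * 1)
    (fun q => w + q.2 * (ka%:C * zeta q.1 ^+ 2)) _ _ _ _ Dtz).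
    exact: (cvgD (cvg_cst _) (cvgcM f2 (cvg_cst _))).
  apply: (cvgD (cvg_cst _)); apply: (cvgcM f2); apply: (cvgcM (cvg_cst _)).
  by apply: csqr_cvg; exact: (cvg_comp _ _ f1 (@continuous_zeta t)).
- by move=> t; exact: open_line.
- by move=> t; have [|] := @OmL x w 1 (ka%:C * zeta t ^+ 2); rewrite ?oner_neq0.
- by move=> t; have [|] := @OmL x w 1 (ka%:C * zeta t ^+ 2); rewrite ?oner_neq0.
- by move=> t; rewrite /D/= !mul0r !addr0.
- move=> t; apply: (cvgcM (cvg_cst _)); apply: cvgV; first exact: zeta_neq0.
  exact: continuous_zeta.
- exact: cst_continuous.
- move=> t; rewrite /D/= expr_div_n alE mulr1.
  have -> : B / zeta t ^+ 2 * (ka%:C * zeta t ^+ 2) = ka%:C * B.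
    by rewrite mulrCA divfK// expf_neq0// zeta_neq0.
  by have [] := H _ (normc_zeta t).
- move=> t; rewrite /D/= beE mulr1 [A * (_ * _)]mulrC.
  by have [] := H _ (normc_zeta t).
- by rewrite /D zeta0 zeta1 sqrrN.
- by [].
- by rewrite zeta0 zeta1 divr1 invrN invr1 mulrN1.
Qed.

(** A line of slope (k / h) z^2 with |z| = 1 through the missing point (x + a, w + b) meets the
    vertical disc at distance at most |b| + k |a| / h from its centre and the horizontal one at
    distance at most |a| + h |b| / k. Both are inside exactly because of the inequality on a and
    b. *)
Lemma diamond x w (h k : R) a b : 0 < h -> 0 < k ->
  (forall y, normc y < h -> Om (x + y) w) -> (forall y, normc y < k -> Om x (w + y)) ->
  normc a / h + normc b / k < 1 -> Om (x + a) (w + b).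
Proof.
move=> h0 k0 Oh Ok ab; apply: contrapT => nO.
have ah0 : 0 <= normc a / h by rewrite divr_ge0 ?normc_ge0 ?ltW.
have bk0 : 0 <= normc b / k by rewrite divr_ge0 ?normc_ge0 ?ltW.
have ah : normc a < h by rewrite -[ltRHS]mul1r -ltr_pdivrMr//; lra.
have bk : normc b < k by rewrite -[ltRHS]mul1r -ltr_pdivrMr//; lra.
case: (eqVneq a 0) => [a0|a0]; first by apply: nO; rewrite a0 addr0; exact: Ok.
case: (eqVneq b 0) => [b0|b0]; first by apply: nO; rewrite b0 addr0; exact: Oh.
have ka0 : 0 < k / h by rewrite divr_gt0.
have kac : (k / h)%:C != 0 by rewrite fmorph_eq0 gt_eqF.
apply: (@pencil (x + a) (w + b) (k / h) (- a) (- b / (k / h)%:C)) => //.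
- by rewrite oppr_eq0.
- by rewrite mulf_neq0 ?oppr_eq0 ?invr_eq0.
move=> z z1; have z2 : normc (z ^+ 2) = 1 by rewrite normcX z1 expr1n.
split.
  rewrite addrK -addrA; apply: Ok; apply: le_lt_trans (le_normcD _ _) _.
  rewrite mulrN normcN 2!normcM z2 mulr1 normcR ger0_norm ?ltW//.
  rewrite -[ltRHS]mul1r -ltr_pdivrMr//; apply: le_lt_trans ab.
  by rewrite mulrDl addrC lerD2r le_eqVlt; apply/orP; left; apply/eqP; field; rewrite !gt_eqF.
rewrite [_%:C * _]mulrC divfK// addrK -addrA; apply: Oh; apply: le_lt_trans (le_normcD _ _) _.
rewrite 2!normcM !normcV z2 normcN invr1 mulr1 normcR ger0_norm ?ltW//.
rewrite -[ltRHS]mul1r -ltr_pdivrMr//; apply: le_lt_trans ab.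
by rewrite mulrDl lerD2l le_eqVlt; apply/orP; left; apply/eqP; field; rewrite !gt_eqF.
Qed.

(** Were [H] unbounded on [r0, delta), the whole complex line at height r0 / 2 would lie in the
    domain: the lines through a missing point (a, r0 / 2) of slope so small that they pass near (0,
    r0 / 2) would also meet a disc of radius H r > |a| + delta / ka at height r. *)
Lemma radius_bounded (delta r0 : R) (H : R -> R) : 0 < r0 -> r0 < delta ->
  (forall r, 0 < r -> r < delta -> Om 0 r%:C) ->
  (forall r y, 0 < r -> r < delta -> normc y < H r -> Om y r%:C) ->
  (forall w, ~ (forall x, Om x w)) ->
  exists M, forall r, r0 <= r -> r < delta -> H r <= M.
Proof.
move=> r00 r0d O0 OH nl; apply: contrapT => nM.
have big M : exists r, [/\ r0 <= r, r < delta & M < H r].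
  apply: contrapT => nr; apply: nM; exists M => r r1 r2; rewrite leNgt.
  by apply/negP => Hr; apply: nr; exists r.
pose r1 := r0 / 2.
have r10 : 0 < r1 by rewrite /r1; lra.
have r1d : r1 < delta by rewrite /r1; lra.
have Or1 := O0 _ r10 r1d; have [e e0 eE] := OmO Or1.
apply: (nl r1%:C) => a; apply: contrapT => nO.
case: (eqVneq a 0) => [a0|a0]; first by apply: nO; rewrite a0.
have na0 : 0 < normc a by rewrite normc_gt0.
pose ka := e / (2 * normc a).
have ka0 : 0 < ka by rewrite divr_gt0// mulr_gt0.
have kac : ka%:C != 0 by rewrite fmorph_eq0 gt_eqF.
have [r [rr0 rd rH]] := big (normc a + delta / ka).
have rr1 : 0 < r - r1 by rewrite /r1; lra.
have rr1c : (r - r1)%:C != 0 by rewrite fmorph_eq0 gt_eqF.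
apply: (@pencil a r1%:C ka (- a) ((r - r1)%:C / ka%:C)) => //.
- by rewrite oppr_eq0.
- by rewrite mulf_neq0 ?invr_eq0.
move=> z z1; have z2 : normc (z ^+ 2) = 1 by rewrite normcX z1 expr1n.
split.
  rewrite subrr; apply: eE; first by rewrite subrr normc0.
  rewrite addrAC subrr add0r mulrN normcN 2!normcM z2 mulr1.
  rewrite normcR ger0_norm ?ltW// /ka mulrAC -mulf_div divff ?gt_eqF//; lra.
rewrite [_%:C * (_ / _)]mulrC divfK// -(rmorphD (real_complex R)) [r1 + _]addrC subrK.
apply: OH => //; first exact: lt_le_trans rr0.
apply: le_lt_trans rH; apply: le_trans (le_normcD _ _) _; rewrite lerD2l.
rewrite 2!normcM !normcV z2 invr1 mulr1 !normcR !ger0_norm ?ltW//.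
by rewrite ltr_pM2r ?invr_gt0// /r1; lra.
Qed.

Hypothesis cone : forall e : R, 0 < e -> exists2 d : R, 0 < d &
  forall x w, normc x < d -> normc w < d -> e * (normc x + normc w) < complex.Re w -> Om x w.
Hypothesis Om00 : ~ Om 0 0.

(** If (x, 0) were in the domain, the lines through (0, 0) of a small slope ka z^2 would meet the
    domain near (x, 0) as well as in the cone, in points turning at different speeds. *)
Lemma tangent_disjoint x : ~ Om x 0.
Proof.
move=> Oa; case: (eqVneq x 0) => [x0|x0]; first by apply: Om00; rewrite -{1}x0.
have [e e0 eE] := OmO Oa.
have nx : 0 < normc x by rewrite normc_gt0.
pose ka := e / (2 * normc x).
have ka0 : 0 < ka by rewrite divr_gt0// mulr_gt0.
have kac : ka%:C != 0 by rewrite fmorph_eq0 gt_eqF.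
have iv0 : 0 < ka^-1 by rewrite invr_gt0.
(* The point (r / (ka z^2), r) with r chosen below has |x| + |w| = r (1 / ka + 1) = d / 2, and with
   this aperture the cone condition reads r / 2 < r. *)
have e1 : 0 < (2 * (ka^-1 + 1))^-1 by rewrite invr_gt0; lra.
have [d d0 dE] := cone e1.
pose r := d / (2 * (ka^-1 + 1)).
have den0 : 0 < 2 * (ka^-1 + 1) by lra.
have r0 : 0 < r by rewrite divr_gt0.
have rE : r * (2 * (ka^-1 + 1)) = d by rewrite /r divfK// gt_eqF.
have rk : 0 < r * ka^-1 by rewrite mulr_gt0.
have rc : r%:C != 0 by rewrite fmorph_eq0 gt_eqF.
apply: (@pencil 0 0 ka x (r%:C / ka%:C)) => //.
  by rewrite mulf_neq0 ?invr_eq0.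
move=> z z1; have z2 : normc (z ^+ 2) = 1 by rewrite normcX z1 expr1n.
split.
  rewrite !add0r; apply: eE; first by rewrite subrr normc0.
  rewrite subr0 2!normcM z2 mulr1.
  rewrite normcR ger0_norm ?ltW// /ka mulrAC -mulf_div divff ?gt_eqF//; lra.
rewrite !add0r [_%:C * (_ / _)]mulrC divfK//.
have nE : normc (r%:C / ka%:C / z ^+ 2) = r * ka^-1.
  by rewrite 2!normcM !normcV z2 invr1 mulr1 !normcR !ger0_norm ?ltW.
apply: dE; rewrite ?nE ?normcR ?ger0_norm ?ltW//; try lra.
rewrite mulrC ltr_pdivrMr//=; lra.
Qed.

(* Each line {(mu y, y)} through the boundary point (0, 0) meets the domain in a
   simply connected set avoiding y = 0, on which y has two square roots; the
   branch is the one that is positive at small positive y. *)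
Definition slope_set (mu : C) : set C := squares [set y | Om (0 + y * mu) (0 + y * 1)].

Definition is_branch x w s : Prop := s ^+ 2 = w /\
  exists2 r0 : R, 0 < r0 & forall r, 0 < r -> r < r0 -> joined (slope_set (x / w)) r%:C s.

(** Uniformity in [mu] allows one positive real starting point for all nearby lines, as
    [branch_near] requires. *)
Lemma slope_set_small (M : R) : 0 <= M -> exists2 r0 : R, 0 < r0 &
  forall mu r, normc mu <= M -> 0 < r -> r < r0 -> slope_set mu r%:C.
Proof.
move=> M0; have e1 : 0 < (2 * (M + 1))^-1 by rewrite invr_gt0; lra.
have [d d0 dE] := cone e1.
have i0 : 0 < d / (M + 1) by rewrite divr_gt0//; lra.
exists (Num.min 1 (d / (M + 1))); first by rewrite lt_min ltr01.
move=> mu r muM r0; rewrite lt_min => /andP[r1 rd].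
have rM : r * (M + 1) < d by rewrite -ltr_pdivlMr//; lra.
have r20 : 0 < r ^+ 2 by rewrite exprn_gt0.
have r2 : r ^+ 2 < r by rewrite expr2 gtr_pMl.
have r2M : r ^+ 2 * M <= r * M by rewrite ler_wpM2r// ltW.
have r2mu : r ^+ 2 * normc mu <= r ^+ 2 * M by rewrite ler_wpM2l// ltW.
rewrite /slope_set/squares/= !add0r mulr1 -(rmorphXn (real_complex R)) /=.
apply: dE; rewrite ?normcM !normcR (ger0_norm (ltW r20)).
- lra.
- by nra.
rewrite mulrC ltr_pdivrMr /=; [nra|lra].
Qed.

Lemma slope_set_joined mu (r0 r r' : R) : (forall r, 0 < r -> r < r0 -> slope_set mu r%:C) ->
  0 < r -> r < r0 -> 0 < r' -> r' < r0 -> joined (slope_set mu) r%:C r'%:C.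
Proof.
move=> H r1 r2 r3 r4; exists (fun t => (r + t * (r' - r))%:C); split.
- move=> t; apply: cvgRc; apply: cvgD; first exact: cvg_cst.
  by apply: mulrr_continuous.
- by rewrite mul0r addr0.
- by rewrite mul1r addrC subrK.
- move=> t /andP[t0 t1]; have [h|h] := leP r r'.
    have h1 : 0 <= t * (r' - r) by rewrite mulr_ge0// subr_ge0.
    have h2 : t * (r' - r) <= r' - r by rewrite ler_piMl// subr_ge0.
    by apply: H; lra.
  have h1 : 0 <= t * (r - r') by rewrite mulr_ge0// subr_ge0 ltW.
  have h2 : t * (r - r') <= r - r' by rewrite ler_piMl// subr_ge0 ltW.
  have E : t * (r' - r) = - (t * (r - r')) by ring.
  by apply: H; rewrite E; lra.
Qed.

Lemma slope_lines mu : [/\ open [set y | Om (0 + y * mu) (0 + y * 1)],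
  connected [set y | Om (0 + y * mu) (0 + y * 1)],
  loops_contract [set y | Om (0 + y * mu) (0 + y * 1)] &
  ~ [set y | Om (0 + y * mu) (0 + y * 1)] 0].
Proof.
have h : (mu != 0) || ((1 : C) != 0) by rewrite oner_neq0 orbT.
have [h1 h2] := OmL 0 0 h; split => //; first exact: open_line.
by rewrite /= !mul0r !addr0.
Qed.

Lemma Om_w_neq0 x w : Om x w -> w != 0.
Proof. by apply: contraPneq => ->; exact: tangent_disjoint. Qed.

Lemma branch_exists x w : Om x w -> exists s, is_branch x w s.
Proof.
move=> Oxw; have w0 := Om_w_neq0 Oxw.
have [r0 r00 r0E] := slope_set_small (normc_ge0 (x / w)).
have rE r : 0 < r -> r < r0 -> slope_set (x / w) r%:C by exact: r0E.
have [Do Dc Dl D0] := slope_lines (x / w).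
have r1 : 0 < r0 / 2 by lra.
have r2 : r0 / 2 < r0 by lra.
have Dw : [set y | Om (0 + y * (x / w)) (0 + y * 1)] w.
  by rewrite /= !add0r mulr1 mulrC divfK.
have [s s2 j] := exists_root Do Dc D0 (rE _ r1 r2) (erefl _) Dw.
exists s; split => //; exists r0 => // r r3 r4.
by apply: joined_trans j; exact: slope_set_joined rE _ _ _ _.
Qed.

Lemma branch_unique x w s s' : is_branch x w s -> is_branch x w s' -> s = s'.
Proof.
move=> [s2 [r0 r00 r0E]] [s2' [r1 r10 r1E]].
have [Do Dc Dl D0] := slope_lines (x / w).
case: (csqrt_eq (etrans s2 (esym s2'))) => // E; exfalso.
pose r := Num.min r0 r1 / 2.
have m0 : 0 < Num.min r0 r1 by rewrite lt_min r00.
have [m1 m2] : Num.min r0 r1 <= r0 /\ Num.min r0 r1 <= r1 by rewrite !ge_min !lexx orbT.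
have rr0 : 0 < r by rewrite /r; lra.
apply: (@no_flip _ _ s' D0 Dl); rewrite -E.
apply: (@joined_trans _ (slope_set (x / w)) s' r%:C s).
  by apply: joined_sym; apply: r1E; rewrite /r; lra.
by apply: r0E; rewrite /r; lra.
Qed.

Lemma slope_set_near mu y : slope_set mu y ->
  \forall mu' \near mu & y' \near y, slope_set mu' y'.
Proof.
move=> Fy.
have FF : Filter (filter_prod (nbhs mu) (nbhs y)) by exact: filter_prod_filter.
have f1 : (fun q : C * C => q.1) @ filter_prod (nbhs mu) (nbhs y) --> mu by exact: cvg_fst.
have f2 : (fun q : C * C => q.2) @ filter_prod (nbhs mu) (nbhs y) --> y by exact: cvg_snd.
apply: (@Om_near _ (filter_prod (nbhs mu) (nbhs y)) _ (fun q => 0 + q.2 ^+ 2 * q.1)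
    (fun q => 0 + q.2 ^+ 2 * 1) _ _ _ _ Fy).
  exact: (cvgD (cvg_cst _) (cvgcM (csqr_cvg f2) f1)).
exact: (cvgD (cvg_cst _) (cvgcM (csqr_cvg f2) (cvg_cst _))).
Qed.

(** Three paths in the section of the moved line: along the positive reals to a fixed r, from r to s
    by the path of the old line, which stays valid nearby, and from s to its local continuation
    within a ball. *)
Lemma branch_near {T : Type} {F : set_system T} {FF : Filter F} (X W : T -> C) x w s :
  X @ F --> x -> W @ F --> w -> Om x w -> is_branch x w s ->
  \forall t \near F, is_branch (X t) (W t) (s * psqrt (W t / w)).
Proof.
move=> Xx Ww Oxw [s2 [r0 r00 r0E]]; have w0 := Om_w_neq0 Oxw.
have s0 : s != 0 by rewrite -sqrf_eq0 s2.
have qc : (W t / w) @[t --> F] --> (1 : C).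
  by rewrite -[X in _ --> X](divff w0); exact: (cvgcM Ww (cvg_cst _)).
have slit1 : slit (1 : C) by apply: Re_gt0_slit; rewrite /= ltr01.
have pc : (s * psqrt (W t / w)) @[t --> F] --> s.
  rewrite -[X in _ --> X]mulr1 -psqrt1.
  by apply: (cvgcM (cvg_cst _)); exact: psqrt_cvg.
have mc : (X t / W t) @[t --> F] --> x / w.
  exact: (cvgcM Xx (cvgV w0 Ww)).
have [r1 r10 r1E] := @slope_set_small (normc (x / w) + 1) (addr_ge0 (normc_ge0 _) ler01).
pose r2 := Num.min r0 r1.
have r20 : 0 < r2 by rewrite lt_min r00.
have [r2a r2b] : r2 <= r0 /\ r2 <= r1 by rewrite !ge_min !lexx orbT.
pose r := r2 / 2.
have rr : 0 < r /\ r < r2 by rewrite /r; lra.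
have j0 : joined (slope_set (x / w)) r%:C s by apply: r0E; lra.
have jn : \forall mu \near x / w, joined (slope_set mu) r%:C s.
  by apply: joined_near j0 => z; exact: slope_set_near.
have Fs : slope_set (x / w) s.
  by move: j0 => [g [_ _ g1 gE]]; rewrite -g1; apply: gE; rewrite ler01 lexx.
have [[A B]/= [nA nB] AB] := slope_set_near Fs.
have [e e0 eB] : exists2 e, 0 < e & forall y, normc (y - s) < e -> B y by apply/near_normc.
near=> t.
have st : slit (W t / w).
  apply/Re_gt0_slit/near1_Re_gt0; near: t.
  by move/cvgc_normc : qc; apply.
split; first by rewrite exprMn s2 psqrt_sqr// mulrC divfK.
exists r2 => // r' r'0 r'2.
have nmu : normc (X t / W t) <= normc (x / w) + 1.
  rewrite -lerBlDl; apply: le_trans (_ : normc (X t / W t - x / w) <= 1).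
    by have := le_normcB (X t / W t) (x / w); rewrite ler_norml => /andP[_].
  by apply: ltW; near: t; move/cvgc_normc : mc; apply.
apply: (@joined_trans _ (slope_set (X t / W t)) r'%:C r%:C).
  by apply: (@slope_set_joined _ r1); [move=> r3 h1 h2; exact: r1E|lra|lra|lra|lra].
apply: (@joined_trans _ (slope_set (X t / W t)) r%:C s).
  by near: t; exact: (mc _ jn).
apply: (@joined_ball _ _ _ _ e).
  move=> y ye; apply: (AB (X t / W t, y)); split => /=; last exact: eB.
  by near: t; exact: (mc _ nA).
by near: t; move/cvgc_normc : pc; apply.
Unshelve. all: end_near. Qed.

Definition branch x w : C := get (is_branch x w).

Lemma branchP x w : Om x w -> is_branch x w (branch x w).
Proof. by move=> /branch_exists[s sE]; exact: (getI sE). Qed.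

Lemma branch_sqr x w : Om x w -> branch x w ^+ 2 = w.
Proof. by move=> /branchP[]. Qed.

Lemma branch_cvg {T : Type} {F : set_system T} {FF : Filter F} (X W : T -> C) x w :
  X @ F --> x -> W @ F --> w -> Om x w -> branch (X t) (W t) @[t --> F] --> branch x w.
Proof.
move=> Xx Ww Oxw; have w0 := Om_w_neq0 Oxw.
have qc : (W t / w) @[t --> F] --> (1 : C).
  by rewrite -[X in _ --> X](divff w0); exact: (cvgcM Ww (cvg_cst _)).
have slit1 : slit (1 : C) by apply: Re_gt0_slit; rewrite /= ltr01.
have pc : (branch x w * psqrt (W t / w)) @[t --> F] --> branch x w.
  rewrite -[X in _ --> X]mulr1 -psqrt1.
  by apply: (cvgcM (cvg_cst _)); exact: psqrt_cvg.
apply: cvg_trans pc; apply: near_eq_cvg; near=> t.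
apply: (@branch_unique (X t) (W t)).
  near: t; exact: (branch_near Xx Ww Oxw (branchP Oxw)).
by apply: branchP; near: t; exact: Om_near Xx Ww Oxw.
Unshelve. all: end_near. Qed.

(** At x = 0 the positive root is joined to the small positive reals inside the positive axis. The
    slice w = r is a section by a complex line, hence connected, and on it a continuous root of the
    constant r cannot change sign. *)
Lemma branch_real (rc : R) : (forall r : R, 0 < r -> r < rc -> Om 0 r%:C) ->
  forall (r : R) x, 0 < r -> r < rc -> Om x r%:C -> branch x r%:C = (Num.sqrt r)%:C.
Proof.
move=> O0 r x r0 rrc Ox.
have sr0 : 0 < Num.sqrt r by rewrite sqrtr_gt0.
have s2 : (Num.sqrt r)%:C ^+ 2 = r%:C :> C.
  by rewrite -(rmorphXn (real_complex R)) sqr_sqrtr// ltW.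
have b0 : is_branch 0 r%:C (Num.sqrt r)%:C.
  split => //; rewrite mul0r.
  have H s : 0 < s -> s < Num.sqrt rc -> slope_set 0 s%:C.
    move=> s0 src; rewrite /slope_set/squares/= mulr0 addr0 add0r mulr1.
    rewrite -(rmorphXn (real_complex R)) /=; apply: O0; first by rewrite exprn_gt0.
    by rewrite -[ltRHS]sqr_sqrtr ?ltr_pXn2r// ?nnegrE ?sqrtr_ge0 ?ltW// (lt_trans r0).
  have srrc : Num.sqrt r < Num.sqrt rc by rewrite ltr_sqrt// (lt_trans r0).
  exists (Num.sqrt rc); first exact: lt_trans srrc.
  by move=> s h1 h2; exact: (slope_set_joined H).
have L : connected [set t | Om (0 + t * 1) (r%:C + t * 0)].
  have h : ((1 : C) != 0) || ((0 : C) != 0) by rewrite oner_neq0.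
  by have [] := OmL 0 r%:C h.
have LE t : [set t | Om (0 + t * 1) (r%:C + t * 0)] t = Om t r%:C.
  by rewrite /= add0r mulr1 mulr0 addr0.
pose P t := branch t r%:C = (Num.sqrt r)%:C.
have O00 := O0 _ r0 rrc.
apply: (@connected_ind _ _ P L _ 0 x); rewrite ?LE//; last first.
  exact: (branch_unique (branchP O00) b0).
move=> t; rewrite LE => Ot.
have bc : (fun t' => branch t' r%:C) @ nbhs t --> branch t r%:C.
  by apply: branch_cvg; [exact: cvg_id|exact: cvg_cst|exact: Ot].
have n2 : 0 < 2 * Num.sqrt r by lra.
move/cvgc_normc: bc => /(_ _ n2); apply: filterS => t' d; rewrite LE => Ot'.
have := branch_sqr Ot; rewrite -{2}s2 => /csqrt_eq E.
have := branch_sqr Ot'; rewrite -{2}s2 => /csqrt_eq E'.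
have N : - (Num.sqrt r)%:C <> (Num.sqrt r)%:C :> C.
  by move=> /(congr1 (@complex.Re R))/=; lra.
have n4 (u : C) : u = (Num.sqrt r)%:C + (Num.sqrt r)%:C -> normc u = 2 * Num.sqrt r.
  by move=> ->; rewrite -(rmorphD (real_complex R)) normcR ger0_norm; lra.
rewrite /P; case: E d => ->; case: E' => -> // d.
- exfalso; move: d; rewrite -opprD normcN n4// ltxx//.
- exfalso; move: d; rewrite opprK n4// ltxx//.

Qed.

End Pencils.

(** * The Hermitian product and coordinatewise limits *)

Section Hermitian.
Context {R : realType} {n : nat}.
Local Notation C := R[i].
Implicit Types (z w v : 'rV[C]_n) (c : C).

Definition herm z w : C := \sum_(i < n) z 0 i * (w 0 i)^*.

Lemma hermDl z v w : herm (z + v) w = herm z w + herm v w.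
Proof. by rewrite /herm -big_split; apply: eq_bigr => i _; rewrite mxE mulrDl. Qed.

Lemma hermZl c z w : herm (c *: z) w = c * herm z w.
Proof. by rewrite /herm mulr_sumr; apply: eq_bigr => i _; rewrite mxE mulrA. Qed.

Lemma herm_conj z w : herm w z = (herm z w)^*.
Proof. by rewrite /herm rmorph_sum; apply: eq_bigr => i _; rewrite rmorphM /= conjcK mulrC. Qed.

Lemma rdotE z w : rdot z w = complex.Re (herm z w).
Proof.
rewrite /rdot /herm raddf_sum; apply: eq_bigr => i _.
by case: (z 0 i) => a b; case: (w 0 i) => c d /=; ring.
Qed.

Lemma herm_self_Im z : complex.Im (herm z z) = 0.
Proof. by have := herm_conj z z; case: (herm z z) => a b [] /= h; lra. Qed.

Lemma rdot_ge0 z : 0 <= rdot z z.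
Proof. by rewrite /rdot sumr_ge0// => i _; rewrite addr_ge0// -expr2 sqr_ge0. Qed.

Lemma enorm_sqr z : enorm z ^+ 2 = rdot z z.
Proof. by rewrite sqr_sqrtr// rdot_ge0. Qed.

Lemma herm_unit z : enorm z = 1 -> herm z z = 1.
Proof.
move=> z1; have := enorm_sqr z; rewrite z1 expr1n rdotE.
by have := herm_self_Im z; case: (herm z z) => a b /= -> <-.
Qed.

Lemma normc_coord_le z i : normc (z 0 i) <= enorm z.
Proof.
rewrite -(@ler_pXn2r _ 2) ?nnegrE ?normc_ge0 ?sqrtr_ge0// enorm_sqr normc_sqr.
rewrite /rdot (bigD1 i)//= -!expr2 lerDl sumr_ge0// => j _.
by rewrite addr_ge0// -expr2 sqr_ge0.
Qed.

Lemma enormZ c z : enorm (c *: z) = normc c * enorm z.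
Proof.
have E : rdot (c *: z) (c *: z) = normc c ^+ 2 * rdot z z.
  rewrite normc_sqr /rdot mulr_sumr; apply: eq_bigr => i _; rewrite mxE.
  by case: c => a b; case: (z 0 i) => u v /=; ring.
by rewrite /enorm E sqrtrM ?sqr_ge0// sqrtr_sqr ger0_norm// normc_ge0.
Qed.

Lemma enorm0 : enorm (0 : 'rV[C]_n) = 0.
Proof. by rewrite -(scale0r 0) enormZ normc0 mul0r. Qed.

Lemma near_rV z (A : set 'rV[C]_n) :
  nbhs z A <-> exists2 e : R, 0 < e &
    forall w, (forall i, normc (w 0 i - z 0 i) < e) -> A w.
Proof.
split.
  move=> /nbhs_ballP[e /= e0 eA]; case: e e0 eA => e e'.
  rewrite ltcE/= => /andP[/eqP -> e0] eA; exists e => // w wz; apply: eA.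
  split=> [|i j]; first by rewrite ltcE/= eqxx.
  rewrite (ord1 i) /ball/= distrC norm_normc.
  by rewrite [_ +i* 0]complexr0 ltcR.
move=> [e e0 eA]; apply/nbhs_ballP; exists e%:C => /=; first by rewrite ltcR.
move=> w [_ wz]; apply: eA => i; have := wz 0 i.
by rewrite /ball/= distrC norm_normc ltcR.
Qed.

Lemma cvg_rV {T : Type} {F : set_system T} {FF : Filter F} (f : T -> 'rV[C]_n) z :
  f @ F --> z <-> (forall i, (f t 0 i) @[t --> F] --> z 0 i).
Proof.
split=> [fz i|fz A /near_rV[e e0 eA]].
  apply/cvgc_normc => e e0.
  have nz : nbhs z [set w | normc (w 0 i - z 0 i) < e].
    by apply/near_rV; exists e => // w; apply.
  exact: (fz _ nz).
have H : \forall t \near F, forall i, normc (f t 0 i - z 0 i) < e.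
  apply: filter_forall => i.
  by move/cvgc_normc: (fz i) => /(_ _ e0).
by apply: filterS H => t ft; apply: eA.
Qed.

Lemma cvg_coord {T : Type} {F : set_system T} {FF : Filter F} (f : T -> 'rV[C]_n) z i :
  f @ F --> z -> (f t 0 i) @[t --> F] --> z 0 i.
Proof. by move/cvg_rV. Qed.

Lemma cvg_rVZ {T : Type} {F : set_system T} {FF : Filter F} (f : T -> C) c v :
  f @ F --> c -> (f t *: v) @[t --> F] --> c *: v.
Proof.
move=> fc; apply/cvg_rV => i; rewrite mxE.
rewrite (_ : (fun t => _) = (fun t => f t * v 0 i)); last first.
  by apply/funext => t; rewrite mxE.
exact: (cvgcM fc (cvg_cst _)).
Qed.

Lemma cvg_rVD {T : Type} {F : set_system T} {FF : Filter F} (f g : T -> 'rV[C]_n) z w :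
  f @ F --> z -> g @ F --> w -> (f t + g t) @[t --> F] --> z + w.
Proof.
move=> fz gw; apply/cvg_rV => i; rewrite mxE.
rewrite (_ : (fun t => _) = (fun t => f t 0 i + g t 0 i)); last first.
  by apply/funext => t; rewrite mxE.
have fi : (fun t => f t 0 i) @ F --> z 0 i by exact: cvg_coord.
have gi : (fun t => g t 0 i) @ F --> w 0 i by exact: cvg_coord.
exact: (cvgD fi gi).
Qed.

Lemma cvg_sum {T : Type} {F : set_system T} {FF : Filter F} m (f : 'I_m -> T -> C) (c : 'I_m -> C) :
  (forall i, f i @ F --> c i) -> (\sum_(i < m) f i t) @[t --> F] --> \sum_(i < m) c i.
Proof.
elim: m f c => [|m IH] f c fc.
  rewrite big_ord0 (_ : (fun t => _) = fun=> 0); first exact: cvg_cst.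
  by apply/funext => t; rewrite big_ord0.
rewrite big_ord_recl (_ : (fun t => _) =
   (fun t => f ord0 t + \sum_(i < m) f (lift ord0 i) t)); last first.
  by apply/funext => t; rewrite big_ord_recl.
exact: (cvgD (fc _) (IH _ _ (fun i => fc _))).
Qed.

Lemma cvg_herm {T : Type} {F : set_system T} {FF : Filter F} (f : T -> 'rV[C]_n) z w :
  f @ F --> z -> herm (f t) w @[t --> F] --> herm z w.
Proof.
move=> fz; apply: cvg_sum => i.
have fi : (fun t => f t 0 i) @ F --> z 0 i by exact: cvg_coord.
exact: (cvgcM fi (cvg_cst _)).
Qed.

Lemma cderiv_herm (f : C -> 'rV[C]_n) w (y : C) :
  (forall i, exists d, cderiv (fun x => f x 0 i) y d) ->
  exists d, cderiv (fun x => herm (f x) w) y d.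
Proof.
move=> fd; rewrite /herm.
suff : forall m (g : 'I_m -> C -> C), (forall i, exists d, cderiv (g i) y d) ->
    exists d, cderiv (fun x => \sum_(i < m) g i x) y d.
  apply=> i; have [d dE] := fd i; eexists; exact: (cderivM dE (cderiv_cst _ y)).
elim=> [|m IH] g gd.
  exists 0; rewrite (_ : (fun x => _) = fun=> 0); first exact: cderiv_cst.
  by apply/funext => x; rewrite big_ord0.
have [d1 h1] := gd ord0; have [d2 h2] := IH _ (fun i => gd (lift ord0 i)).
exists (d1 + d2); rewrite (_ : (fun x => _) =
   (fun x => g ord0 x + \sum_(i < m) g (lift ord0 i) x)); last first.
  by apply/funext => x; rewrite big_ord_recl.
exact: cderivD.
Qed.

End Hermitian.

(** * Coordinates along an orthonormal pair of vectors of C^2 *)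

Section Coordinates.
Context {R : realType}.
Local Notation C := R[i].
Variables (Omega : set 'rV[C]_2) (p X eta : 'rV[C]_2).
Hypotheses (XX : herm X X = 1) (ee : herm eta eta = 1) (Xe : herm X eta = 0).

Definition pt (x w : C) : 'rV[C]_2 := p + x *: X + w *: eta.
Definition cx (z : 'rV[C]_2) : C := herm (z - p) X.
Definition cw (z : 'rV[C]_2) : C := herm (z - p) eta.
Definition Om (x w : C) : Prop := Omega (pt x w).

(** The matrix with rows X and eta has its adjoint as right inverse, hence as left inverse. *)
Lemma orthonormal_decomp v : v = herm v X *: X + herm v eta *: eta.
Proof.
pose A : 'M[C]_2 := \matrix_(i, j) (if i == 0 then X 0 j else eta 0 j).
pose B : 'M[C]_2 := \matrix_(j, i) (if i == 0 then (X 0 j)^* else (eta 0 j)^*).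
have AB : A *m B = 1%:M.
  apply/matrixP => i j; rewrite !mxE.
  under eq_bigr do rewrite !mxE.
  case: (i =P 0) => [->|/eqP i0]; case: (j =P 0) => [->|/eqP j0].
  - by rewrite -[LHS]/(herm X X) XX.
  - by rewrite -[LHS]/(herm X eta) Xe eq_sym (negbTE j0).
  - by rewrite -[LHS]/(herm eta X) herm_conj Xe conjc0 (negbTE i0).
  rewrite -[LHS]/(herm eta eta) ee.
  by case: i i0 => [[|[|//]] ?]// _; case: j j0 => [[|[|//]] ?]// _.
have := mulmx1C AB => BA.
rewrite -[LHS]mulmx1 -BA mulmxA.
apply/rowP => j; rewrite !mxE big_ord_recl big_ord1 !mxE /=.
congr (_ * _ + _ * _); by apply: eq_bigr => i _; rewrite mxE.
Qed.

Lemma pt_cxw z : pt (cx z) (cw z) = z.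
Proof. by rewrite /pt -addrA -orthonormal_decomp addrC subrK. Qed.

Lemma cx_pt x w : cx (pt x w) = x.
Proof.
rewrite /cx /pt -[p + _ + _]addrA addrAC subrr add0r hermDl !hermZl XX.
by rewrite (herm_conj X eta) Xe conjc0 mulr0 addr0 mulr1.
Qed.

Lemma cw_pt x w : cw (pt x w) = w.
Proof.
rewrite /cw /pt -[p + _ + _]addrA addrAC subrr add0r hermDl !hermZl ee Xe.
by rewrite mulr0 add0r mulr1.
Qed.

Lemma pt_line x w u v t : pt (x + t * u) (w + t * v) = pt x w + t *: (u *: X + v *: eta).
Proof.
rewrite /pt !scalerDl scalerDr !scalerA !addrA; congr (_ + _).
by rewrite addrAC.
Qed.

Lemma cvg_pt {T : Type} {F : set_system T} {FF : Filter F} (f g : T -> C) x w :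
  f @ F --> x -> g @ F --> w -> pt (f t) (g t) @[t --> F] --> pt x w.
Proof.
move=> fx gw.
have fX : (fun t => f t *: X) @ F --> x *: X by apply: cvg_rVZ; exact: fx.
have ge : (fun t => g t *: eta) @ F --> w *: eta by apply: cvg_rVZ; exact: gw.
have pc : (fun=> p) @ F --> p by exact: cvg_cst.
exact: (cvg_rVD (cvg_rVD pc fX) ge).
Qed.

Lemma cvg_cx {T : Type} {F : set_system T} {FF : Filter F} (f : T -> 'rV[C]_2) z :
  f @ F --> z -> cx (f t) @[t --> F] --> cx z.
Proof. by move=> fz; apply: cvg_herm; exact: (cvg_rVD fz (cvg_cst _)). Qed.

Lemma cvg_cw {T : Type} {F : set_system T} {FF : Filter F} (f : T -> 'rV[C]_2) z :
  f @ F --> z -> cw (f t) @[t --> F] --> cw z.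
Proof. by move=> fz; apply: cvg_herm; exact: (cvg_rVD fz (cvg_cst _)). Qed.

Lemma Om_open : open Omega -> forall x w, Om x w -> exists2 e : R, 0 < e &
  forall x' w', normc (x' - x) < e -> normc (w' - w) < e -> Om x' w'.
Proof.
move=> Oo x w Oxw.
have c : (fun q : C * C => pt q.1 q.2) @ filter_prod (nbhs x) (nbhs w) --> pt x w.
  by apply: cvg_pt; [exact: cvg_fst|exact: cvg_snd].
have nO : nbhs (pt x w) Omega by exact: open_nbhs_nbhs.
have [[A B]/= [/near_normc[a a0 aA] /near_normc[b b0 bB]] AB] := c _ nO.
exists (Num.min a b); first by rewrite lt_min a0.
move=> x' w'; rewrite !lt_min => /andP[xa _] /andP[_ wb].
by apply: (AB (x', w')); split; [exact: aA|exact: bB].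
Qed.

(** [la] reads off the parameter of a point of the line. Clamping both variables extends the
    homotopy from the unit square to the plane without leaving the section. *)
Lemma Om_lines : C_convex Omega -> forall x w u v, (u != 0) || (v != 0) ->
  connected [set t | Om (x + t * u) (w + t * v)] /\
  loops_contract [set t | Om (x + t * u) (w + t * v)].
Proof.
move=> Occ x w u v uv.
pose a := pt x w; pose V := u *: X + v *: eta.
pose la z := if u != 0 then (cx z - x) / u else (cw z - w) / v.
have laE t : la (a + t *: V) = t.
  rewrite /la /a /V -pt_line cx_pt cw_pt; case: (eqVneq u 0) uv => [u0|u0] /= v0.
    by rewrite addrAC subrr add0r mulfK.
  by rewrite addrAC subrr add0r mulfK.
have lac : continuous la.
  move=> z; rewrite /la; case: (u != 0).
    have cz : (fun z => cx z) @ nbhs z --> cx z by apply: cvg_cx; exact: cvg_id.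
    exact: (cvgcM (cvgD cz (cvg_cst _)) (cvg_cst _)).
  have cz : (fun z => cw z) @ nbhs z --> cw z by apply: cvg_cw; exact: cvg_id.
  exact: (cvgcM (cvgD cz (cvg_cst _)) (cvg_cst _)).
have V0 : V != 0.
  apply/eqP => VE; have := laE 1; have := laE 0; rewrite VE !scaler0 => -> /eqP.
  by rewrite eq_sym oner_eq0.
have [Oc Ol] := Occ a V V0.
set D := [set t | _].
have DE t : D t <-> (Omega `&` complex_line a V) (a + t *: V).
  rewrite /D/= /Om pt_line -/a -/V; split=> [h|[]//]; split => //; by exists t.
have DO z : (Omega `&` complex_line a V) z -> D (la z).
  move=> Oz; have [_ [t _ tE]] := Oz; rewrite -tE laE; apply/DE; by rewrite tE.
split.
  have -> : D = la @` (Omega `&` complex_line a V).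
    apply/seteqP; split => [t /DE Dt|_ [z Oz <-]]; last exact: DO.
    by exists (a + t *: V).
  apply: connected_continuous_connected => //.
  exact: continuous_subspaceT.
move=> g gc gD g01.
pose g1 t := a + g t *: V.
have g1c : continuous g1.
  move=> t.
  have gV : (fun t => g t *: V) @ nbhs t --> g t *: V by apply: cvg_rVZ; exact: gc.
  have ac : (fun=> a) @ nbhs t --> a by exact: cvg_cst.
  exact: (cvg_rVD ac gV).
have [|t|h [hc hD h0 h1 hend]] := Ol g1 _ _ (congr1 (fun c => a + c *: V) g01).
- exact: continuous_subspaceT.
- by rewrite /= in_itv/= => /gD/DE.
pose cl (t : R) := Num.max 0 (Num.min 1 t).
have clc : continuous cl.
  move=> t; apply: (@continuous_max _ _ (fun=> 0) (fun t : R => Num.min 1 t)).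
    exact: cst_continuous.
  by apply: continuous_min; [exact: cst_continuous|exact: cvg_id].
have cl01 t : `[0, 1]%classic (cl t).
  by rewrite /= in_itv/= /cl le_max lexx/= ge_max ler01 ge_min lexx.
have cl0 : cl 0 = 0 by rewrite /cl min_r ?max_l ?ler01.
have cl1 : cl 1 = 1 by rewrite /cl min_l ?max_r ?ler01.
pose k (q : R * R) := (cl q.1, cl q.2).
have kc : continuous k.
  move=> [q1 q2].
  have c1 : (fun q : R * R => cl q.1) @ filter_prod (nbhs q1) (nbhs q2) --> cl q1.
    by apply: (cvg_comp _ _ cvg_fst); exact: clc.
  have c2 : (fun q : R * R => cl q.2) @ filter_prod (nbhs q1) (nbhs q2) --> cl q2.
    by apply: (cvg_comp _ _ cvg_snd); exact: clc.
  exact: (cvg_pair c1 c2).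
exists (fun q => la (h (k q))); split.
- have hk : continuous (fun q => h (k q)).
    by apply: (continuous_within_comp hc kc) => q; split; exact: cl01.
  exact: (continuousc hk lac).
- by move=> q; apply: DO; apply: hD; exact: cl01.
- move=> t t01; have t01' : `[0, 1]%classic t by rewrite /= in_itv.
  have -> : k (0, t) = (0, t).
    by rewrite /k/= cl0 /cl; case/andP: t01 => t0 t1; rewrite (min_idPr t1) (max_idPr t0).
  by rewrite h0// /g1 laE.
- by move=> t; rewrite /k/= cl1 !h1.
- by move=> t; rewrite /k/= cl0 cl1; have [-> ->] := hend _ (cl01 t).
Qed.

End Coordinates.

(** * Logarithmic lower bound for the Kobayashi distance in terms of the height *)

Section LowerBound.
Context {R : realType}.
Local Notation C := R[i].

Lemma slitPn (z : C) : ~ slit z -> exists2 y : R, 0 <= y & z = (- y)%:C.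
Proof.
rewrite /slit => /negP; rewrite -leNgt => h; exists (normc z); first exact: normc_ge0.
have := normc_sqr z; have := normc_ge0 z; move: h; move: (normc z) => n.
case: z => x y /= h n0 E; have hx : x <= - n by lra.
have : n ^+ 2 <= x ^+ 2 by rewrite -[x ^+ 2]sqrrN ler_pXn2r// ?nnegrE//; lra.
move=> h2; have y0 : y ^+ 2 = 0 by have := sqr_ge0 y; lra.
have y00 : y = 0 by apply/eqP; rewrite -sqrf_eq0 y0.
have xn : x ^+ 2 = n ^+ 2 by lra.
have : x = - n.
  by have /eqP := xn; rewrite eqf_sqr => /orP[/eqP E1|/eqP//]; lra.
by move=> ->; rewrite y00.
Qed.

Variables (Omega : set 'rV[C]_2) (p eta : 'rV[C]_2) (br : 'rV[C]_2 -> C) (rc a : R).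
Hypotheses (br_sqr : forall z, Omega z -> br z ^+ 2 = cw p eta z)
  (br_neq0 : forall z, Omega z -> br z != 0)
  (br_cvg : forall z, Omega z -> br @ nbhs z --> br z)
  (br_real : forall z (r : R), Omega z -> 0 < r -> r < rc -> cw p eta z = r%:C ->
     br z = (Num.sqrt r)%:C)
  (a0 : 0 < a) (a2 : a ^+ 2 < rc).

(* As br omits [-a, 0], the quotient br / (br + a) omits the slit, so that its
   square root has positive real part. *)
Definition halfplane_coord (z : 'rV[C]_2) : C := psqrt (br z / (br z + a%:C)).

(** A value -c would force w = c^2, a positive number below [rc], where the branch is the positive
    root. *)
Lemma br_omits z (c : R) : Omega z -> 0 < c -> c <= a -> br z != (- c)%:C.
Proof.
move=> Oz c0 ca; apply/eqP => E.
have c2 : cw p eta z = (c ^+ 2)%:C.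
  by rewrite -br_sqr// E -(rmorphXn (real_complex R)) sqrrN.
have c20 : 0 < c ^+ 2 by rewrite exprn_gt0.
have c2rc : c ^+ 2 < rc.
  by apply: le_lt_trans a2; rewrite ler_pXn2r ?nnegrE ?(ltW c0) ?(ltW a0).
have := br_real Oz c20 c2rc c2.
rewrite sqrtr_sqr E => /(congr1 (@complex.Re R)) /=.
by rewrite ger0_norm ?ltW//; lra.
Qed.

Lemma br_den z : Omega z -> br z + a%:C != 0.
Proof.
move=> Oz; apply/eqP => /eqP; rewrite addr_eq0 => /eqP E.
have := br_omits Oz a0 (lexx _); rewrite E -(rmorphN (real_complex R)) eqxx//.
Qed.

(** If the quotient were -y with y >= 0, then br z = - a y / (1 + y), a point of the omitted
    interval [-a, 0]. *)
Lemma br_slit z : Omega z -> slit (br z / (br z + a%:C)).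
Proof.
move=> Oz; apply: contrapT => /slitPn[y y0 E].
have d0 := br_den Oz; have b0 := br_neq0 Oz.
have y1 : (1 + y)%:C != 0 :> C by rewrite fmorph_eq0; lra.
have bE : br z = (- (a * y / (1 + y)))%:C.
  have : br z = (- y)%:C * (br z + a%:C) by rewrite -E divfK.
  move=> E2; have E3 : br z * (1 + y)%:C = (- (a * y))%:C.
    move: E2; rewrite mulrDr => E2.
    rewrite rmorphD mulrDr mulr1 {1}E2 !rmorphN !rmorphM /=; ring.
  apply: (mulIf y1); rewrite E3 -(rmorphM (real_complex R)) mulNr divfK//.
  by apply/eqP => h; move: y1; rewrite h eqxx.
have yn0 : y != 0.
  by apply: contraNneq b0 => y00; rewrite bE y00 mulr0 mul0r oppr0.
have ypos : 0 < y by rewrite lt_def yn0.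
have c0 : 0 < a * y / (1 + y) by rewrite divr_gt0 ?mulr_gt0//; lra.
have ca : a * y / (1 + y) <= a.
  have y11 : 0 < 1 + y by lra.
  by rewrite ler_pdivrMr// mulrDr mulr1 lerDr ltW.
by have := br_omits Oz c0 ca; rewrite bE eqxx.
Qed.

(** Along a disc both roots are continuous and have holomorphic squares, so [cderiv_sqrt] applies
    twice. *)
Lemma halfplane_coord_holo phi : holo_disc 1 Omega phi -> forall y : C, normc y < 1 ->
  0 < complex.Re (halfplane_coord (phi y)) /\
  exists d, cderiv (fun x => halfplane_coord (phi x)) y d.
Proof.
move=> hphi y y1.
have ph z : normc z < 1 -> Omega (phi z) /\
    forall i, exists d, cderiv (fun x => phi x 0 i) z d.
  move=> z1; have [|h1 h2] := hphi z.
    by rewrite norm_normc ltcR.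
  by split => // i; apply: derivable_cderiv; exact: h2.
have [Oy dy] := ph _ y1.
split; first by apply: psqrt_Re_gt0; exact: br_slit.
have near1 : \forall w \near y, normc w < 1.
  apply/near_normc; exists (1 - normc y); first by rewrite subr_gt0.
  by move=> w wy; have := normc_triB w y; lra.
have cp : phi @ nbhs y --> phi y.
  by apply/cvg_rV => i; have [d /cderiv_cvg] := dy i.
have [d1 h1] : exists d, cderiv (fun x => cw p eta (phi x)) y d.
  apply: (@cderiv_herm _ _ (fun x => phi x - p) eta y) => i.
  have [d dE] := dy i; exists (d + 0).
  rewrite (_ : (fun x => _) = fun x => phi x 0 i + - p 0 i); last first.
    by apply/funext => x; rewrite !mxE.
  exact: (cderivD dE (cderiv_cst _ y)).
have bc : (fun x => br (phi x)) @ nbhs y --> br (phi y).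
  exact: (cvg_comp _ _ cp (br_cvg Oy)).
have h2 : cderiv (fun x => br (phi x)) y (d1 / (2 * br (phi y))).
  apply: (cderiv_sqrt (br_neq0 Oy) bc _ h1).
  by apply: filterS near1 => w /ph[Ow _]; exact: br_sqr.
pose g x := br (phi x) + a%:C.
have den : g y != 0 by exact: br_den.
have [d2 h4] : exists d, cderiv g y d.
  by eexists; exact: (cderivD h2 (cderiv_cst a%:C y)).
have [d3 h3] : exists d, cderiv (fun x => br (phi x) / g x) y d.
  by eexists; exact: (cderivM h2 (cderivV den h4)).
have s0 : halfplane_coord (phi y) != 0.
  have : slit (br (phi y) / (br (phi y) + a%:C)) by exact: br_slit.
  by move=> /psqrt_Re_gt0; apply: contraTneq; rewrite /halfplane_coord => ->; rewrite ltxx.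
eexists; apply: (@cderiv_sqrt _ _ _ y _ s0 _ _ h3); last first.
  by apply: filterS near1 => w /ph[Ow _]; apply: psqrt_sqr; exact: br_slit.
apply: psqrt_cvg; first exact: br_slit.
exact: (cderiv_cvg h3).
Qed.

Lemma halfplane_coord_real z (r : R) : Omega z -> 0 < r -> r < rc -> cw p eta z = r%:C ->
  ln (complex.Re (halfplane_coord z)) = (ln (Num.sqrt r) - ln (Num.sqrt r + a)) / 2.
Proof.
move=> Oz r0 rrc zr; rewrite /halfplane_coord (br_real Oz r0 rrc zr).
have s0 : 0 < Num.sqrt r by rewrite sqrtr_gt0.
move: (Num.sqrt r) s0 => s s0.
have sa : 0 < s + a by rewrite addr_gt0.
have q0 : 0 < s / (s + a) by rewrite divr_gt0.
rewrite -(rmorphD (real_complex R)) -(fmorphV (real_complex R)) -(rmorphM (real_complex R)).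
rewrite -(ln_div s0 sa).
move: (s / (s + a)) q0 => q q0.
have qE : q = Num.sqrt q ^+ 2 by rewrite sqr_sqrtr// ltW.
have t0 : 0 < Num.sqrt q by rewrite sqrtr_gt0.
move: (Num.sqrt q) qE t0 => t -> t0.
rewrite (rmorphXn (real_complex R)) psqrt_sqr_id//.
by rewrite -[complex.Re _]/t (lnXn _ t0) -(mulr_natr (ln t)) mulfK.
Qed.

(** 16 = 2^4: the roots [br] and [psqrt] halve logarithms twice, passing from s to s / (s + a) costs
    a factor 2 as long as s <= a, and [kobayashi_ge] costs the last one. *)
Lemma kobayashi_lower z1 z2 (r1 r2 : R) : 0 < r1 -> r1 <= r2 -> r2 <= a ^+ 2 ->
  Omega z1 -> Omega z2 -> cw p eta z1 = r1%:C -> cw p eta z2 = r2%:C ->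
  (((ln r2 - ln r1) / 16)%:E <= kobayashi Omega z2 z1)%E.
Proof.
move=> r10 r12 r2a O1 O2 E1 E2.
have r20 : 0 < r2 by exact: lt_le_trans r12.
have r2c : r2 < rc by exact: le_lt_trans a2.
have r1c : r1 < rc by exact: le_lt_trans r2c.
apply: le_trans (kobayashi_ge _ _ halfplane_coord_holo).
rewrite lee_fin (halfplane_coord_real O1 r10 r1c E1) (halfplane_coord_real O2 r20 r2c E2).
have s10 : 0 < Num.sqrt r1 by rewrite sqrtr_gt0.
have s20 : 0 < Num.sqrt r2 by rewrite sqrtr_gt0.
have s12 : Num.sqrt r1 <= Num.sqrt r2 by rewrite ler_wsqrtr.
have s2a : Num.sqrt r2 <= a by rewrite -(ger0_norm (ltW a0)) -sqrtr_sqr ler_wsqrtr.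
have F1 : ln r1 = 2 * ln (Num.sqrt r1).
  by have := lnXn 2 s10; rewrite sqr_sqrtr ?(ltW r10)// => ->; rewrite mulr_natl.
have F2 : ln r2 = 2 * ln (Num.sqrt r2).
  by have := lnXn 2 s20; rewrite sqr_sqrtr ?(ltW r20)// => ->; rewrite mulr_natl.
rewrite F1 F2; move: (Num.sqrt r1) (Num.sqrt r2) s10 s20 s12 s2a {F1 F2} => s1 s2 s10 s20 s12 s2a.
have t1 : 0 < s1 + a by rewrite addr_gt0.
have t2 : 0 < s2 + a by rewrite addr_gt0.
have p1 : 0 < (s1 + a) ^+ 2 by rewrite exprn_gt0.
have p2 : 0 < (s2 + a) ^+ 2 by rewrite exprn_gt0.
(* The sides differ by (s2 - s1) (a^2 - s1 s2). In logarithms, ln (s + a) varies at most half as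
   much as ln s. *)
have key : s1 * (s2 + a) ^+ 2 <= s2 * (s1 + a) ^+ 2.
  have : 0 <= (s2 - s1) * (a * a - s1 * s2).
    by apply: mulr_ge0; rewrite subr_ge0//; apply: ler_pM; lra.
  by rewrite !expr2; lra.
have := ler_ln (mulr_gt0 s10 p2) (mulr_gt0 s20 p1); rewrite key.
rewrite (lnM s10 p2) (lnM s20 p1) (lnXn _ t1) (lnXn _ t2) -!(mulr_natl (ln _)) => {}key.
apply: le_trans (_ : ((ln s2 - ln (s2 + a)) / 2 - (ln s1 - ln (s1 + a)) / 2) / 2 <= _).
  move: (ln s1) (ln s2) (ln (s1 + a)) (ln (s2 + a)) key => l1 l2 l3 l4 key; lra.
by rewrite ler_pM2r ?invr_gt0// ler_norm.
Qed.

End LowerBound.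

(** * Strict differentiability from continuous directional derivatives *)

Section StrictDifferential.
Context {R : realType} {n : nat}.
Local Notation C := R[i].
Implicit Types (z s v : 'rV[C]_n) (U : set 'rV[C]_n) (rho : 'rV[C]_n -> R).

Definition rv_ball s (d : R) z : Prop := forall i, normc (z 0 i - s 0 i) < d.

Lemma rv_ballD s (d1 d2 : R) z v : rv_ball s d1 z -> (forall i, normc (v 0 i) <= d2) ->
  rv_ball s (d1 + d2) (z + v).
Proof.
move=> zs vd i; rewrite mxE addrAC; apply: le_lt_trans (le_normcD _ _) _.
exact: ltr_leD.
Qed.

Lemma rv_ballW s (d1 d2 : R) z : d1 <= d2 -> rv_ball s d1 z -> rv_ball s d2 z.
Proof. by move=> d12 zs i; exact: lt_le_trans (zs i) d12. Qed.

Lemma is_derive_line U rho v z (t : R) : C1_on U rho -> U (z + t%:C *: v) ->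
  is_derive t 1 (fun t : R => rho (z + t%:C *: v)) (rderive rho v (z + t%:C *: v)).
Proof.
move=> C1 Uz; have [dr _] := C1 v _ Uz.
have dr' : is_derive (0 : R) 1 (fun h : R => rho (z + t%:C *: v + h%:C *: v))
    (rderive rho v (z + t%:C *: v)).
  by rewrite /rderive derive1E; apply: DeriveDef.
apply: eps_is_derive => e e0; have := is_derive_eps dr' e0.
apply: filterS => h; rewrite add0r scale0r addr0.
by rewrite rmorphD scalerDl addrA.
Qed.

Section AtPoint.
Variables (U : set 'rV[C]_n) (rho : 'rV[C]_n -> R) (s : 'rV[C]_n).
Hypotheses (Uo : open U) (C1 : C1_on U rho) (Us : U s).

(* Strict differentiability at s along a family of displacements A t, with
   differential L t and size N t. *)
Definition strict_diff (T : Type) (N : T -> R) (A : T -> 'rV[C]_n) (L : T -> R) : Prop :=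
  [/\ forall t, 0 <= N t,
      exists2 K : R, 0 < K & forall t i, normc (A t 0 i) <= K * N t &
      forall e : R, 0 < e -> exists2 d : R, 0 < d & forall z t, rv_ball s d z -> N t < d ->
        U (z + A t) /\ `|rho (z + A t) - rho z - L t| <= e * N t].

(** The mean value theorem on the segment from z to z + t v, with continuity of the derivative at s.
    The base point z moves too, which is what makes displacements composable. *)
Lemma strict_diff_line v :
  strict_diff (fun t : R => `|t|) (fun t => t%:C *: v) (fun t => t * rderive rho v s).
Proof.
pose K := 1 + \sum_i normc (v 0 i).
have sn0 : 0 <= \sum_i normc (v 0 i) by rewrite sumr_ge0// => i _; exact: normc_ge0.
have K0 : 0 < K by rewrite /K; lra.
have vK i : normc (v 0 i) <= K.
  rewrite /K (bigD1 i)//= addrCA lerDl addr_ge0// sumr_ge0// => j _; exact: normc_ge0.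
have AK (t : R) i : normc ((t%:C *: v) 0 i) <= K * `|t|.
  by rewrite mxE normcM normcR mulrC ler_wpM2r.
split => [t||e e0]; [exact: normr_ge0|by exists K|].
have [_ cv] := C1 v Us.
have nU : \forall z \near s, U z by exact: open_nbhs_nbhs.
have nD : \forall z \near s, `|rderive rho v s - rderive rho v z| < e.
  by move/cvgrPdist_lt : cv; apply.
have /near_rV[r r0 rE] : \forall z \near s, U z /\ `|rderive rho v s - rderive rho v z| < e.
  by near=> z; split; near: z.
exists (r / (1 + K)); first by rewrite divr_gt0//; lra.
move=> z t zs tr.
have inball (u : R) : `|u| <= `|t| -> rv_ball s r (z + u%:C *: v).
  move=> ut; have := @rv_ballD s (r / (1 + K)) (K * `|u|) z (u%:C *: v) zs (AK u).
  apply: rv_ballW; apply: le_trans (_ : r / (1 + K) + K * (r / (1 + K)) <= _).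
    by rewrite lerD2l ler_pM2l// (le_trans ut)// ltW.
  by rewrite -[X in X + _]mul1r -mulrDl mulrC divfK// gt_eqF//; lra.
split; first by have [] := rE _ (inball t (lexx _)).
pose g (u : R) := rho (z + u%:C *: v).
have dg (u : R) : `|u| <= `|t| -> is_derive (u : R) (1 : R) g (rderive rho v (z + u%:C *: v)).
  by move=> ut; apply: is_derive_line C1 _; have [] := rE _ (inball u ut).
have bnd (u : R) : `|u| <= `|t| -> `|rderive rho v (z + u%:C *: v) - rderive rho v s| <= e.
  by move=> ut; have [_] := rE _ (inball u ut); rewrite distrC => /ltW.
have cg (u : R) : `|u| <= `|t| -> {for u, continuous g}.
  move=> ut; apply: differentiable_continuous; apply/derivable1_diffP.
  by have := dg _ ut; case.
have g0 : rho z = g 0 by rewrite /g scale0r addr0.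
rewrite g0 -/(g t).
have [c ct ->] : exists2 c : R, `|c| <= `|t| & g t - g 0 = rderive rho v (z + c%:C *: v) * t.
  have [t0|t0|<-] := ltgtP 0 t; last by exists 0; rewrite ?subrr ?mulr0.
    have [||c] := @MVT _ g (fun u => rderive rho v (z + u%:C *: v)) _ _ t0.
    - move=> u; rewrite in_itv/= => /andP[u0 ut]; apply: dg.
      by rewrite !gtr0_norm// ltW.
    - apply: continuous_subspace_itv => u; rewrite in_itv/= => /andP[u0 ut]; apply: cg.
      by rewrite !ger0_norm// ltW.
    rewrite in_itv/= subr0 => /andP[c0 ct] E; exists c => //.
    by rewrite !gtr0_norm// ltW.
  have [||c] := @MVT _ g (fun u => rderive rho v (z + u%:C *: v)) _ _ t0.
  - move=> u; rewrite in_itv/= => /andP[u0 ut]; apply: dg.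
    by rewrite !ltr0_norm// lerN2 ltW.
  - apply: continuous_subspace_itv => u; rewrite in_itv/= => /andP[u0 ut]; apply: cg.
    by rewrite !ler0_norm ?lerN2// ltW.
  rewrite in_itv/= sub0r => /andP[c0 ct] E; exists c.
    by rewrite !ltr0_norm// lerN2 ltW.
  by rewrite -opprB E mulrN opprK.
by rewrite mulrC -mulrBr normrM mulrC ler_wpM2r ?bnd.
Unshelve. all: end_near. Qed.

(** The displacements are performed one after the other: the second starts at a moved base point,
    still close to s. *)
Lemma strict_diffD (T1 T2 : Type) N1 N2 A1 A2 L1 L2 :
  @strict_diff T1 N1 A1 L1 -> @strict_diff T2 N2 A2 L2 ->
  strict_diff (fun t : T1 * T2 => N1 t.1 + N2 t.2) (fun t => A1 t.1 + A2 t.2)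
    (fun t => L1 t.1 + L2 t.2).
Proof.
clear Uo C1 Us; move=> [N10 [K1 K10 K1E] H1] [N20 [K2 K20 K2E] H2]; split => [t||e e0].
- by rewrite addr_ge0.
- exists (K1 + K2); first by rewrite addr_gt0.
  move=> t i; rewrite mxE; apply: le_trans (le_normcD _ _) _.
  apply: le_trans (lerD (K1E t.1 i) (K2E t.2 i)) _.
  have := mulr_ge0 (ltW K10) (N20 t.2); have := mulr_ge0 (ltW K20) (N10 t.1).
  by rewrite mulrDl !mulrDr; lra.
have [d1 d10 d1E] := H1 _ e0; have [d2 d20 d2E] := H2 _ e0.
have den : 0 < 1 + K1 by lra.
exists (Num.min d1 (d2 / (1 + K1))).
  by rewrite lt_min d10 divr_gt0.
move=> z t zs; rewrite lt_min => /andP[t1 t2].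
have := N10 t.1; have := N20 t.2 => n2 n1.
have zs1 : rv_ball s d1 z by apply: rv_ballW zs; rewrite ge_min lexx.
have [_ h1] : U (z + A1 t.1) /\ `|rho (z + A1 t.1) - rho z - L1 t.1| <= e * N1 t.1.
  by apply: d1E zs1 _; lra.
have z2 : rv_ball s d2 (z + A1 t.1).
  have := @rv_ballD s _ _ z (A1 t.1) zs (K1E t.1); apply: rv_ballW.
  apply: le_trans (_ : d2 / (1 + K1) + K1 * (d2 / (1 + K1)) <= _).
    by rewrite lerD ?ge_min ?lexx ?orbT// ler_pM2l// ltW//; lra.
  by rewrite -[X in X + _]mul1r -mulrDl mulrC divfK// gt_eqF.
have t2' : N2 t.2 < d2.
  apply: lt_le_trans (_ : d2 / (1 + K1) <= _); first by lra.
  by rewrite ler_pdivrMr// ler_peMr; lra.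
have [u h2] := d2E (z + A1 t.1) t.2 z2 t2'.
rewrite addrA; split => //.
have -> : rho (z + A1 t.1 + A2 t.2) - rho z - (L1 t.1 + L2 t.2) =
  (rho (z + A1 t.1) - rho z - L1 t.1) + (rho (z + A1 t.1 + A2 t.2) - rho (z + A1 t.1) - L2 t.2).
  by ring.
by apply: le_trans (ler_normD _ _) _; rewrite mulrDr lerD.
Qed.

End AtPoint.

End StrictDifferential.

(** * The differential of a defining function and the inner normal *)

Section TangentGeometry.
Context {R : realType}.
Local Notation C := R[i].
Variables (Omega : set 'rV[C]_2) (X eta : 'rV[C]_2).
Hypotheses (XX : herm X X = 1) (ee : herm eta eta = 1) (Xe : herm X eta = 0).
Hypothesis (Oo : open Omega).

(** The real differential of rho at s on x X + w eta. [C1_on] does not assert linearity in the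
    direction; [rderive_coord] derives it. *)
Definition dlin (rho : 'rV[C]_2 -> R) (s : 'rV[C]_2) (x w : C) : R :=
  (complex.Re x * rderive rho X s + complex.Im x * rderive rho ('i *: X) s) +
  (complex.Re w * rderive rho eta s + complex.Im w * rderive rho ('i *: eta) s).

Definition l1norm (x : C) : R := `|complex.Re x| + `|complex.Im x|.

Lemma dlinZ rho s (t : R) x w : dlin rho s (t%:C * x) (t%:C * w) = t * dlin rho s x w.
Proof.
rewrite /dlin; move: (rderive _ X s) (rderive _ ('i *: X) s) (rderive _ eta s) => a b c.
move: (rderive _ ('i *: eta) s) => d.
by case: x => x1 x2; case: w => w1 w2 /=; ring.
Qed.

Lemma dlinB rho s x y w u : dlin rho s (x - y) (w - u) = dlin rho s x w - dlin rho s y u.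
Proof.
rewrite /dlin; move: (rderive _ X s) (rderive _ ('i *: X) s) (rderive _ eta s) => a b c.
move: (rderive _ ('i *: eta) s) => d.
by case: x => x1 x2; case: w => w1 w2; case: y => y1 y2; case: u => u1 u2 /=; ring.
Qed.

Lemma Re_conj_shift (x w x0 w0 : C) (t : R) :
  complex.Re ((x - t%:C * x0) * x0^* + (w - t%:C * w0) * w0^*) =
  complex.Re (x * x0^* + w * w0^*) - t * complex.Re (x0 * x0^* + w0 * w0^*).
Proof. by case: x => x1 x2; case: w => w1 w2; case: x0 => a1 a2; case: w0 => b1 b2 /=; ring. Qed.

Lemma l1norm_le x : l1norm x <= 2 * normc x.
Proof. by rewrite /l1norm mulr_natl mulr2n lerD ?normc_Re ?normc_Im. Qed.

Lemma strict_diff_coord U rho s : open U -> C1_on U rho -> U s -> forall e : R, 0 < e ->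
  exists2 d : R, 0 < d & forall z x w, rv_ball s d z -> normc x < d -> normc w < d ->
    U (z + x *: X + w *: eta) /\
    `|rho (z + x *: X + w *: eta) - rho z - dlin rho s x w| <= e * (normc x + normc w).
Proof.
move=> Uo C1 Us e e0.
have [_ _ H] := strict_diffD
  (strict_diffD (strict_diff_line Uo C1 Us X) (strict_diff_line Uo C1 Us ('i *: X)))
  (strict_diffD (strict_diff_line Uo C1 Us eta) (strict_diff_line Uo C1 Us ('i *: eta))).
have e2 : 0 < e / 2 by lra.
have [d d0 dE] := H _ e2.
exists (d / 4); first lra.
move=> z x w zs xd wd.
have nx := l1norm_le x; have nw := l1norm_le w.
have zs1 : rv_ball s d z by apply: rv_ballW zs; lra.
have n1 : l1norm x + l1norm w < d by lra.
have := dE z ((complex.Re x, complex.Im x), (complex.Re w, complex.Im w)) zs1 n1 => /=.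
have E (c : C) v : (complex.Re c)%:C *: v + (complex.Im c)%:C *: ('i *: v) = c *: v.
  rewrite scalerA -scalerDl; congr (_ *: _).
  by rewrite [RHS]complexE mulrC.
rewrite !E addrA /dlin => -[h1 h2]; split => //; apply: le_trans h2 _.
by move: nx nw; rewrite /l1norm => nx nw; nra.
Qed.

Lemma rderive_coord U rho s x w : open U -> C1_on U rho -> U s ->
  rderive rho (x *: X + w *: eta) s = dlin rho s x w.
Proof.
move=> Uo C1 Us; rewrite /rderive.
suff : is_derive (0 : R) 1 (fun t : R => rho (s + t%:C *: (x *: X + w *: eta))) (dlin rho s x w).
  by move=> h; rewrite derive1E derive_val.
apply: eps_is_derive => e e0.
pose N := 1 + normc x + normc w.
have N0 : 0 < N by have := normc_ge0 x; have := normc_ge0 w; rewrite /N; lra.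
have eN : 0 < e / N by rewrite divr_gt0.
have [d d0 dE] := strict_diff_coord Uo C1 Us eN.
apply/nbhs_ballP; exists (d / N) => /=; first by rewrite divr_gt0.
move=> t; rewrite /ball/= sub0r normrN => td; rewrite add0r scale0r addr0.
have tN : `|t| * N < d by rewrite -ltr_pdivlMr.
have t0 := normr_ge0 t; have nx := normc_ge0 x; have nw := normc_ge0 w.
have tx : `|t| * normc x <= `|t| * N by rewrite ler_wpM2l// /N; lra.
have tw : `|t| * normc w <= `|t| * N by rewrite ler_wpM2l// /N; lra.
have [||| _] := dE s (t%:C * x) (t%:C * w).
- by move=> i; rewrite subrr normc0.
- by rewrite normcM normcR; lra.
- by rewrite normcM normcR; lra.
rewrite scalerDr !scalerA addrA !normcM normcR -mulrDr.
rewrite dlinZ.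
move=> h; apply: le_trans h _; rewrite mulrCA [X in _ <= X]mulrC ler_wpM2l//.
by rewrite -mulrA ler_piMr ?(ltW e0)// mulrC ler_pdivrMr// mul1r /N; lra.
Qed.

Lemma rdot_coord x w y u : rdot (x *: X + w *: eta) (y *: X + u *: eta) =
  complex.Re (x * y^* + w * u^*).
Proof.
rewrite rdotE hermDl !hermZl !(herm_conj (y *: X + _)) !hermDl !hermZl XX ee Xe (herm_conj X eta) Xe.
by rewrite !(conjc0, mulr0, addr0, add0r, mulr1).
Qed.

(** The kernel of the differential is orthogonal to the normal, so the differential is a multiple of
    the pairing with the normal; the multiple is negative because the normal points to where rho <
    0. *)
Lemma tangent_dirP s eta0 (x0 w0 : C) : C1_smooth_boundary_at Omega s ->
  is_inner_unit_normal Omega s eta0 -> eta0 = x0 *: X + w0 *: eta -> boundary Omega s ->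
  (forall x w, real_tangent_dir Omega s (x *: X + w *: eta) <->
     complex.Re (x * x0^* + w * w0^*) = 0) /\
  (forall rho, defining_function Omega s rho -> exists2 k : R, 0 < k &
     forall x w, dlin rho s x w = - k * complex.Re (x * x0^* + w * w0^*)).
Proof.
move=> [rho0 hrho0] [n1 nperp ninn] e0E bs.
have hk rho : defining_function Omega s rho -> exists2 k : R, 0 < k &
     forall x w, dlin rho s x w = - k * complex.Re (x * x0^* + w * w0^*).
  move=> hrho; have [U [Uo Us C1 nz H]] := hrho.
  have perp x w : dlin rho s x w = 0 -> complex.Re (x * x0^* + w * w0^*) = 0.
    move=> xw; rewrite -rdot_coord -e0E; apply: nperp; exists rho => //.
    by rewrite (rderive_coord x w Uo C1 Us).
  have self : complex.Re (x0 * x0^* + w0 * w0^*) = 1.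
    by rewrite -rdot_coord -e0E -enorm_sqr n1 expr1n.
  have k0 : dlin rho s x0 w0 != 0.
    by apply/eqP => /perp; rewrite self => /eqP; rewrite oner_eq0.
  have lin x w : dlin rho s x w = dlin rho s x0 w0 * complex.Re (x * x0^* + w * w0^*).
    pose t := dlin rho s x w / dlin rho s x0 w0.
    have : dlin rho s (x - t%:C * x0) (w - t%:C * w0) = 0.
      by rewrite dlinB dlinZ /t divfK// subrr.
    move=> /perp; rewrite Re_conj_shift self mulr1 => /eqP; rewrite subr_eq0 => /eqP ->.
    by rewrite /t mulrC divfK.
  (* If rho increased along the normal, it would be nonnegative at s + r eta0 for small r, although
     these points lie in the domain. *)
  have neg : dlin rho s x0 w0 <= 0.
    rewrite leNgt; apply/negP => pos.
    pose N := 1 + normc x0 + normc w0.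
    have nx := normc_ge0 x0; have nw := normc_ge0 w0.
    have N0 : 0 < N by rewrite /N; lra.
    have eN : 0 < dlin rho s x0 w0 / N by rewrite divr_gt0.
    have [d d0 dE] := strict_diff_coord Uo C1 Us eN.
    have [e /= ee0 eE] := ninn.
    pose r := Num.min (d / N) e / 2.
    have m0 : 0 < Num.min (d / N) e by rewrite lt_min divr_gt0.
    have [m1 m2] : Num.min (d / N) e <= d / N /\ Num.min (d / N) e <= e.
      by rewrite !ge_min !lexx orbT.
    have r0 : 0 < r by rewrite /r; lra.
    have rN : r * N < d by rewrite -ltr_pdivlMr// /r; lra.
    have rx : r * normc x0 <= r * N by rewrite ler_pM2l// /N; lra.
    have rw : r * normc w0 <= r * N by rewrite ler_pM2l// /N; lra.
    have Or : Omega (s + r%:C *: eta0).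
      apply: eE => //=; rewrite sub0r normrN gtr0_norm// /r; lra.
    have [||| Ur] := dE s (r%:C * x0) (r%:C * w0).
    - by move=> i; rewrite subrr normc0.
    - by rewrite normcM normcR gtr0_norm//; lra.
    - by rewrite normcM normcR gtr0_norm//; lra.
    have sE : s + (r%:C * x0) *: X + (r%:C * w0) *: eta = s + r%:C *: eta0.
      by rewrite e0E scalerDr !scalerA addrA.
    rewrite sE in Ur *.
    have rho1 : rho (s + r%:C *: eta0) < 0 by apply/(H _ Ur).1.
    have rho2 : rho s = 0 by apply/(H _ Us).2.
    rewrite rho2 subr0 !normcM normcR (gtr0_norm r0) -mulrDr dlinZ ler_norml => /andP[h _].
    have : dlin rho s x0 w0 / N * (r * (normc x0 + normc w0)) <= r * dlin rho s x0 w0.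
      rewrite mulrCA ler_pM2l// -mulrA ler_piMr ?(ltW pos)//.
      by rewrite mulrC ler_pdivrMr// mul1r /N; lra.
    lra.
  exists (- dlin rho s x0 w0); first by rewrite oppr_gt0 lt_def eq_sym k0 neg.
  by move=> x w; rewrite opprK.
split => // x w; split.
  by move=> h; have := nperp _ h; rewrite e0E rdot_coord.
move=> h; exists rho0 => //; have [k k0 kE] := hk _ hrho0.
by have [U [Uo Us C1 nz H]] := hrho0; rewrite (rderive_coord x w Uo C1 Us) kE h mulr0.
Qed.

End TangentGeometry.

(** * Divergence of the integral turned into divergence of sums over blocks *)

Section RealLine.
Context {R : realType}.
Local Notation mu := (@lebesgue_measure R).

(* No measurability is needed: the integral of a nonnegative function is a
   supremum over the simple functions below it. *)
Lemma ge0_le_integral_nomeas (D : set R) (f g : R -> \bar R) :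
  (forall x, D x -> (0 <= f x)%E) -> (forall x, D x -> (f x <= g x)%E) ->
  (\int[mu]_(x in D) f x <= \int[mu]_(x in D) g x)%E.
Proof.
move=> f0 fg.
have g0 x : D x -> (0 <= g x)%E by move=> Dx; apply: le_trans (fg _ Dx); exact: f0.
rewrite !ge0_integralE//; apply: ereal_sup_le => _ [h hf <-]; exists h => // x.
apply: le_trans (hf x) _; rewrite /patch; case: ifPn => // /set_mem Dx; exact: fg.
Qed.

Lemma integral_le_cst (D : set R) (f : R -> \bar R) (M : R) : measurable D ->
  (forall x, D x -> (0 <= f x)%E) -> (forall x, D x -> (f x <= M%:E)%E) ->
  (\int[mu]_(x in D) f x <= M%:E * mu D)%E.
Proof.
move=> mD f0 fM; rewrite -(integral_cst mu mD); exact: ge0_le_integral_nomeas.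
Qed.

(** The supremum need not be attained; a point reaching half of it is enough, at the cost of a
    factor 2. *)
Lemma near_max (h : R -> R) (a b M : R) : a <= b -> 0 < h a ->
  (forall r, a <= r -> r <= b -> h r <= M) ->
  exists r, [/\ a <= r, r <= b, 0 < h r & forall r', a <= r' -> r' <= b -> h r' <= 2 * h r].
Proof.
move=> ab ha hM.
pose E := [set h r | r in `[a, b]%classic].
have Ea : E (h a) by exists a => //=; rewrite in_itv/= lexx ab.
have hs : has_sup E.
  split; first by exists (h a).
  by exists M => _ [r /= + <-]; rewrite in_itv/= => /andP[ar rb]; exact: hM.
have s0 : 0 < sup E by apply: lt_le_trans ha _; apply: ub_le_sup => //; exact: hs.2.
have s2 : 0 < sup E / 2 by rewrite divr_gt0.
have [_ [r /= + <-]] := sup_adherent s2 hs; rewrite in_itv/= => /andP[ar rb] hr.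
exists r; split => //; first by move: hr; lra.
move=> r' ar' r'b; have : h r' <= sup E.
  by apply: ub_le_sup; [exact: hs.2|exists r' => //=; rewrite in_itv/= ar'].
by move: hr; lra.
Qed.

(** The integral of H r / r over block k is at most G k times the length of the block divided by its
    lower end, that is G k (1 / q - 1); bounded sums would make the integral finite. As [H] may be
    negative, the positive part is estimated. *)
Lemma block_sums_diverge (delta rho q : R) (H : R -> R) (G : nat -> R) (M : R) :
  0 < rho -> rho < delta -> 0 < q -> q < 1 -> measurable_fun `]0, delta[ H ->
  (forall r0, 0 < r0 -> r0 < delta -> exists B, forall r, r0 <= r -> r < delta -> H r <= B) ->
  (\int[mu]_(r in `]0%R, delta[) (H r / r)%:E = +oo)%E ->
  (forall k, 0 <= G k) ->
  (forall k r, rho * q ^+ k.+1 <= r -> r <= rho * q ^+ k -> H r <= G k) ->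
  exists N, M <= \sum_(k < N) G k.
Proof.
move=> rho0 rhod q0 q1 mH Hb int_H G0 HG; apply: contrapT => no.
have sumM N : \sum_(k < N) G k <= M.
  by apply/ltW; rewrite ltNge; apply/negP => h; apply: no; exists N.
pose f (r : R) : \bar R := (H r / r)%:E.
have mf : measurable_fun `]0, delta[ f.
  apply/measurable_EFinP; apply: measurable_funM => //.
  apply: open_continuous_measurable_fun; first exact: interval_open.
  move=> r /set_mem /=; rewrite in_itv/= => /andP[r0 _]; apply: inv_continuous.
  by rewrite gt_eqF.
have f0 r : (0 <= f^\+ r)%E by exact: funepos_ge0.
have fle (r c B : R) : 0 < c -> c <= r -> H r <= B -> 0 <= B -> (f^\+ r <= (B / c)%:E)%E.
  move=> c0 cr HB B0; rewrite funeposE /f -EFin_max lee_fin ge_max.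
  have r0 : 0 < r by exact: lt_le_trans cr.
  apply/andP; split; last by rewrite divr_ge0// ltW.
  apply: le_trans (_ : B / r <= _); first by rewrite ler_pM2r// invr_gt0.
  by rewrite ler_wpM2l// lef_pV2.
have [B HB] := Hb _ rho0 rhod.
have B10 : 0 <= Num.max B 0 by rewrite le_max lexx orbT.
have B1 r : rho <= r -> r < delta -> H r <= Num.max B 0.
  by move=> h1 h2; rewrite le_max HB.
move: (Num.max B 0) B10 B1 => {HB} B' B10 B1.
have qn n : 0 < rho * q ^+ n by rewrite mulr_gt0// exprn_gt0.
have qle m n : (m <= n)%N -> rho * q ^+ n <= rho * q ^+ m.
  by move=> mn; rewrite ler_pM2l// ler_wiXn2l// ltW.
(* A countable partition of (0, delta): the half-open blocks, preceded by [rho, delta), where [H] is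
   bounded above. *)
pose F k : set R := if k is j.+1 then `[rho * q ^+ j.+1, rho * q ^+ j[%classic
  else `[rho, delta[%classic.
have mF k : measurable (F k) by case: k => [|k]; exact: measurable_itv.
have FE : \bigcup_k F k = `]0, delta[%classic.
  apply/seteqP; split => [r [[|k] _]|r] /=; rewrite !in_itv/= => /andP[h1 h2].
  - by rewrite h2 (lt_le_trans rho0).
  - rewrite (lt_le_trans (qn _) h1) (lt_trans h2)//.
    by apply: le_lt_trans rhod; have := qle 0%N k; rewrite expr0 mulr1; apply.
  have [rr|rr] := leP rho r; first by exists 0%N => //=; rewrite in_itv/= rr.
  have ex : exists n, rho * q ^+ n <= r.
    have qc : `|q| < 1 by rewrite gtr0_norm.
    have rr0 : 0 < r / rho by rewrite divr_gt0.
    have /cvgrPdist_lt/(_ _ rr0)[n _ nE] := cvg_expr qc.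
    exists n; have := nE n (leqnn n); rewrite /= sub0r normrN gtr0_norm ?exprn_gt0//.
    by rewrite ltr_pdivlMr// mulrC => /ltW.
  have := ex_minnP ex; case=> [[|n]]; first by rewrite expr0 mulr1 leNgt rr.
  move=> h3 h4; exists n.+1 => //=; rewrite in_itv/= h3 ltNge; apply/negP => /h4.
  by rewrite ltnn.
have tF : trivIset setT F.
  apply: ltn_trivIset => -[//|n] m mn; apply/seteqP; split => // r [/= h1].
  rewrite in_itv/= => /andP[_ h2]; case: m mn h1 => [|m] mn /=; rewrite in_itv/= => /andP[h1 _].
    by have := qle 0%N n isT; rewrite expr0 mulr1; lra.
  by have := qle m.+1 n mn; lra.
have mfp : measurable_fun (\bigcup_k F k) (f^\+)%E by rewrite FE; exact: measurable_funepos.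
have E := ge0_integral_bigcup mu mF mfp (fun x _ => f0 x) tF.
have i0 k : (0 <= \int[mu]_(x in F k) f^\+ x)%E by exact: integral_ge0.
have bnd0 : (\int[mu]_(x in F 0%N) f^\+ x <= (B' / rho * (delta - rho))%:E)%E.
  apply: le_trans (integral_le_cst (M := B' / rho) (mF 0%N) _ _) _ => //.
    move=> x /=; rewrite in_itv/= => /andP[h1 h2]; apply: fle => //; exact: B1.
  by rewrite lebesgue_measure_itv/= lte_fin rhod -EFinB -EFinM.
have bnd k : (\int[mu]_(x in F k.+1) f^\+ x <= (G k * (q^-1 - 1))%:E)%E.
  apply: le_trans (integral_le_cst (M := G k / (rho * q ^+ k.+1)) (mF k.+1) _ _) _ => //.
    move=> x /=; rewrite in_itv/= => /andP[h1 h2]; apply: fle => //.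
    by apply: HG => //; exact: ltW.
  rewrite lebesgue_measure_itv/= lte_fin exprS mulrCA gtr_pMl ?qn// q1 -EFinB -EFinM lee_fin.
  rewrite -mulrA ler_wpM2l// -[X in X - _]mul1r -mulrBl invfM mulrACA mulVf ?mulr1 ?gt_eqF ?qn//.
  by rewrite mulrBr mulr1 mulVf// gt_eqF.
have fin : (\int[mu]_(x in \bigcup_k F k) f^\+ x <=
    (B' / rho * (delta - rho) + M * (q^-1 - 1))%:E)%E.
  rewrite E; apply: lime_le; first by apply: is_cvg_nneseries => n _ _; exact: i0.
  exists 1%N => // -[//|n] _ /=; rewrite big_nat_recl//= EFinD leeD//.
  apply: le_trans (lee_sum _ (fun k _ => bnd k)) _.
  rewrite sumEFin lee_fin -mulr_suml ler_wpM2r//.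
    by rewrite subr_ge0 -[X in X <= _]invr1 lef_pV2 ?posrE// ltW.
  by rewrite big_mkord; exact: sumM.
move: fin; rewrite FE => fin.
have : (\int[mu]_(x in `]0%R, delta[) f x <= \int[mu]_(x in `]0%R, delta[) f^\+ x)%E.
  rewrite [X in (X <= _)%E]integralE geeDl// oppe_le0; exact: integral_ge0.
rewrite int_H leye_eq => /eqP E2; by move: fin; rewrite E2 leye_eq.
Qed.

End RealLine.

(** * Monotone C^1 steps *)

Section Smoothstep.
Context {R : realType}.
Implicit Types (x v : R).

Definition possqr x : R := Num.max 0 x ^+ 2.

Lemma is_derive_possqr x : is_derive x 1 possqr (2 * Num.max 0 x).
Proof.
apply: eps_is_derive => e e0.
apply/nbhs_ballP; exists e => //= h; rewrite /ball/= sub0r normrN => he.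
have step : `|possqr (x + h) - possqr x - h * (2 * Num.max 0 x)| <= `|h| * `|h|.
  have hh : `|h| * `|h| = h ^+ 2 by rewrite -expr2 real_normK ?num_real.
  rewrite hh /possqr ler_norml.
  case: (leP 0 x) => x0; case: (leP 0 (x + h)) => xh0; apply/andP; split; nra.
apply: le_trans step _; by rewrite ler_wpM2r// ltW.
Qed.

(** A quadratic spline with knots 0, 1/2 and 1, whose derivative is the tent of height 2 over
    [0, 1]; truncated squares let one differentiation rule cover all pieces. *)
Definition smoothstep x : R := 2 * (possqr x - 2 * possqr (x - 2^-1) + possqr (x - 1)).

Definition dsmoothstep x : R :=
  4 * (Num.max 0 x - 2 * Num.max 0 (x - 2^-1) + Num.max 0 (x - 1)).

Lemma is_derive_shift (f : R -> R) (c x d : R) : is_derive (x - c) 1 f d ->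
  is_derive x 1 (fun y => f (y - c)) d.
Proof.
move=> fd; apply: eps_is_derive => e e0; have := is_derive_eps fd e0.
by apply: filterS => h; rewrite [x - c + h]addrAC.
Qed.

Lemma is_derive_smoothstep x : is_derive x 1 smoothstep (dsmoothstep x).
Proof.
have d1 := is_derive_possqr x.
have d2 := is_derive_shift (is_derive_possqr (x - 2^-1)).
have d3 := is_derive_shift (is_derive_possqr (x - 1)).
have h := is_deriveZ 2 (is_deriveD (is_deriveB d1 (is_deriveZ 2 d2)) d3).
apply: (is_derive_eq h); rewrite /dsmoothstep /GRing.scale/=; ring.
Qed.

Lemma smoothstep_le0 x : x <= 0 -> smoothstep x = 0.
Proof. by move=> x0; rewrite /smoothstep /possqr !max_l; lra. Qed.

Lemma smoothstep_ge1 x : 1 <= x -> smoothstep x = 1.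
Proof. by move=> x0; rewrite /smoothstep /possqr !max_r; lra. Qed.

Lemma smoothstep01 x : 0 <= smoothstep x <= 1.
Proof.
rewrite /smoothstep /possqr; case: (leP 0 x) => x0; case: (leP 0 (x - 2^-1)) => x1;
  case: (leP 0 (x - 1)) => x2; apply/andP; split; nra.
Qed.

Lemma dsmoothstep_le0 x : x <= 0 -> dsmoothstep x = 0.
Proof. by move=> x0; rewrite /dsmoothstep !max_l; lra. Qed.

Lemma dsmoothstep_ge1 x : 1 <= x -> dsmoothstep x = 0.
Proof. by move=> x0; rewrite /dsmoothstep !max_r; lra. Qed.

Lemma dsmoothstep_bound x : 0 <= dsmoothstep x <= 2.
Proof.
rewrite /dsmoothstep; case: (leP 0 x) => x0; case: (leP 0 (x - 2^-1)) => x1;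
  case: (leP 0 (x - 1)) => x2; apply/andP; split; lra.
Qed.

Section Steps.
Variables (theta : nat -> R) (N : nat).
Hypotheses (theta0 : forall k, 0 <= theta k).

Definition steps v : R := \sum_(k < N) theta k * smoothstep (v - k%:R).
Definition dsteps v : R := \sum_(k < N) theta k * dsmoothstep (v - k%:R).

Lemma is_derive_steps v : is_derive v 1 steps (dsteps v).
Proof.
rewrite /steps /dsteps; elim: N => [|n IH].
  rewrite big_ord0 (_ : (fun v => _) = cst 0); first exact: is_derive_cst.
  by apply/funext => y; rewrite big_ord0.
rewrite big_ord_recr (_ : (fun v => _) =
  (fun v => \sum_(k < n) theta k * smoothstep (v - k%:R)) +
  (fun v => theta n *: smoothstep (v - n%:R))); last first.
  by apply/funext => y; rewrite big_ord_recr.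
exact: (is_deriveD IH (is_deriveZ (theta n) (is_derive_shift (is_derive_smoothstep _)))).
Qed.

Lemma steps0 : steps 0 = 0.
Proof.
by rewrite /steps big1// => k _; rewrite smoothstep_le0 ?mulr0// sub0r oppr_le0 ler0n.
Qed.

Lemma stepsN : steps N%:R = \sum_(k < N) theta k.
Proof.
apply: eq_bigr => k _; rewrite smoothstep_ge1 ?mulr1//.
by rewrite lerBrDr addrC natr1 ler_nat.
Qed.

Lemma steps_bound v : 0 <= steps v <= \sum_(k < N) theta k.
Proof.
apply/andP; split.
  by rewrite sumr_ge0// => k _; rewrite mulr_ge0//; case/andP: (smoothstep01 (v - k%:R)).
apply: ler_sum => k _; rewrite ler_piMr//; by case/andP: (smoothstep01 (v - k%:R)).
Qed.

Lemma unit_block v : (0 < N)%N -> 0 <= v -> v <= N%:R ->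
  exists k, [/\ (k < N)%N, k%:R <= v & v <= k.+1%:R].
Proof.
case: N => // n _ v0; elim: n => [|n IH] vn; first by exists 0%N.
case: (leP v n.+1%:R) => [/IH[k [kn h1 h2]]|h]; first by exists k; split => //; exact: ltnW.
by exists n.+1; split => //; exact: ltW.
Qed.

(** Between k and k + 1 the earlier steps are complete and the later ones have not begun, so a
    single summand remains. *)
Lemma dsteps_bound v k : (k < N)%N -> k%:R <= v -> v <= k.+1%:R ->
  0 <= dsteps v <= 2 * theta k.
Proof.
move=> kN kv vk; rewrite /dsteps (bigD1 (Ordinal kN))//= big1 ?addr0.
  have /andP[h1 h2] := dsmoothstep_bound (v - k%:R).
  by rewrite mulr_ge0//= mulrC ler_wpM2r.
move=> j jk; have [h|h|h] := ltngtP j k.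
- rewrite dsmoothstep_ge1 ?mulr0// lerBrDr; apply: le_trans kv.
  by rewrite addrC natr1 ler_nat.
- rewrite dsmoothstep_le0 ?mulr0// subr_le0; apply: le_trans vk _.
  by rewrite ler_nat.
by move: jk; rewrite -val_eqE/= h eqxx.
Qed.

End Steps.

Lemma lipschitz_of_derive (f df : R -> R) (a b L : R) : a <= b ->
  (forall t, a <= t -> t <= b -> is_derive t 1 f (df t)) ->
  (forall t, a <= t -> t <= b -> `|df t| <= L) -> `|f b - f a| <= L * (b - a).
Proof.
rewrite le_eqVlt => /orP[/eqP ->|ab] fd dL; first by rewrite !subrr normr0 mulr0.
have [||c] := @MVT _ f df a b ab.
- by move=> x; rewrite in_itv/= => /andP[h1 h2]; apply: fd; exact: ltW.
- apply: continuous_subspace_itv => x; rewrite in_itv/= => /andP[h1 h2].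
  apply: differentiable_continuous; apply/derivable1_diffP.
  by have := fd x h1 h2; case.
rewrite in_itv/= => /andP[h1 h2] ->; rewrite normrM [`|b - a|]gtr0_norm ?subr_gt0//.
by apply: ler_wpM2r; [rewrite subr_ge0 ltW|apply: dL; exact: ltW].
Qed.

End Smoothstep.

(** * Absolute continuity and speed of curves *)

Section Curves.
Context {R : realType} {n : nat}.
Local Notation C := R[i].
Implicit Types (Omega : set 'rV[C]_n) (g : R -> 'rV[C]_n).

Lemma lipschitz_abs_continuous g (L : R) : 0 <= L ->
  (forall a b, 0 <= a -> a <= b -> b <= 1 -> enorm (g b - g a) <= L * (b - a)) ->
  abs_continuous g.
Proof.
move=> L0 gL e e0; have L1 : 0 < L + 1 by lra.
exists (e / (L + 1)); first by rewrite divr_gt0.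
move=> N a b ab _; rewrite ltr_pdivlMr// => sd.
have sL : \sum_(k < N) enorm (g (b k) - g (a k)) <= \sum_(k < N) L * (b k - a k).
  by apply: ler_sum => k _; have [h1 h2 h3] := ab k; exact: gL.
apply: le_lt_trans sL _; rewrite -mulr_sumr; apply: le_lt_trans sd; rewrite mulrC.
have s0 : 0 <= \sum_(k < N) (b k - a k).
  by rewrite sumr_ge0// => k _; have [_ h _] := ab k; rewrite subr_ge0.
by rewrite ler_wpM2l// lerDl.
Qed.

Lemma kobayashi_royden_ge0 Omega z v : (0 <= kobayashi_royden Omega z v)%E.
Proof.
by apply: le_ereal_inf_tmp => _ [r [r0 _] <-]; rewrite lee_fin invr_ge0 ltW.
Qed.

(** The affine disc y -> z + y v competes in the infimum. *)
Lemma kobayashi_royden_linear Omega z v (r : R) : 0 < r ->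
  (forall y, normc y < r -> Omega (z + y *: v)) ->
  (kobayashi_royden Omega z v <= (r^-1)%:E)%E.
Proof.
move=> r0 H; apply: ereal_inf_lbound; exists r => //; split => //.
have D (y : C) k : is_derive y 1 (fun y : C => (z + y *: v) 0 k) (v 0 k).
  apply: cderiv_is_derive.
  rewrite (_ : (fun y => _) = (fun y => z 0 k + y * v 0 k)); last first.
    by apply/funext => x; rewrite !mxE.
  have := cderivD (cderiv_cst (z 0 k) y) (cderivM (cderiv_id y) (cderiv_cst (v 0 k) y)).
  by rewrite mulr0 mul1r addr0 add0r.
exists (fun y => z + y *: v); split.
- move=> y; rewrite norm_normc ltcR => yr; split; first exact: H.
  by move=> k; have := D y k; case.
- by rewrite scale0r addr0.
by move=> k; rewrite derive1E; have d := D 0 k; rewrite derive_val.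
Qed.

End Curves.

Section CurveInPlane.
Context {R : realType}.
Local Notation C := R[i].
Variables (Omega : set 'rV[C]_2) (p X eta : 'rV[C]_2).
Hypotheses (XX : herm X X = 1) (ee : herm eta eta = 1) (Xe : herm X eta = 0).
Local Notation pt := (pt p X eta).
Local Notation Om := (Om Omega p X eta).

Lemma enorm_coord x w : enorm (x *: X + w *: eta) <= normc x + normc w.
Proof.
rewrite -(@ler_pXn2r _ 2) ?nnegrE ?sqrtr_ge0 ?addr_ge0 ?normc_ge0//.
rewrite enorm_sqr (rdot_coord XX ee Xe).
have -> : complex.Re (x * x^* + w * w^*) = normc x ^+ 2 + normc w ^+ 2.
  by rewrite !normc_sqr; case: x => a b; case: w => c d /=; ring.
by have := mulr_ge0 (normc_ge0 x) (normc_ge0 w); rewrite sqrrD mulr2n; lra.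
Qed.

Lemma pt_sub x w y u : pt x w - pt y u = (x - y) *: X + (w - u) *: eta.
Proof. by apply/rowP => j; rewrite !mxE; ring. Qed.

Lemma velocity_pt (c : C) (f g : R -> R) (t f' g' : R) :
  is_derive t 1 f f' -> is_derive t 1 g g' ->
  velocity (fun t => pt (c * (f t)%:C) (g t)%:C) t = (c * f'%:C) *: X + (g'%:C) *: eta.
Proof.
move=> df dg; apply/rowP => j; rewrite mxE.
have lin (a b d : R) : is_derive t 1 (fun u => a + (b * f u + d * g u)) (b * f' + d * g').
  have h := is_deriveD (is_derive_cst a t 1) (is_deriveD (is_deriveZ b df) (is_deriveZ d dg)).
  by apply: (is_derive_eq h); rewrite add0r.
have -> : (fun u => complex.Re (pt (c * (f u)%:C) (g u)%:C 0 j)) =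
  (fun u => complex.Re (p 0 j) + (complex.Re (c * X 0 j) * f u + complex.Re (eta 0 j) * g u)).
  apply/funext => u; rewrite !mxE; case: c => c1 c2; case: (X 0 j) => x1 x2.
  by case: (eta 0 j) => e1 e2; case: (p 0 j) => p1 p2 /=; ring.
have -> : (fun u => complex.Im (pt (c * (f u)%:C) (g u)%:C 0 j)) =
  (fun u => complex.Im (p 0 j) + (complex.Im (c * X 0 j) * f u + complex.Im (eta 0 j) * g u)).
  apply/funext => u; rewrite !mxE; case: c => c1 c2; case: (X 0 j) => x1 x2.
  by case: (eta 0 j) => e1 e2; case: (p 0 j) => p1 p2 /=; ring.
rewrite !derive1E.
have d1 := lin (complex.Re (p 0 j)) (complex.Re (c * X 0 j)) (complex.Re (eta 0 j)).
have d2 := lin (complex.Im (p 0 j)) (complex.Im (c * X 0 j)) (complex.Im (eta 0 j)).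
rewrite (@derive_val _ _ _ _ _ _ _ d1) (@derive_val _ _ _ _ _ _ _ d2) !mxE.
case: c {d1 d2} => c1 c2; case: (X 0 j) => x1 x2; case: (eta 0 j) => e1 e2 /=.
by apply/eqP; rewrite eq_complex /=; apply/andP; split; apply/eqP; ring.
Qed.

End CurveInPlane.

(** * The rate of descent *)

Section Rate.
Context {R : realType}.

(** The loss of the logarithm of the height per block, the heights of consecutive blocks having
    ratio 7/8. *)
Definition rate : R := - ln (7 / 8).

Lemma rate_bounds : 1 / 8 <= rate /\ rate <= 1 / 7.
Proof.
have s1 : ln (7 / 8) <= - (1 / 8) :> R.
  have := @le_ln1Dx R (- (1 / 8)) _; rewrite (_ : 1 + - (1 / 8) = 7 / 8); last by lra.
  by apply; lra.
have s2 : ln (8 / 7) <= 1 / 7 :> R.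
  have := @le_ln1Dx R (1 / 7) _; rewrite (_ : 1 + (1 / 7) = 8 / 7); last by lra.
  by apply; lra.
have s3 : ln (8 / 7) = rate.
  rewrite (_ : 8 / 7 = (7 / 8)^-1 :> R); last by rewrite invf_div.
  by rewrite lnV// posrE; lra.
by split; [rewrite /rate; lra|rewrite -s3].
Qed.

Lemma expR_rate k : expR (- rate * k%:R) = (7 / 8) ^+ k.
Proof. by rewrite expRM_natr opprK lnK// posrE; lra. Qed.

Lemma is_derive_scaled (f : R -> R) (a t d : R) : is_derive (a * t) 1 f d ->
  is_derive t 1 (fun t => f (a * t)) (a * d).
Proof.
move=> fd; have e : is_derive t 1 (fun t => a * t) a.
  by have hh := is_deriveZ a (is_derive_id t 1); apply: (is_derive_eq hh); rewrite /GRing.scale/= mulr1.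
by apply: (is_derive_eq (is_derive1_comp fd e)); rewrite mulrC.
Qed.

End Rate.

(** * The descending curve that crosses the segment *)

Section SlowCurve.
Context {R : realType}.
Local Notation C := R[i].
Variables (Omega : set 'rV[C]_2) (p X eta : 'rV[C]_2).
Hypotheses (XX : herm X X = 1) (ee : herm eta eta = 1) (Xe : herm X eta = 0).
Hypotheses (Oo : open Omega) (Occ : C_convex Omega).
Local Notation pt := (pt p X eta).
Local Notation Om := (Om Omega p X eta).
Variables (c : C) (h : R -> R) (r0 : R).
Hypotheses (disc_x : forall (u r : R) y, 0 <= u -> u <= 1 -> 0 < r -> r < r0 ->
     normc y < h r -> Om (c * u%:C + y) r%:C)
  (disc_w : forall (u r : R) y, 0 <= u -> u <= 1 -> 0 < r -> r < r0 ->
     normc y < r / 2 -> Om (c * u%:C) (r%:C + y))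
  (lower : forall x1 x2 (r1 r2 : R), 0 < r1 -> r1 <= r2 -> r2 < r0 ->
     Om x1 r1%:C -> Om x2 r2%:C ->
     (((ln r2 - ln r1) / 16)%:E <= kobayashi Omega (pt x2 r2%:C) (pt x1 r1%:C))%E).
Variables (rho : R) (N : nat) (rk : nat -> R).
Hypotheses (rho_gt0 : 0 < rho) (rho_lt : rho < r0) (N_gt0 : (0 < N)%N)
  (rk_lo : forall k, rho * (7 / 8) ^+ k.+1 <= rk k)
  (rk_hi : forall k, rk k <= rho * (7 / 8) ^+ k)
  (h_gt0 : forall k, 0 < h (rk k))
  (h_sum : normc c + 1 <= \sum_(k < N) h (rk k)).

Let T : R := \sum_(k < N) h (rk k).
Let theta k : R := h (rk k) / T.
Local Notation sigma := (@rate R).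

(** The product N t counts blocks. Block k receives the share [theta k] of the way across,
    proportional to the radius available there, while the logarithm of the height descends at
    constant speed. *)
Definition transverse (t : R) : R := steps theta N (N%:R * t).
Definition height (t : R) : R := rho * expR (- sigma * (N%:R * t)).
Definition slow_curve (t : R) : 'rV[C]_2 := pt (c * (transverse t)%:C) (height t)%:C.

Lemma T_gt0 : 0 < T.
Proof. by apply: lt_le_trans h_sum; have := normc_ge0 c; lra. Qed.

Lemma theta_ge0 k : 0 <= theta k.
Proof. by rewrite /theta divr_ge0 ?ltW// T_gt0. Qed.

Lemma theta_sum : \sum_(k < N) theta k = 1.
Proof. by rewrite -mulr_suml divff// gt_eqF// T_gt0. Qed.

Lemma height_gt0 t : 0 < height t.
Proof. by rewrite mulr_gt0// expR_gt0. Qed.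

Lemma height_anti t1 t2 : t1 <= t2 -> height t2 <= height t1.
Proof.
move=> t12; have [s0 _] := @rate_bounds R.
rewrite /height ler_pM2l// ler_expR; apply: ler_wnM2l; first lra.
by rewrite ler_wpM2l.
Qed.

Lemma height0 : height 0 = rho.
Proof. by rewrite /height !mulr0 expR0 mulr1. Qed.

Lemma height_le t : 0 <= t -> height t <= rho.
Proof. by move=> t0; rewrite -height0; exact: height_anti. Qed.

Lemma ln_height t : ln (height t) = ln rho - sigma * (N%:R * t).
Proof. by rewrite lnM ?posrE ?expR_gt0// expRK mulNr. Qed.

Lemma transverse01 t : 0 <= transverse t /\ transverse t <= 1.
Proof.
have /andP[h1 h2] := steps_bound N theta_ge0 (N%:R * t); split => //.
by rewrite -theta_sum.
Qed.

Lemma transverse0 : transverse 0 = 0.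
Proof. by rewrite /transverse mulr0 steps0. Qed.

Lemma transverse1 : transverse 1 = 1.
Proof. by rewrite /transverse mulr1 stepsN theta_sum. Qed.

Lemma is_derive_transverse (t : R) : is_derive t (1 : R) transverse (N%:R * dsteps theta N (N%:R * t)).
Proof. by apply: is_derive_scaled; exact: is_derive_steps. Qed.

Lemma is_derive_height (t : R) : is_derive t (1 : R) height (- (sigma * N%:R * height t)).
Proof.
have e := is_derive_scaled (is_derive_expR (- sigma * (N%:R * t))).
have e2 := is_deriveZ rho (is_derive_scaled e).
by apply: (is_derive_eq e2); rewrite /height /GRing.scale/=; ring.
Qed.

(* While the height runs through the k-th block, only the k-th step moves
   sideways, at a speed comparable to the width h (rk k) of the domain there. *)
Lemma slow_curve_disc t y : 0 <= t -> t <= 1 -> normc y < (7 * N%:R)^-1 ->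
  Omega (slow_curve t + y *: velocity slow_curve t).
Proof.
move=> t0 t1 yN; have N0 : 0 < N%:R :> R by rewrite ltr0n.
rewrite (velocity_pt _ _ _ _ (is_derive_transverse t) (is_derive_height t)).
have [u0 u1] := transverse01 t.
have Nt0 : 0 <= N%:R * t by rewrite mulr_ge0// ltW.
have NtN : N%:R * t <= N%:R by rewrite ler_piMr// ltW.
have [k [kN kt tk]] := unit_block N_gt0 Nt0 NtN.
have /andP[d0 dk] := dsteps_bound theta_ge0 kN kt tk.
have [s0 s1] := @rate_bounds R.
have lo : rho * (7 / 8) ^+ k.+1 <= height t.
  by rewrite -expR_rate /height ler_pM2l// ler_expR; apply: ler_wnM2l => //; lra.
have hi : height t <= rho * (7 / 8) ^+ k.
  by rewrite -expR_rate /height ler_pM2l// ler_expR; apply: ler_wnM2l => //; lra.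
have := rk_lo k; have := rk_hi k; have hk := h_gt0 k.
have A0 : 0 < rho * (7 / 8) ^+ k by rewrite mulr_gt0// exprn_gt0//; lra.
have Ar : rho * (7 / 8) ^+ k <= rho.
  by rewrite ler_piMr ?(ltW rho_gt0)// exprn_ile1//; lra.
move: lo; rewrite exprS mulrCA.
move: (rho * _) A0 Ar hi => A A0 Ar hi lo rhi rlo.
have r00 : 0 < rk k by lra.
have rlt : rk k < r0 by have := rho_lt; lra.
rewrite -pt_line -/(Om _ _).
(* The diamond is centred at height rk k rather than at the curve, at the same point of the segment;
   its half-axes are h (rk k) and rk k / 2. *)
have -> : (height t)%:C + y * (- (sigma * N%:R * height t))%:C =
   (rk k)%:C + ((height t - rk k)%:C + y * (- (sigma * N%:R * height t))%:C) :> C.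
  by rewrite addrA -rmorphD subrKC.
have nb : 0 < rk k / 2 by lra.
apply: (diamond (@Om_open R Omega p X eta Oo) (@Om_lines R Omega p X eta XX ee Xe Occ) hk nb).
- by move=> y' y'h; exact: disc_x.
- by move=> y' y'h; exact: disc_w.
rewrite !normcM !normcR.
have ny := normc_ge0 y.
have yN7 : normc y * N%:R < 1 / 7.
  by rewrite -ltr_pdivlMr// mul1r -invfM.
have yN0 : 0 <= normc y * N%:R by rewrite mulr_ge0// ltW.
have e1 : normc y * (normc c * `|N%:R * dsteps theta N (N%:R * t)|) / h (rk k) <= 2 / 7.
  rewrite ger0_norm ?mulr_ge0 ?(ltW N0)// ler_pdivrMr//.
  (* As the total width T is at least |c|, the part |c| theta k of the way is at most h (rk k). *)
  have cT : normc c * (2 * theta k) <= 2 * h (rk k).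
    rewrite /theta mulrCA ler_pM2l// mulrCA ler_piMr ?(ltW hk)// ler_pdivrMr ?T_gt0// mul1r.
    by have := h_sum; rewrite -/T; lra.
  have cd : normc c * dsteps theta N (N%:R * t) <= 2 * h (rk k).
    by apply: le_trans cT; rewrite ler_wpM2l// normc_ge0.
  rewrite (mulrCA (normc c)) [normc y * _]mulrA.
  apply: le_trans (_ : 1 / 7 * (2 * h (rk k)) <= _); last by lra.
  apply: le_trans (_ : normc y * N%:R * (2 * h (rk k)) <= _); first by rewrite ler_wpM2l.
  by rewrite ler_wpM2r ?(ltW yN7)// mulr_ge0// ltW.
(* Both the height and rk k lie in [7 A / 8, A], so they differ by at most A / 8; the vertical
   velocity adds at most A / 49. *)
have e2 : normc ((height t - rk k)%:C + y * (- (sigma * N%:R * height t))%:C) / (rk k / 2) <= 3 / 7.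
  rewrite ler_pdivrMr//; apply: le_trans (le_normcD _ _) _.
  rewrite normcM !normcR normrN.
  have b1 : `|height t - rk k| <= A / 8 by rewrite ler_norml; apply/andP; split; lra.
  have b2 : normc y * `|sigma * N%:R * height t| <= A / 49.
    rewrite ger0_norm; last by rewrite !mulr_ge0 ?(ltW N0) ?(ltW (height_gt0 _))//; lra.
    rewrite -mulrA [normc y * _]mulrCA [normc y * _]mulrA mulrA.
    have b3 : sigma * (normc y * N%:R) <= 1 / 7 * (1 / 7).
      by apply: ler_pM => //; [lra|exact: ltW].
    apply: le_trans (_ : 1 / 7 * (1 / 7) * height t <= _); last lra.
    by rewrite ler_wpM2r// ltW// height_gt0.
  lra.
lra.
Qed.

Lemma slow_curve_in t : 0 <= t -> t <= 1 -> Omega (slow_curve t).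
Proof.
move=> t0 t1; have := slow_curve_disc (y := 0) t0 t1.
by rewrite scale0r addr0 normc0; apply; rewrite invr_gt0 mulr_gt0 ?ltr0n//; lra.
Qed.

Lemma slow_curve_speed t : 0 <= t -> t <= 1 ->
  (kobayashi_royden Omega (slow_curve t) (velocity slow_curve t) <= (7 * N%:R)%:E)%E.
Proof.
move=> t0 t1; rewrite -[7 * N%:R]invrK; apply: kobayashi_royden_linear.
  by rewrite invr_gt0 mulr_gt0 ?ltr0n//; lra.
by move=> y yN; exact: slow_curve_disc.
Qed.

Lemma slow_curve_length t1 t2 : 0 <= t1 -> t1 <= t2 -> t2 <= 1 ->
  (kobayashi_length Omega slow_curve t1 t2 <= (7 * N%:R * (t2 - t1))%:E)%E.
Proof.
move=> t10 t12 t21; apply: le_trans (@integral_le_cst _ _ _ (7 * N%:R) _ _ _) _.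
- exact: measurable_itv.
- by move=> t _; exact: kobayashi_royden_ge0.
- move=> t /=; rewrite in_itv/= => /andP[h1 h2].
  by apply: slow_curve_speed; [exact: le_trans h1|exact: le_trans t21].
rewrite lebesgue_measure_itv/= lte_fin; case: ifP => h0; first by rewrite -EFinB -EFinM.
by rewrite mule0 lee_fin mulr_ge0 ?subr_ge0// mulr_ge0// ler0n.
Qed.

(** Only the drop in height counts: its logarithm falls by rate * N (t2 - t1) with rate >= 1/8, and
    128 = 8 * 16. *)
Lemma slow_curve_far t1 t2 : 0 <= t1 -> t1 <= t2 -> t2 <= 1 ->
  ((N%:R * (t2 - t1) / 128)%:E <= kobayashi Omega (slow_curve t1) (slow_curve t2))%E.
Proof.
move=> t10 t12 t21.
have t20 : 0 <= t2 by exact: le_trans t12.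
have t11 : t1 <= 1 by exact: le_trans t21.
have hr : height t1 < r0 by apply: le_lt_trans (height_le t10) rho_lt.
have := lower (height_gt0 t2) (height_anti t12) hr (slow_curve_in t20 t21) (slow_curve_in t10 t11).
apply: le_trans; rewrite lee_fin !ln_height.
have [s0 _] := @rate_bounds R; have N0 : 0 <= N%:R * (t2 - t1) by rewrite mulr_ge0// subr_ge0.
have : 1 / 8 * (N%:R * (t2 - t1)) <= @rate R * (N%:R * (t2 - t1)) by rewrite ler_wpM2r.
by move: (@rate R) (ln rho) {s0} => x y; lra.
Qed.

Lemma slow_curve_ac : abs_continuous slow_curve.
Proof.
have N0 : 0 < N%:R :> R by rewrite ltr0n.
apply: (@lipschitz_abs_continuous _ _ _ (normc c * (2 * N%:R) + N%:R * rho)).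
  by rewrite addr_ge0// mulr_ge0 ?normc_ge0 ?(ltW rho_gt0) ?(ltW N0)// mulr_ge0// ltW.
move=> a b a0 ab b1; rewrite /slow_curve pt_sub.
apply: le_trans (enorm_coord XX ee Xe _ _) _.
rewrite -mulrBr -!rmorphB normcM !normcR mulrDl; apply: lerD.
  rewrite -mulrA ler_wpM2l ?normc_ge0//.
  apply: (lipschitz_of_derive ab (fun t _ _ => is_derive_transverse t)) => t at' tb.
  have t0 : 0 <= t by exact: le_trans at'.
  have t1 : t <= 1 by exact: le_trans b1.
  have Nt0 : 0 <= N%:R * t by rewrite mulr_ge0// ltW.
  have NtN : N%:R * t <= N%:R by rewrite ler_piMr// ltW.
  have [k [kN kt tk]] := unit_block N_gt0 Nt0 NtN.
  have /andP[d0 dk] := dsteps_bound theta_ge0 kN kt tk.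
  rewrite ger0_norm ?mulr_ge0 ?(ltW N0)// mulrC ler_wpM2r ?(ltW N0)//.
  apply: le_trans dk _; rewrite ler_piMr//.
  rewrite -theta_sum (bigD1 (Ordinal kN))//= lerDl sumr_ge0// => j _; exact: theta_ge0.
apply: (lipschitz_of_derive ab (fun t _ _ => is_derive_height t)) => t at' tb.
have t0 : 0 <= t by exact: le_trans at'.
have [s0 s1] := @rate_bounds R; have hh := height_gt0 t; have hl := height_le t0.
rewrite normrN ger0_norm; last by rewrite !mulr_ge0 ?(ltW N0) ?(ltW hh)//; lra.
apply: ler_pM => //; first by rewrite mulr_ge0 ?(ltW N0)//; lra.
  exact: ltW.
by rewrite ler_piMl ?(ltW N0)//; lra.
Qed.

(* 896 = 7 * 128, the quotient of the rates in the two estimates above. *)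
Lemma slow_curve_geodesic : geodesic Omega 896 0 slow_curve.
Proof.
split; first exact: slow_curve_ac.
  by move=> t /=; rewrite in_itv/= => /andP[]; exact: slow_curve_in.
move=> t1 t2 t10 t12 t21; rewrite adde0.
apply: le_trans (slow_curve_length t10 t12 t21) _.
apply: le_trans (_ : 896%:E * (N%:R * (t2 - t1) / 128)%:E <= _)%E.
  by rewrite -EFinM lee_fin; lra.
by apply: lee_wpmul2l; [rewrite lee_fin; lra|exact: slow_curve_far].
Qed.

End SlowCurve.

(** * Geometry of the domain along the segment, and the sequence of geodesics *)

Section Segment.
Context {R : realType}.
Local Notation C := R[i].
Variables (Omega : set 'rV[C]_2) (p X : 'rV[C]_2) (S : set 'rV[C]_2)
  (delta : R) (H : R -> R).
Hypotheses (Oo : open Omega) (unit_X : enorm X = 1)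
  (tangent_X : complex_tangent_dir Omega p X)
  (segment_S : line_segment S)
  (sub_S : S `<=` complex_tangent_space Omega p `&` boundary Omega)
  (S_p : S p)
  (C1_S : forall s, S s -> C1_smooth_boundary_at Omega s)
  (tangent_S : forall s, S s -> real_tangent_space Omega p = real_tangent_space Omega s)
  (delta_gt0 : 0 < delta)
  (H_le : forall s r, S s -> 0 < r -> r < delta ->
     ((H r)%:E <= dir_bdist Omega (inner_shift Omega s r) X)%E).

Local Notation eta := (inner_unit_normal Omega p).

Lemma boundary_notin z : boundary Omega z -> ~ Omega z.
Proof. by move=> [_ ni] Oz; apply: ni; apply: open_nbhs_nbhs. Qed.

Lemma dir_bdist_in z v (r : R) : (r%:E <= dir_bdist Omega z v)%E -> Omega z.
Proof.
move=> h; have : (-oo < dir_bdist Omega z v)%E by apply: lt_le_trans h; rewrite ltNyr.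
move=> /ereal_sup_gt[_ [d [d0 dE] _] _].
by have := dE 0; rewrite scale0r addr0; apply; rewrite normr0 ltcR.
Qed.

Lemma dir_bdist_disc z v (r : R) y : (r%:E <= dir_bdist Omega z v)%E -> normc y < r ->
  Omega (z + y *: v).
Proof.
move=> h yr; have : ((normc y)%:E < dir_bdist Omega z v)%E by apply: lt_le_trans h; rewrite lte_fin.
move=> /ereal_sup_gt[_ [d [d0 dE] <-]]; rewrite lte_fin => yd.
by apply: dE; rewrite norm_normc ltcR.
Qed.

(** Without a normal the default value 0 would make s_r equal to s, and the bound by [H] would place
    the boundary point s in the domain. *)
Lemma normalP s : S s -> is_inner_unit_normal Omega s (inner_unit_normal Omega s).
Proof.
move=> Ss; have [_ bs] := sub_S Ss.
case: (pselect (exists e, is_inner_unit_normal Omega s e)) => [[e eE]|no].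
  by apply: (@xgetPex _ 0 [set e | is_inner_unit_normal Omega s e]); exists e.
exfalso; apply: (boundary_notin bs).
have d2 : 0 < delta / 2 by rewrite divr_gt0.
have d3 : delta / 2 < delta by rewrite ltr_pdivrMr// ltr_pMr// ltr1n.
have := dir_bdist_in (H_le Ss d2 d3); rewrite /inner_shift /inner_unit_normal xgetPN.
  by rewrite scaler0 addr0.
by move=> e eE; apply: no; exists e.
Qed.

Lemma XX : herm X X = 1. Proof. exact: herm_unit. Qed.

Lemma ee : herm eta eta = 1.
Proof. by have [e1 _ _] := normalP S_p; exact: herm_unit. Qed.

(** Writing u = i v, the real products of v and of i v with eta vanish: these are the real part of
    the Hermitian product of v with eta and the opposite of its imaginary part. *)
Lemma complex_tangent_perp u : complex_tangent_dir Omega p u -> herm u eta = 0.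
Proof.
move=> [Fu [v Fv vu]]; have [_ nperp _] := normalP S_p.
have := nperp _ Fu; have := nperp _ Fv; rewrite !rdotE -vu hermZl.
case: (herm v eta) => a b /= -> /eqP; rewrite mul0r add0r mul1r oppr_eq0 => /eqP ->.
by simpc.
Qed.

Lemma Xe : herm X eta = 0. Proof. exact: complex_tangent_perp. Qed.

Lemma segment_coord s : S s -> exists c, s = p + c *: X.
Proof.
move=> /sub_S[[u Fu <-] _]; exists (herm u X).
by rewrite {1}(orthonormal_decomp XX ee Xe u) complex_tangent_perp// scale0r addr0.
Qed.

Lemma tangent_dir_p x w : real_tangent_dir Omega p (x *: X + w *: eta) <-> complex.Re w = 0.
Proof.
have eE : eta = 0 *: X + 1 *: eta by rewrite scale0r add0r scale1r.
have [_ bp] := sub_S S_p.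
have [h _] := tangent_dirP XX ee Xe (C1_S S_p) (normalP S_p) eE bp.
by rewrite h rmorph0 rmorph1 mulr0 add0r mulr1.
Qed.

Lemma tangent_dir_s s x w : S s -> complex.Re w = 0 ->
  real_tangent_dir Omega s (x *: X + w *: eta).
Proof.
move=> Ss w0; have [c sE] := segment_coord Ss.
have : real_tangent_space Omega p (s + (x *: X + w *: eta)).
  exists ((c + x) *: X + w *: eta); first exact/tangent_dir_p.
  by rewrite sE scalerDl !addrA.
by rewrite (tangent_S Ss) => -[v Fv /addrI <-].
Qed.

(** Equality of the tangent spaces makes X, i X and i eta tangent at s, which leaves a real multiple
    of eta. The orientation is not decided here. *)
Lemma normal_sign s : S s -> exists2 e : R, e ^+ 2 = 1 & inner_unit_normal Omega s = e%:C *: eta.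
Proof.
move=> Ss; have [n1 nperp _] := normalP Ss.
have := orthonormal_decomp XX ee Xe (inner_unit_normal Omega s).
set es := inner_unit_normal Omega s in n1 nperp *.
move: (herm es X) (herm es eta) => x0 w0 esE.
have R0 x w : complex.Re w = 0 -> complex.Re (x * x0^* + w * w0^*) = 0.
  by move=> w00; rewrite -(rdot_coord XX ee Xe) -esE; apply: nperp; exact: tangent_dir_s.
have h1 := R0 1 0 erefl; have h2 := R0 'i 0 erefl; have h3 := R0 0 'i erefl.
have : complex.Re (x0 * x0^* + w0 * w0^*) = 1.
  by rewrite -(rdot_coord XX ee Xe) -esE -enorm_sqr n1 expr1n.
move: esE h1 h2 h3; case: x0 {R0} => a b; case: w0 => c d esE /= h1 h2 h3 h4.
have a0 : a = 0 by lra.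
have b0 : b = 0 by lra.
have d0 : d = 0 by lra.
exists c; first by rewrite -h4 a0 b0 d0; ring.
by rewrite esE a0 b0 d0 [_ +i* 0]complexr0 scale0r add0r.
Qed.

(** Strict differentiability at s serves all base points of [S] near s at once: rho vanishes there
    and changes by at most k e (|x| + |w|) - k Re w < 0. *)
Lemma local_cone s (e : R) : S s -> inner_unit_normal Omega s = eta -> 0 < e ->
  exists2 d : R, 0 < d & forall z x w, S z -> rv_ball s d z ->
    normc x < d -> normc w < d -> e * (normc x + normc w) < complex.Re w ->
    Omega (z + x *: X + w *: eta).
Proof.
move=> Ss es e0; have [_ bs] := sub_S Ss.
have eE : eta = 0 *: X + 1 *: eta by rewrite scale0r add0r scale1r.
have ns := normalP Ss; rewrite es in ns.
have [_ h] := tangent_dirP XX ee Xe (C1_S Ss) ns eE bs.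
have [rho hrho] := C1_S Ss; have [k k0 kE] := h _ hrho.
have [U [Uo Us C1 nz HU]] := hrho.
have [d d0 dE] := strict_diff_coord X eta Uo C1 Us (mulr_gt0 k0 e0).
exists d => // z x w Sz zs xd wd ew.
have [Uz Ez] := dE z x w zs xd wd.
have d0' : normc (0 : C) < d by rewrite normc0.
have [Uz0 _] := dE z 0 0 zs d0' d0'.
rewrite !scale0r !addr0 in Uz0.
have [_ bz] := sub_S Sz.
have r0 : rho z = 0 by apply/(HU _ Uz0).2.
apply/(HU _ Uz).1; move: Ez; rewrite r0 subr0 kE rmorph0 rmorph1 mulr0 add0r mulr1.
rewrite ler_norml => /andP[_ h2].
have : k * (e * (normc x + normc w)) < k * complex.Re w by rewrite ltr_pM2l.
rewrite mulrA; lra.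
Qed.

(** If the normal at a nearby z in [S] were opposite to the one at s, the differential at s would
    make rho positive at points z + t n_z, n_z being the normal at z, that lie in the domain. *)
Lemma normal_local_cst s : S s -> exists2 d : R, 0 < d & forall z, S z -> rv_ball s d z ->
  inner_unit_normal Omega z = inner_unit_normal Omega s.
Proof.
move=> Ss; have [_ bs] := sub_S Ss.
have [c c2 cE] := normal_sign Ss.
have eE : inner_unit_normal Omega s = 0 *: X + c%:C *: eta by rewrite scale0r add0r.
have [_ h] := tangent_dirP XX ee Xe (C1_S Ss) (normalP Ss) eE bs.
have [rho hrho] := C1_S Ss; have [k k0 kE] := h _ hrho.
have [U [Uo Us C1 nz HU]] := hrho.
have k2 : 0 < k / 2 by lra.
have [d d0 dE] := strict_diff_coord X eta Uo C1 Us k2.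
exists d => // z Sz zs.
have [f f2 fE] := normal_sign Sz; have [_ _ [r /= r0 rE]] := normalP Sz.
have d0' : normc (0 : C) < d by rewrite normc0.
have [Uz0 _] := dE z 0 0 zs d0' d0'.
rewrite !scale0r !addr0 in Uz0.
have [_ bz] := sub_S Sz.
have rz0 : rho z = 0 by apply/(HU _ Uz0).2.
pose t := Num.min r d / 2.
have m0 : 0 < Num.min r d by rewrite lt_min r0.
have [m1 m2] : Num.min r d <= r /\ Num.min r d <= d by rewrite !ge_min !lexx orbT.
have t0 : 0 < t by rewrite /t; lra.
have Ot : Omega (z + t%:C *: inner_unit_normal Omega z).
  by apply: rE => //=; rewrite sub0r normrN gtr0_norm// /t; lra.
have nf : normc (t%:C * f%:C) = t.
  rewrite normcM !normcR gtr0_norm//.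
  suff -> : `|f| = 1 by rewrite mulr1.
  by apply/eqP; rewrite -(@eqrXn2 _ 2)// real_normK ?num_real// f2 expr1n.
have td : normc (t%:C * f%:C) < d by rewrite nf /t; lra.
have := dE z 0 _ zs d0' td; rewrite scale0r addr0 -scalerA -fE => -[Ut].
have : rho (z + t%:C *: inner_unit_normal Omega z) < 0 by apply/(HU _ Ut).1.
rewrite rz0 subr0 kE rmorph0 mulr0 add0r nf normc0 add0r.
have -> : complex.Re (t%:C * f%:C * c%:C^*) = t * (f * c) by move=> /=; ring.
rewrite ler_norml => h1 /andP[h2 _].
have : (f * c - 1) * (f * c + 1) = 0 by rewrite -subr_sqr expr1n exprMn f2 c2; ring.
move=> /eqP; rewrite mulf_eq0 => /orP[/eqP fc|/eqP fc].
  have : f = c.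
    by rewrite -[f]mulr1 -c2 expr2 mulrA (_ : f * c = 1) ?mul1r//; apply/eqP; rewrite -subr_eq0 fc.
  by rewrite fE cE => ->.
have fc1 : f * c = - 1 by lra.
exfalso; have kt := mulr_gt0 k0 t0; move: h1 h2 kt; rewrite fc1.
by move: (rho _) => q; lra.
Qed.

Lemma segment_rv_ball (a b : 'rV[C]_2) (t : R) (d : R) : 0 < d ->
  \forall u \near t, rv_ball (a + t%:C *: (b - a)) d (a + u%:C *: (b - a)).
Proof.
move=> d0.
have cu : (fun u : R => u%:C) @ nbhs t --> t%:C by apply: cvgRc; exact: cvg_id.
have cv : (fun u : R => u%:C *: (b - a)) @ nbhs t --> t%:C *: (b - a) by apply: cvg_rVZ; exact: cu.
have ca : (fun _ : R => a) @ nbhs t --> a by exact: cvg_cst.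
have cz : (fun u : R => a + u%:C *: (b - a)) @ nbhs t --> a + t%:C *: (b - a).
  exact: (cvg_rVD ca cv).
have nd : nbhs (a + t%:C *: (b - a)) [set z | rv_ball (a + t%:C *: (b - a)) d z].
  by apply/near_rV; exists d.
exact: (cz _ nd).
Qed.

Lemma normal_cst s : S s -> inner_unit_normal Omega s = eta.
Proof.
have [a [b [_ SE]]] := segment_S.
pose P (t : R) := inner_unit_normal Omega (a + t%:C *: (b - a)) = eta.
have SI t : `[(0 : R), 1]%classic t -> S (a + t%:C *: (b - a)) by rewrite SE => t01; exists t.
have loc (t : R) : `[(0 : R), 1]%classic t -> \forall u \near t, `[(0 : R), 1]%classic u -> (P t <-> P u).
  move=> t01; have [d d0 dE] := normal_local_cst (SI _ t01).
  apply: filterS (segment_rv_ball a b t d0) => u ut u01.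
  by rewrite /P (dE _ (SI _ u01) ut); split.
have : S p by exact: S_p.
rewrite {1 2}SE => -[t t01 tE] [u u01 <-].
apply: (connected_ind (@segment_connected R 0 1) loc t01 u01).
by rewrite /P tE.
Qed.

(** Compactness of the parameter interval of the segment makes the size of the cones uniform. *)
Lemma uniform_cone (e : R) : 0 < e -> exists2 d : R, 0 < d & forall s x w, S s ->
  normc x < d -> normc w < d -> e * (normc x + normc w) < complex.Re w ->
  Omega (s + x *: X + w *: eta).
Proof.
move=> e0; have [a [b [_ SE]]] := segment_S.
have SI (t : R) : `[(0 : R), 1]%classic t -> S (a + t%:C *: (b - a)) by rewrite SE => t01; exists t.
pose P (d t : R) := `[(0 : R), 1]%classic t -> forall x w, normc x < d -> normc w < d ->
  e * (normc x + normc w) < complex.Re w -> Omega (a + t%:C *: (b - a) + x *: X + w *: eta).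
have /compact_near_coveringP cpt := @segment_compact R 0 1.
have : \forall d \near (0 : R)^'+, `[(0 : R), 1]%classic `<=` P d.
  apply: (cpt R (0 : R)^'+ P) => t t01.
  have [d d0 dE] := local_cone (SI _ t01) (normal_cst (SI _ t01)) e0.
  exists ([set u | rv_ball (a + t%:C *: (b - a)) d (a + u%:C *: (b - a))], [set c : R | c < d]).
    split; first exact: segment_rv_ball.
    by exact: nbhs_right_lt.
  move=> [u c]/= [ud cd] u01 x w xc wc.
  apply: dE => //; [exact: SI|exact: lt_trans cd|exact: lt_trans cd].
move=> [r /= r0 rE].
have r2 : 0 < r / 2 by lra.
exists (r / 2) => // s x w; rewrite SE => -[t t01 <-]; apply: (rE _ _ r2 _ t01) => //=.
by rewrite sub0r normrN gtr0_norm//; lra.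
Qed.

Hypotheses (Occ : C_convex Omega) (no_line : contains_no_complex_line Omega)
  (mH : measurable_fun `]0, delta[ H)
  (int_H : (\int[@lebesgue_measure R]_(r in `]0%R, delta[) (H r / r)%:E = +oo)%E).

Local Notation Om := (Om Omega p X eta).
Local Notation pt := (pt p X eta).

Lemma Om00 : ~ Om 0 0.
Proof.
have [_ bp] := sub_S S_p; rewrite /Om /pt !scale0r !addr0; exact: boundary_notin bp.
Qed.

Lemma Om_cone (e : R) : 0 < e -> exists2 d : R, 0 < d & forall x w,
  normc x < d -> normc w < d -> e * (normc x + normc w) < complex.Re w -> Om x w.
Proof.
by move=> /uniform_cone[d d0 dE]; exists d => // x w xd wd xw; exact: (dE p).
Qed.

Lemma segment_disc s (r : R) y : S s -> 0 < r -> r < delta -> normc y < H r ->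
  Omega (s + y *: X + r%:C *: eta).
Proof.
move=> Ss r0 rd yr; have := dir_bdist_disc (H_le Ss r0 rd) yr.
by rewrite /inner_shift (normal_cst Ss) addrAC.
Qed.

Lemma segment_inner s (r : R) : S s -> 0 < r -> r < delta -> Omega (s + r%:C *: eta).
Proof.
by move=> Ss r0 rd; have := dir_bdist_in (H_le Ss r0 rd); rewrite /inner_shift (normal_cst Ss).
Qed.

Lemma radius_bounded_segment (r1 : R) : 0 < r1 -> r1 < delta ->
  exists B, forall r, r1 <= r -> r < delta -> H r <= B.
Proof.
move=> r10 r1d.
apply: (radius_bounded (@Om_open R Omega p X eta Oo) (@Om_lines R Omega p X eta XX ee Xe Occ) r10 r1d).
- by move=> r r0 rd; rewrite /Om /pt scale0r addr0; exact: segment_inner.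
- by move=> r y r0 rd yH; exact: segment_disc.
move=> w Ow.
have X0 : X != 0.
  by apply/eqP => X0; move: unit_X; rewrite X0 enorm0 => /eqP; rewrite eq_sym oner_eq0.
apply: (no_line (a := p + w *: eta) X0) => _ [x _ <-].
by rewrite addrAC; exact: Ow.
Qed.

(** In the cone of aperture 1/4, |y| < r gives (|y| + r) / 4 < r, and |y| < r / 2 gives (r + |y|) /
    4 < r / 2 < Re (r + y). The bound d / 2 on r keeps these points within the range of the cone. *)
Lemma thin_height : exists r0 : R, [/\ 0 < r0, r0 <= delta,
  forall s (r : R) y, S s -> 0 < r -> r < r0 -> normc y < Num.max (H r) r ->
    Omega (s + y *: X + r%:C *: eta) &
  forall s (r : R) y, S s -> 0 < r -> r < r0 -> normc y < r / 2 ->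
    Omega (s + (r%:C + y) *: eta)].
Proof.
have e4 : 0 < 1 / 4 :> R by lra.
have [d d0 dE] := uniform_cone e4.
have [m1 m2] : Num.min delta (d / 2) <= delta /\ Num.min delta (d / 2) <= d / 2.
  by rewrite !ge_min !lexx orbT.
exists (Num.min delta (d / 2)); split => //.
- by rewrite lt_min delta_gt0 divr_gt0.
- move=> s r y Ss r0 rr; rewrite lt_max => /orP[yH|yr].
    by apply: segment_disc => //; exact: lt_le_trans m1.
  have nr : normc (r%:C : C) = r by rewrite normcR gtr0_norm.
  by apply: dE => //; rewrite ?nr /=; lra.
move=> s r y Ss r0 rr yr.
have n1 : normc (r%:C + y) <= r + normc y.
  by apply: le_trans (le_normcD _ _) _; rewrite normcR gtr0_norm.
have n2 : - normc y <= complex.Re y by have := normc_Re y; rewrite ler_norml => /andP[].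
have := dE s 0 (r%:C + y) Ss; rewrite scale0r addr0; apply.
- by rewrite normc0.
- lra.
- by rewrite normc0 add0r raddfD /=; lra.
Qed.

Lemma segment_between s c (u : R) : S s -> s = p + c *: X -> 0 <= u -> u <= 1 ->
  S (p + (c * u%:C) *: X).
Proof.
have [a [b [_ SE]]] := segment_S.
have : S p by exact: S_p.
rewrite SE => -[t0 /= + pE] [t1 /= + sE] sc u0 u1.
rewrite !in_itv/= => /andP[t00 t01] /andP[t10 t11].
exists (t0 + u * (t1 - t0)).
  by rewrite /= in_itv/=; apply/andP; split; nra.
have -> : (c * u%:C) *: X = u%:C *: (s - p) by rewrite sc addrAC subrr add0r scalerA mulrC.
rewrite -{1}pE -sE -pE opprD addrACA subrr add0r -scalerBl scalerA.
by rewrite rmorphD scalerDl addrA -rmorphB -rmorphM.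
Qed.

Lemma kobayashi_segment (r0 : R) x1 x2 (r1 r2 : R) :
  (forall r, 0 < r -> r < r0 -> Om 0 r%:C) ->
  0 < r1 -> r1 <= r2 -> r2 < r0 -> Om x1 r1%:C -> Om x2 r2%:C ->
  (((ln r2 - ln r1) / 16)%:E <= kobayashi Omega (pt x2 r2%:C) (pt x1 r1%:C))%E.
Proof.
move=> O0 r10 r12 r2r O1 O2.
have OmO := @Om_open R Omega p X eta Oo.
have OmL := @Om_lines R Omega p X eta XX ee Xe Occ.
have OmE z : Omega z -> Om (cx p X z) (cw p eta z) by rewrite /Om pt_cxw// ?XX ?ee ?Xe.
(* The square of the interval length a is put halfway between r2 and r0, as it has to be at least r2
   and below the range r0 of the positive axis. *)
have m0 : 0 < (r2 + r0) / 2 by lra.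
have a2 : Num.sqrt ((r2 + r0) / 2) ^+ 2 = (r2 + r0) / 2 by rewrite sqr_sqrtr// ltW.
have c1 := cw_pt p ee Xe x1 r1%:C; have c2 := cw_pt p ee Xe x2 r2%:C.
apply: (@kobayashi_lower R Omega p eta (fun z => branch Om (cx p X z) (cw p eta z))
   r0 (Num.sqrt ((r2 + r0) / 2)) _ _ _ _ _ _ _ _ r1 r2) => //.
- by move=> z /OmE Oz; exact: (branch_sqr OmO OmL Om_cone Om00 Oz).
- move=> z /OmE Oz; rewrite -sqrf_eq0 (branch_sqr OmO OmL Om_cone Om00 Oz).
  exact: (Om_w_neq0 OmO OmL Om_cone Om00 Oz).
- move=> z /OmE Oz; apply: (branch_cvg OmO OmL Om_cone Om00 _ _ Oz).
    by apply: cvg_cx; exact: cvg_id.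
  by apply: cvg_cw; exact: cvg_id.
- move=> z r Oz rr0 rr1 zr; have := OmE _ Oz; rewrite zr => Oz'.
  exact: (branch_real OmO OmL Om_cone Om00 O0 rr0 rr1 Oz').
- by rewrite sqrtr_gt0.
- by rewrite a2; lra.
- by rewrite a2; lra.
Qed.

(** However low the starting height is, divergence of the integral leaves enough total width below
    it to reach s; the factor 896 is not affected. *)
Lemma slow_geodesics s (rho' : R) : S s -> 0 < rho' -> exists g : R -> 'rV[C]_2,
  [/\ geodesic Omega 896 0 g,
      forall t, 0 <= t -> t <= 1 -> exists z (w : R),
        [/\ S z, 0 <= w, w <= rho' & g t = z + w%:C *: eta],
      exists w : R, [/\ 0 <= w, w <= rho' & g 0 = p + w%:C *: eta] &
      exists w : R, [/\ 0 <= w, w <= rho' & g 1 = s + w%:C *: eta]].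
Proof.
move=> Ss rho'0; have [c sE] := segment_coord Ss.
have [r0 [r00 r0d dx dw]] := thin_height.
pose rho := Num.min rho' (r0 / 2).
have rho0 : 0 < rho by rewrite lt_min rho'0 divr_gt0.
have [rho_le1 rho_le2] : rho <= rho' /\ rho <= r0 / 2 by rewrite !ge_min !lexx orbT.
have rho_lt : rho < r0 by lra.
(* The maximum is a positive radius dominating [H]; both radii are available by [thin_height]. *)
pose q : R := 7 / 8; pose h r := Num.max (H r) r.
have q0 : 0 < q by rewrite /q; lra.
have q1 : q < 1 by rewrite /q; lra.
have rq k : 0 < rho * q ^+ k by rewrite mulr_gt0// exprn_gt0.
have rq_le k : rho * q ^+ k <= rho by rewrite ler_piMr ?(ltW rho0)// exprn_ile1// ltW.
have /choice[rk rkE] : forall k, exists r, [/\ rho * q ^+ k.+1 <= r, r <= rho * q ^+ k, 0 < h r &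
    forall r', rho * q ^+ k.+1 <= r' -> r' <= rho * q ^+ k -> h r' <= 2 * h r].
  move=> k; have rk1 : rho * q ^+ k.+1 < delta by have := rq_le k.+1; lra.
  have [B HB] := radius_bounded_segment (rq k.+1) rk1.
  apply: (@near_max R h _ _ (Num.max B delta)).
  - by rewrite exprS mulrCA ler_piMl// ltW.
  - by rewrite lt_max rq orbT.
  move=> r h1 h2; have rd : r < delta by have := rq_le k; lra.
  by rewrite /h ge_max !le_max HB// (ltW rd) orbT.
(* Twice the chosen radius dominates [H] on the whole block. The summand 1 keeps the total width
   positive when c = 0. *)
have [N NE] : exists N, 2 * (normc c + 1) <= \sum_(k < N) (2 * h (rk k)).
  apply: (@block_sums_diverge R delta rho q H (fun k => 2 * h (rk k)) _ rho0 _ q0 q1 mH radius_bounded_segment int_H).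
  - by lra.
  - by move=> k; have [_ _ hk _] := rkE k; rewrite mulr_ge0// ltW.
  move=> k r h1 h2; have [_ _ _ hk] := rkE k.
  by apply: le_trans (hk r h1 h2); rewrite /h le_max lexx.
have NE' : normc c + 1 <= \sum_(k < N) h (rk k) by move: NE; rewrite -mulr_sumr; lra.
have N0 : (0 < N)%N.
  by case: N NE' {NE} => //; rewrite big_ord0; have := normc_ge0 c; lra.
have disc_x (u r : R) y : 0 <= u -> u <= 1 -> 0 < r -> r < r0 -> normc y < h r ->
    Om (c * u%:C + y) r%:C.
  move=> u0 u1 rr0 rr1 yh; rewrite /Om /pt scalerDl addrA.
  by apply: dx => //; exact: segment_between sE u0 u1.
have disc_w (u r : R) y : 0 <= u -> u <= 1 -> 0 < r -> r < r0 -> normc y < r / 2 ->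
    Om (c * u%:C) (r%:C + y).
  move=> u0 u1 rr0 rr1 yh.
  by apply: dw => //; exact: segment_between sE u0 u1.
have O0 r : 0 < r -> r < r0 -> Om 0 r%:C.
  by move=> rr0 rr1; rewrite /Om /pt scale0r addr0; apply: segment_inner => //; lra.
have lower x1 x2 (r1 r2 : R) : 0 < r1 -> r1 <= r2 -> r2 < r0 -> Om x1 r1%:C -> Om x2 r2%:C ->
    (((ln r2 - ln r1) / 16)%:E <= kobayashi Omega (pt x2 r2%:C) (pt x1 r1%:C))%E.
  exact: kobayashi_segment.
have lo k : rho * (7 / 8) ^+ k.+1 <= rk k by have [] := rkE k.
have hi k : rk k <= rho * (7 / 8) ^+ k by have [] := rkE k.
have hk k : 0 < h (rk k) by have [] := rkE k.
have hgt (t : R) : 0 <= t -> 0 <= height rho N t /\ height rho N t <= rho'.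
  move=> t0; split; first by apply/ltW; exact: height_gt0.
  by apply: le_trans rho_le1; exact: height_le.
exists (slow_curve p X eta c h rho N rk); split.
- exact: (slow_curve_geodesic XX ee Xe Oo Occ disc_x disc_w lower rho0 rho_lt N0 lo hi hk NE').
- move=> t t0 t1; have [w0 w1] := hgt t t0.
  exists (p + (c * (transverse h N rk t)%:C) *: X), (height rho N t); split => //.
  have [u0 u1] := transverse01 hk NE' t.
  exact: segment_between sE u0 u1.
- have [w0 w1] := hgt 0 (lexx _); exists (height rho N 0); split => //.
  by rewrite /slow_curve transverse0 mulr0 /pt scale0r addr0.
have [w0 w1] := hgt 1 ler01; exists (height rho N 1); split => //.
by rewrite /slow_curve (transverse1 NE') mulr1 sE.
Qed.

Lemma bdist_le y z : boundary Omega z -> bdist Omega y <= enorm (y - z).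
Proof.
move=> bz; apply: ge_inf; last by exists z.
by exists 0 => _ [w _ <-]; exact: sqrtr_ge0.
Qed.

Lemma bdist_ge0 y : 0 <= bdist Omega y.
Proof.
apply: lb_le_inf; last by move=> _ [w _ <-]; exact: sqrtr_ge0.
by have [_ bp] := sub_S S_p; exists (enorm (y - p)), p.
Qed.

Lemma bdist_segment z (w : R) : S z -> 0 <= w -> bdist Omega (z + w%:C *: eta) <= w.
Proof.
move=> Sz w0; have [_ bz] := sub_S Sz; apply: le_trans (bdist_le _ bz) _.
have [e1 _ _] := normalP S_p.
by rewrite addrAC subrr add0r enormZ normcR ger0_norm// e1 mulr1.
Qed.

Lemma cvg_segment_shift z (g : nat -> 'rV[C]_2) :
  (forall j, exists w : R, [/\ 0 <= w, w <= j.+1%:R^-1 & g j = z + w%:C *: eta]) ->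
  g @ \oo --> z.
Proof.
move=> H0 A /near_rV[e e0 eA].
have := near_infty_natSinv_lt (PosNum e0).
apply: filterS => j /= je; apply: eA => i; have [w [w0 wj ->]] := H0 j.
have [e1 _ _] := normalP S_p.
rewrite !mxE addrAC subrr add0r normcM normcR ger0_norm//.
apply: le_lt_trans je; apply: le_trans wj.
by rewrite ler_piMr// -e1 normc_coord_le.
Qed.

(** With starting heights at most 1 / (j + 1), every point of the curve lies above a point of [S],
    within that distance of the boundary. *)
Lemma slow_sequence s : S s -> exists gamma : nat -> R -> 'rV[C]_2,
  [/\ forall j, geodesic Omega 896 0 (gamma j),
      ereal_sup [set (bdist Omega (gamma j t))%:E | t in `[0%R, 1%R]%classic] @[j --> \oo] --> 0%E,
      gamma j 0 @[j --> \oo] --> p &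
      gamma j 1 @[j --> \oo] --> s].
Proof.
move=> Ss.
have /choice[gamma gE] : forall j : nat, exists g : R -> 'rV[C]_2,
  [/\ geodesic Omega 896 0 g,
      forall t, 0 <= t -> t <= 1 -> exists z (w : R),
        [/\ S z, 0 <= w, w <= j.+1%:R^-1 & g t = z + w%:C *: eta],
      exists w : R, [/\ 0 <= w, w <= j.+1%:R^-1 & g 0 = p + w%:C *: eta] &
      exists w : R, [/\ 0 <= w, w <= j.+1%:R^-1 & g 1 = s + w%:C *: eta]].
  by move=> j; apply: slow_geodesics => //; rewrite invr_gt0 ltr0n.
exists gamma; split.
- by move=> j; have [] := gE j.
- apply: (@squeeze_cvge _ _ _ _ (fun=> 0%E) _ (fun j : nat => (j.+1%:R^-1 : R)%:E)).
  + apply: nearW => j; apply/andP; split.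
      apply: le_ereal_sup_tmp; exists (bdist Omega (gamma j 0))%:E; last by rewrite lee_fin bdist_ge0.
      by exists 0 => //=; rewrite in_itv/= lexx ler01.
    apply: ge_ereal_sup => _ [t /= + <-]; rewrite in_itv/= => /andP[t0 t1].
    have [_ /(_ t t0 t1)[z [w [Sz w0 wj ->]]] _ _] := gE j.
    by rewrite lee_fin; apply: le_trans wj; exact: bdist_segment.
  + exact: cvg_cst.
  apply: cvg_EFin; first by apply: nearW.
  exact: cvg_harmonic.
- by apply: cvg_segment_shift => j; have [] := gE j.
by apply: cvg_segment_shift => j; have [] := gE j.
Qed.

(** Each point of [K] has a neighbourhood at positive distance from the boundary, and compactness
    makes the distance uniform. *)
Lemma compact_bdist K : compact K -> K `<=` Omega ->
  exists2 e : R, 0 < e & forall z, K z -> e <= bdist Omega z.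
Proof.
move=> /compact_near_coveringP cK KO.
pose P (e : R) z := forall w, boundary Omega w -> e <= enorm (z - w).
have : \forall e \near (0 : R)^'+, K `<=` P e.
  apply: (cK R (0 : R)^'+ P) => z Kz.
  have /near_rV[e e0 eE] : nbhs z Omega by apply: open_nbhs_nbhs; split => //; exact: KO.
  have e2 : 0 < e / 2 by lra.
  exists ([set y : 'rV[C]_2 | forall i, normc (y 0 i - z 0 i) < e / 2], [set d : R | d < e / 2]).
    by split; [apply/near_rV; exists (e / 2)|exact: nbhs_right_lt].
  move=> [y d]/= [yz de] w bw; rewrite leNgt; apply/negP => yw.
  apply: (boundary_notin bw); apply: eE => i.
  have h1 := yz i; have h2 := normc_coord_le (y - w) i; rewrite !mxE normcB in h2.
  have := le_normcD (w 0 i - y 0 i) (y 0 i - z 0 i); rewrite subrKA; lra.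
move=> [e /= e0 eE]; have e2 : 0 < e / 2 by lra.
exists (e / 2) => // z Kz; apply: lb_le_inf.
  by have [_ bp] := sub_S S_p; exists (enorm (z - p)), p.
move=> _ [w bw <-]; apply: (eE _ _ e2 _ Kz) => //=.
by rewrite sub0r normrN gtr0_norm//; lra.
Qed.

(** For a second point q of [S], the compact set that the geodesics from near p to near q have to
    meet stays at distance at least e from the boundary, whereas the curves of the sequence
    eventually stay closer than e. *)
Lemma not_visible : ~ visibility_property Omega.
Proof.
move=> vis; have [a [b [ab SE]]] := segment_S.
have [q Sq pq] : exists2 q, S q & p != q.
  case: (eqVneq p a) => [->|pa]; last first.
    by exists a => //; rewrite SE; exists 0; rewrite ?scale0r ?addr0//= in_itv/= lexx ler01.
  exists b => //; rewrite SE; exists 1; rewrite /= ?in_itv/= ?lexx ?ler01//.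
  by rewrite scale1r addrC subrK.
have [_ bp] := sub_S S_p; have [_ bq] := sub_S Sq.
have [||Up [Uq [K [nUp nUq cK KO HK]]]] := vis p q bp bq pq 896 0 => //; first lra.
have [e e0 eE] := compact_bdist cK KO.
have [gamma [geo sup0 g0 g1]] := slow_sequence Sq.
have n1 : \forall j \near \oo, Up (gamma j 0) by exact: (g0 _ nUp).
have n2 : \forall j \near \oo, Uq (gamma j 1) by exact: (g1 _ nUq).
have n3 : \forall j \near \oo,
    (ereal_sup [set (bdist Omega (gamma j t))%:E | t in `[0%R, 1%R]%classic] < e%:E)%E.
  by apply: (sup0 [set x | (x < e%:E)%E]); apply: open_nbhs_nbhs; split;
    [exact: open_ereal_lt_ereal|rewrite /= lte_fin].
have [j [h1 h2 h3]] : exists j, [/\ Up (gamma j 0), Uq (gamma j 1) &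
    (ereal_sup [set (bdist Omega (gamma j t))%:E | t in `[0%R, 1%R]%classic] < e%:E)%E].
  have [N _ NE] : \forall j \near \oo, [/\ Up (gamma j 0), Uq (gamma j 1) &
    (ereal_sup [set (bdist Omega (gamma j t))%:E | t in `[0%R, 1%R]%classic] < e%:E)%E].
    by near=> j; split; near: j.
  by exists N; apply: NE => /=.
have [_ gin _] := geo j.
have i0 : `[(0 : R), 1]%classic 0 by rewrite /= in_itv/= lexx ler01.
have i1 : `[(0 : R), 1]%classic 1 by rewrite /= in_itv/= lexx ler01.
have [t t01 Kt] := HK _ (geo j) (conj (gin _ i0) h1) (conj (gin _ i1) h2).
have := eE _ (subset_closure Kt); rewrite leNgt => /negP; apply.
rewrite -lte_fin; apply: le_lt_trans h3.
by apply: ereal_sup_ubound; exists t.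
Unshelve. all: end_near. Qed.

End Segment.

Theorem corollary18 (R : realType) (Omega : set 'rV[R[i]]_2)
    (p X : 'rV[R[i]]_2) (S : set 'rV[R[i]]_2) (delta : R) (H : R -> R)
    (domain_Omega : domain Omega)
    (C_convex_Omega : C_convex Omega)
    (no_line : contains_no_complex_line Omega)
    (bd_p : boundary Omega p)
    (unit_X : enorm X = 1)
    (tangent_X : complex_tangent_dir Omega p X)
    (segment_S : line_segment S)
    (sub_S : S `<=` complex_tangent_space Omega p `&` boundary Omega)
    (S_p : S p)
    (C1_S : forall s, S s -> C1_smooth_boundary_at Omega s)
    (tangent_S : forall s, S s ->
       real_tangent_space Omega p = real_tangent_space Omega s)
    (delta_gt0 : 0 < delta)
    (mH : measurable_fun `]0, delta[ H)
    (H_le : forall s r, S s -> 0 < r -> r < delta ->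
       ((H r)%:E <= dir_bdist Omega (inner_shift Omega s r) X)%E)
    (int_H : (\int[@lebesgue_measure R]_(r in `]0%R, delta[) (H r / r)%:E
              = +oo)%E) :
  ~ visibility_property Omega /\
  exists lambda : R, 1 < lambda /\
    forall s, S s ->
      exists gamma : nat -> R -> 'rV[R[i]]_2,
        [/\ forall j, geodesic Omega lambda 0 (gamma j),
            ereal_sup [set (bdist Omega (gamma j t))%:E
                      | t in `[0%R, 1%R]%classic] @[j --> \oo] --> 0%E,
            gamma j 0 @[j --> \oo] --> p &
            gamma j 1 @[j --> \oo] --> s].
Proof.
have [Oo _ _] := domain_Omega.
split.
  exact: (not_visible Oo unit_X tangent_X segment_S sub_S S_p C1_S tangent_S delta_gt0 H_le
            C_convex_Omega no_line mH int_H).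
exists 896; split; first lra.
exact: (slow_sequence Oo unit_X tangent_X segment_S sub_S S_p C1_S tangent_S delta_gt0 H_le
          C_convex_Omega no_line mH int_H).
Qed.
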